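(* Let $k$ be a commutative unital ring. The coextension $\overline{sh}_\infty=(1+\varphi_\infty B)\overline{sh}$ is associative up to homotopy, and the coextension $\overline{AW}_\infty=\overline{AW}(1+B\varphi_\infty)$ is coassociative up to homotopy (with $\varphi$, $\varphi_\infty$ as in the context). That is, for unital $k$-algebras $A,B,C$, naturally in them, the two maps $$\overline{sh}_\infty(\overline{sh}_\infty\otimes1),\quad \overline{sh}_\infty(1\otimes\overline{sh}_\infty):\ \Omega(A)\otimes\Omega(B)\otimes\Omega(C)\to\Omega(A\otimes B\otimes C)$$ are homotopic with respect to the differential $b+B$, and so are the two maps $$(\overline{AW}_\infty\otimes1)\overline{AW}_\infty,\quad(1\otimes\overline{AW}_\infty)\overline{AW}_\infty:\ \Omega(A\otimes B\otimes C)\to\Omega(A)\otimes\Omega(B)\otimes\Omega(C).$$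
   Context: For a unital $k$-algebra $A$, $\bar A=A/k1$ and $\Omega^n(A)=A\otimes\bar A^{\otimes n}$ (elements $a_0\mathrm da_1\cdots\mathrm da_n$) is the normalized Hochschild complex; $\Omega(A)$ is the differential graded algebra of noncommutative forms. $b(\omega\,\mathrm da)=(-1)^{|\omega|}(\omega a-a\omega)$ ($b=0$ on $\Omega^0$), $B(a_0\mathrm da_1\cdots\mathrm da_n)=\sum_{i=0}^n(-1)^{ni}\mathrm da_{n-i+1}\cdots\mathrm da_n\mathrm da_0\cdots\mathrm da_{n-i}$; both are extended to tensor products as graded derivations with the usual Koszul signs. In composites of operators, $B$ always denotes Connes' operator. In $\Omega(A\otimes B)$ write $a$ for $a\otimes1$ and $b$ for $1\otimes b$. $Sh_{p,q}$ denotes the sum of all $(p,q)$-shuffles of the listed sequence, multiplied by their signatures, each read as a product. $$\overline{sh}(a_0\mathrm da_1\cdots\mathrm da_p\otimes b_0\mathrm db_1\cdots\mathrm db_q)=(a_0\otimes b_0)Sh_{p,q}(\mathrm da_1,\dots,\mathrm da_p,\mathrm db_1,\dots,\mathrm db_q),$$ $$\overline{AW}((a_0\otimes b_0)\mathrm d(a_1\otimes b_1)\cdots\mathrm d(a_n\otimes b_n))=\sum_{i=0}^n a_{i+1}\cdots a_na_0\mathrm da_1\cdots\mathrm da_i\otimes b_0\cdots b_i\mathrm db_{i+1}\cdots\mathrm db_n.$$ $\varphi_n:\Omega^n(A\otimes B)\to\Omega^{n+1}(A\otimes B)$ is $\varphi_n=\sum_{0<p\le r\le n}(-1)^{n+r}\varphi_n^{r,p}$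 with, for $\omega\in\Omega^{n-r}(A\otimes B)$, $$\varphi_n^{r,p}(\omega\,\mathrm d(a_1\otimes b_1)\cdots\mathrm d(a_r\otimes b_r))=(a_{p+1}\cdots a_r\otimes1)\,\omega\,\mathrm d(b_1\cdots b_p)\,Sh_{p,r-p}(\mathrm da_1,\dots,\mathrm da_p,\mathrm db_{p+1},\dots,\mathrm db_r),$$ and $\varphi_\infty=\sum_{m\ge0}(\varphi B)^m\varphi$ (a finite sum on each element of given degree). These $\overline{sh}_\infty$ and $\overline{AW}_\infty$ commute with $b+B$; their components of degree $2m$ are $(\varphi B)^m\overline{sh}$ and $\overline{AW}(B\varphi)^m$. *)

(* Defs.v *)
From HB Require Import structures.
From mathcomp Require Import all_boot all_order all_algebra.
From mathcomp Require Import boolp classical_sets fsbigop.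

Set Implicit Arguments.
Unset Strict Implicit.
Unset Printing Implicit Defensive.

Import GRing.Theory.
Local Open Scope ring_scope.
Local Open Scope quotient_scope.

(* [pres R] is the k-module generated by G subject to the relators in R: the  *)
(* free k-module on G, an element of which is written as a formal linear      *)
(* combination [s : seq (k * G)], modulo the submodule generated by the       *)
(* combinations r such that R r.                                              *)
Section Presentation.
Variables (k : comPzRingType) (G : choiceType) (R : seq (k * G) -> Prop).
Implicit Types (s t : seq (k * G)) (g : G).

Definition fcoef s g : k := \sum_(p <- s | p.2 == g) p.1.

Definition pres_eq s t : Prop :=
  exists2 rs : seq (k * seq (k * G)),
    (forall r : k * seq (k * G), r \in rs -> R r.2) &
    (forall g, fcoef s g = fcoef t g + \sum_(r <- rs) r.1 * fcoef r.2 g).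

Lemma coef_cat s t g : fcoef (s ++ t) g = fcoef s g + fcoef t g.
Proof. by rewrite /fcoef big_cat. Qed.

Definition cscale (c : k) s := [seq (c * p.1, p.2) | p <- s].

Lemma coef_scale c s g : fcoef (cscale c s) g = c * fcoef s g.
Proof. by rewrite /fcoef big_map mulr_sumr. Qed.

Lemma pres_eq_coef s t : fcoef s =1 fcoef t -> pres_eq s t.
Proof. by move=> e; exists [::] => // g; rewrite big_nil addr0. Qed.

Lemma pres_eq_sym s t : pres_eq s t -> pres_eq t s.
Proof.
case=> rs Rrs e; exists [seq (- r.1, r.2) | r <- rs].
  by move=> r /mapP[r' /Rrs Rr ->].
move=> g; rewrite e big_map -addrA -big_split /= big1 ?addr0 // => r _.
by rewrite mulNr subrr.
Qed.

Lemma pres_eq_trans s t r : pres_eq s t -> pres_eq t r -> pres_eq s r.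
Proof.
case=> rs Rrs e [rs' Rrs' e']; exists (rs' ++ rs).
  by move=> u; rewrite mem_cat => /orP[/Rrs'|/Rrs].
by move=> g; rewrite e e' big_cat /= addrA.
Qed.

Lemma pres_eq_cat s s' t t' :
  pres_eq s s' -> pres_eq t t' -> pres_eq (s ++ t) (s' ++ t').
Proof.
case=> rs Rrs e [rs' Rrs' e']; exists (rs ++ rs').
  by move=> u; rewrite mem_cat => /orP[/Rrs|/Rrs'].
by move=> g; rewrite !coef_cat e e' big_cat /= addrACA.
Qed.

Lemma pres_eq_scale c s t : pres_eq s t -> pres_eq (cscale c s) (cscale c t).
Proof.
case=> rs Rrs e; exists [seq (c * r.1, r.2) | r <- rs].
  by move=> r /mapP[r' /Rrs Rr ->].
move=> g; rewrite !coef_scale e mulrDr mulr_sumr big_map; congr (_ + _).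
by apply: eq_bigr => r _; rewrite mulrA.
Qed.

Definition pres_eqb s t := `[< pres_eq s t >].

Lemma pres_eqb_equiv : equiv_class_of pres_eqb.
Proof.
split=> [s|s t|t s r]; first by apply/asboolP/pres_eq_coef.
  by apply/asboolP/asboolP => /pres_eq_sym.
by move=> /asboolP st /asboolP tr; apply/asboolP/(pres_eq_trans st).
Qed.

Canonical pres_equiv := EquivRelPack pres_eqb_equiv.

Definition pres := {eq_quot pres_equiv}.
HB.instance Definition _ := Choice.on pres.
HB.instance Definition _ := EqQuotient.on pres.

Lemma pres_eqP s t : reflect (pres_eq s t) (s == t %[mod pres]).
Proof. by rewrite eqmodE; apply: asboolP. Qed.

Lemma eq_presP s t : pres_eq s t -> \pi_pres s = \pi_pres t.
Proof. by move/pres_eqP/eqP. Qed.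

Lemma repr_pres s : pres_eq (repr (\pi_pres s)) s.
Proof. by apply/pres_eqP; rewrite reprK. Qed.

Definition pres_zero : pres := \pi_pres [::].
Definition pres_add (x y : pres) : pres := \pi_pres (repr x ++ repr y).
Definition pres_scale (c : k) (x : pres) : pres := \pi_pres (cscale c (repr x)).
Definition pres_opp (x : pres) : pres := pres_scale (-1) x.

Lemma pi_add s t : pres_add (\pi_pres s) (\pi_pres t) = \pi_pres (s ++ t).
Proof. exact/eq_presP/pres_eq_cat/repr_pres/repr_pres. Qed.

Lemma pi_scale c s : pres_scale c (\pi_pres s) = \pi_pres (cscale c s).
Proof. exact/eq_presP/pres_eq_scale/repr_pres. Qed.

Fact pres_addA : associative pres_add.
Proof.
by elim/(@quotW _ pres)=> s; elim/(@quotW _ pres)=> t; elim/(@quotW _ pres)=> r; rewrite !pi_add catA.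
Qed.

Fact pres_addC : commutative pres_add.
Proof.
elim/(@quotW _ pres)=> s; elim/(@quotW _ pres)=> t; rewrite !pi_add.
by apply/eq_presP/pres_eq_coef => g; rewrite !coef_cat addrC.
Qed.

Fact pres_add0 : left_id pres_zero pres_add.
Proof. by elim/(@quotW _ pres)=> s; rewrite pi_add. Qed.

Fact pres_addN : left_inverse pres_zero pres_opp pres_add.
Proof.
elim/(@quotW _ pres)=> s; rewrite /pres_opp pi_scale pi_add.
apply/eq_presP/pres_eq_coef => g.
by rewrite coef_cat coef_scale mulN1r addNr /fcoef big_nil.
Qed.

HB.instance Definition _ :=
  GRing.isZmodule.Build pres pres_addA pres_addC pres_add0 pres_addN.

Fact pres_scaleA a b x : pres_scale a (pres_scale b x) = pres_scale (a * b) x.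
Proof.
elim/(@quotW _ pres): x => s; rewrite !pi_scale.
by apply/eq_presP/pres_eq_coef => g; rewrite !coef_scale mulrA.
Qed.

Fact pres_scale1 : left_id 1 pres_scale.
Proof.
elim/(@quotW _ pres)=> s; rewrite pi_scale.
by apply/eq_presP/pres_eq_coef => g; rewrite coef_scale mul1r.
Qed.

Fact pres_scaleDr : right_distributive pres_scale +%R.
Proof.
move=> c; elim/(@quotW _ pres)=> s; elim/(@quotW _ pres)=> t.
by rewrite -[_ + _]/(pres_add _ _) !(pi_add, pi_scale) /cscale map_cat -pi_add.
Qed.

Fact pres_scaleDl x : {morph pres_scale^~ x : a b / a + b}.
Proof.
move=> a b; elim/(@quotW _ pres): x => s.
rewrite -[RHS]/(pres_add _ _) !(pi_scale, pi_add).
by apply/eq_presP/pres_eq_coef => g; rewrite coef_cat !coef_scale mulrDl.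
Qed.

HB.instance Definition _ := GRing.Zmodule_isLmodule.Build k pres
  pres_scaleA pres_scale1 pres_scaleDr pres_scaleDl.

Definition pres_gen g : pres := \pi_pres [:: (1, g)].

(* The k-linear map sending each generator g to F g.  It is independent of    *)
(* the representative, hence linear, as soon as F respects the relators; this *)
(* holds for every F to which [pres_lift] is applied below.                        *)
Definition pres_lift (P : lmodType k) (F : G -> P) (x : pres) : P :=
  \sum_(p <- repr x) p.1 *: F p.2.

Definition respects (P : lmodType k) (F : G -> P) :=
  forall r, R r -> \sum_(p <- r) p.1 *: F p.2 = 0.

Section LiftTheory.
Variables (P : lmodType k) (F : G -> P).

Lemma sum_coef s (U : seq G) : uniq U -> {subset map snd s <= U} ->
  \sum_(p <- s) p.1 *: F p.2 = \sum_(g <- U) fcoef s g *: F g.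
Proof.
move=> uU sU; under [RHS]eq_bigr => g _ do rewrite /fcoef scaler_suml.
rewrite (exchange_big_dep predT) //=; apply: eq_big_seq => p ps.
have pU : p.2 \in U by apply/sU/map_f.
under [RHS]eq_bigl => g do rewrite eq_sym.
by rewrite -big_filter filter_pred1_uniq // big_seq1.
Qed.

Hypothesis FR : respects F.

Lemma pres_eq_sum s t : pres_eq s t ->
  \sum_(p <- s) p.1 *: F p.2 = \sum_(p <- t) p.1 *: F p.2.
Proof.
case=> rs Rrs e.
pose U := undup (map snd (s ++ t) ++ flatten [seq map snd r.2 | r <- rs]).
have sub u : {subset map snd u <= map snd (s ++ t) ++
    flatten [seq map snd r.2 | r <- rs]} -> {subset map snd u <= U}.
  by move=> h g /h; rewrite mem_undup.
have Us : {subset map snd s <= U}.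
  by apply: sub => g gs; rewrite map_cat !mem_cat gs.
have Ut : {subset map snd t <= U}.
  by apply: sub => g gs; rewrite map_cat !mem_cat gs orbT.
have uU : uniq U by apply: undup_uniq.
rewrite (sum_coef uU Us) (sum_coef uU Ut).
under eq_bigr => g _ do rewrite e scalerDl.
rewrite big_split /= [X in _ + X](_ : _ = 0) ?addr0 //.
under eq_bigr => g _ do rewrite scaler_suml.
rewrite exchange_big /= big1_seq // => r /andP[_ rrs].
have Ur : {subset map snd r.2 <= U}.
  apply: sub => g gr; rewrite mem_cat; apply/orP; right.
  by apply/flattenP; exists (map snd r.2) => //; apply/mapP; exists r.
under eq_bigr => g _ do rewrite -scalerA.
by rewrite -scaler_sumr -(sum_coef uU Ur) FR ?scaler0 //; apply: Rrs.
Qed.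

Lemma lift_pi s : pres_lift F (\pi_pres s) = \sum_(p <- s) p.1 *: F p.2.
Proof. exact/pres_eq_sum/repr_pres. Qed.

Lemma lift_gen g : pres_lift F (pres_gen g) = F g.
Proof. by rewrite lift_pi big_seq1 scale1r. Qed.

Lemma lift_linear : linear (pres_lift F).
Proof.
move=> c; elim/(@quotW _ pres)=> s; elim/(@quotW _ pres)=> t.
rewrite -[c *: _ + _]/(pres_add (pres_scale c _) _) pi_scale pi_add !lift_pi.
rewrite big_cat /= big_map scaler_sumr; congr (_ + _).
by apply: eq_bigr => p _; rewrite scalerA.
Qed.

End LiftTheory.

Lemma pi_gen s : \pi_pres s = \sum_(p <- s) p.1 *: pres_gen p.2.
Proof.
elim: s => [|[c g] s IHs]; first by rewrite big_nil.
rewrite big_cons -IHs /= -[RHS]/(pres_add (pres_scale c _) _).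
by rewrite pi_scale pi_add /= mulr1.
Qed.

Lemma pres_rel r : R r -> \sum_(p <- r) p.1 *: pres_gen p.2 = 0.
Proof.
move=> Rr; rewrite -pi_gen; apply/eq_presP.
exists [:: (1, r)] => [q|g]; first by rewrite inE => /eqP->.
by rewrite big_seq1 /= mul1r /fcoef big_nil add0r.
Qed.

Lemma pres_ind (Q : pres -> Prop) :
  (forall g, Q (pres_gen g)) -> (forall c x y, Q x -> Q y -> Q (c *: x + y)) ->
  Q 0 -> forall x, Q x.
Proof.
move=> Qg Ql Q0; elim/(@quotW _ pres)=> s; rewrite pi_gen.
elim: s => [|p s IHs]; first by rewrite big_nil.
by rewrite big_cons; apply: Ql.
Qed.

End Presentation.

Section Tensor.
Variable k : comPzRingType.

Inductive tensor_rel (M N : lmodType k) : seq (k * (M * N)) -> Prop :=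
| TensorRelL c x x' y :
    tensor_rel [:: (1, (c *: x + x', y)); (- c, (x, y)); (-1, (x', y))]
| TensorRelR c x y y' :
    tensor_rel [:: (1, (x, c *: y + y')); (- c, (x, y)); (-1, (x, y'))].

Definition tensor (M N : lmodType k) := pres (@tensor_rel M N).
HB.instance Definition _ M N := GRing.Lmodule.on (tensor M N).

Definition tens (M N : lmodType k) (x : M) (y : N) : tensor M N :=
  pres_gen (@tensor_rel M N) (x, y).

Definition tlift (M N P : lmodType k) (F : M -> N -> P) : tensor M N -> P :=
  pres_lift (fun p => F p.1 p.2).

End Tensor.

Notation "M ⊗ N" := (tensor M N) (at level 40, left associativity).
Notation "x ⊗ₜ y" := (tens x y) (at level 40, left associativity) : ring_scope.

Section TensorTheory.
Variable k : comPzRingType.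
Implicit Types M N P : lmodType k.

Lemma rel3 (P : lmodType k) (c : k) (x y z : P) :
  1 *: x + ((- c) *: y + ((-1) *: z + 0)) = 0 <-> x = c *: y + z.
Proof.
rewrite !scaleNr !scale1r addr0 -opprD; split=> [/eqP|->].
  by rewrite subr_eq0 => /eqP.
exact: subrr.
Qed.

Lemma tens_linearl M N (y : N) : linear (fun x : M => x ⊗ₜ y).
Proof.
move=> c x x'; apply/rel3.
by have := pres_rel (TensorRelL c x x' y); rewrite !big_cons big_nil.
Qed.

Lemma tens_linearr M N (x : M) : linear (fun y : N => x ⊗ₜ y).
Proof.
move=> c y y'; apply/rel3.
by have := pres_rel (TensorRelR c x y y'); rewrite !big_cons big_nil.
Qed.

Lemma linear0f M N (f : M -> N) : linear f -> f 0 = 0.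
Proof.
by move=> fl; have := fl (-1) 0 0; rewrite scaler0 add0r scaleNr scale1r addNr.
Qed.

Lemma tensor_ind M N (Q : M ⊗ N -> Prop) :
  (forall x y, Q (x ⊗ₜ y)) -> (forall c x y, Q x -> Q y -> Q (c *: x + y)) ->
  Q 0 -> forall x, Q x.
Proof. by move=> Qt; apply: pres_ind; case. Qed.

Lemma tensor_eq M N P (f g : M ⊗ N -> P) : linear f -> linear g ->
  (forall a b, f (a ⊗ₜ b) = g (a ⊗ₜ b)) -> f =1 g.
Proof.
move=> fl gl e; apply: tensor_ind => [//|c x y ex ey|].
  by rewrite fl gl ex ey.
by rewrite !linear0f.
Qed.

Section Lift.
Variables (M N P : lmodType k) (F : M -> N -> P).
Hypotheses (Fl : forall y, linear (F^~ y)) (Fr : forall x, linear (F x)).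

Lemma bilinear_respects :
  respects (@tensor_rel k M N) (fun p => F p.1 p.2).
Proof.
by move=> r [c x x' y|c x y y']; rewrite !big_cons big_nil; apply/rel3;
  [exact: Fl | exact: Fr].
Qed.

Lemma tlift_tens x y : tlift F (x ⊗ₜ y) = F x y.
Proof. exact: (lift_gen bilinear_respects). Qed.

Lemma tlift_linear : linear (tlift F).
Proof. exact: (lift_linear bilinear_respects). Qed.

End Lift.

End TensorTheory.

(* Unital associative k-algebras, possibly zero. The library's [algType] is   *)
(* restricted to nonzero rings, a class that is not closed under the tensor   *)
(* product over a general k.                                                  *)
HB.mixin Record Lmodule_isUnitalAlgebra (k : comPzRingType) A
    of GRing.Lmodule k A := {
  algone : A;
  algmul : A -> A -> A;
  algmulA : associative algmul;
  algmul1x : left_id algone algmul;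
  algmulx1 : right_id algone algmul;
  algmul_linearl : forall y, linear (fun x => algmul x y);
  algmul_linearr : forall x, linear (algmul x)
}.

#[short(type="unitalAlgType")]
HB.structure Definition UnitalAlgebra (k : comPzRingType) :=
  {A of GRing.Lmodule k A & Lmodule_isUnitalAlgebra k A}.

Notation "𝟙" := (@algone _ _) : ring_scope.
Notation "x ∙ y" := (algmul x y) (at level 40, left associativity) : ring_scope.

Definition algebra_morphism (k : comPzRingType) (A B : unitalAlgType k)
  (f : A -> B) : Prop :=
  [/\ linear f, f 𝟙 = 𝟙 & {morph f : x y / x ∙ y}].

Definition algprod (k : comPzRingType) (A : unitalAlgType k) (s : seq A) : A :=
  foldr algmul 𝟙 s.

Section TensorAlgebra.
Variables (k : comPzRingType) (A B : unitalAlgType k).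
Local Notation T := (A ⊗ B).
Implicit Types (x y z : T).

Definition tensor_one : T := 𝟙 ⊗ₜ 𝟙.

Definition tensor_mul x y : T :=
  tlift (fun a b => tlift (fun a' b' => (a ∙ a') ⊗ₜ (b ∙ b')) y) x.

Let mul1 (a : A) (b : B) y : T :=
  tlift (fun a' b' => (a ∙ a') ⊗ₜ (b ∙ b')) y.

Lemma mul1_tens a b a' b' : mul1 a b (a' ⊗ₜ b') = (a ∙ a') ⊗ₜ (b ∙ b').
Proof.
apply: tlift_tens => [y c x x'|x c y y'].
  by rewrite algmul_linearr tens_linearl.
by rewrite algmul_linearr tens_linearr.
Qed.

Lemma mul1_linear a b : linear (mul1 a b).
Proof.
apply: (tlift_linear (F := fun a' b' => (a ∙ a') ⊗ₜ (b ∙ b'))).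
  by move=> y c x x'; rewrite algmul_linearr tens_linearl.
by move=> x c y y'; rewrite algmul_linearr tens_linearr.

Qed.

Lemma mul1_linearA b y : linear (fun a => mul1 a b y).
Proof.
move=> c a a'; move: y.
apply: tensor_eq => [||x z].
- exact: mul1_linear.
- move=> d u v; rewrite !mul1_linear !scalerDr !scalerA mulrC.
  by rewrite -!addrA; congr (_ + _); rewrite !addrA; congr (_ + _); rewrite addrC.
- by rewrite !mul1_tens algmul_linearl tens_linearl.
Qed.

Lemma mul1_linearB a y : linear (fun b => mul1 a b y).
Proof.
move=> c b b'; move: y.
apply: tensor_eq => [||x z].
- exact: mul1_linear.
- move=> d u v; rewrite !mul1_linear !scalerDr !scalerA mulrC.
  by rewrite -!addrA; congr (_ + _); rewrite !addrA; congr (_ + _); rewrite addrC.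
- by rewrite !mul1_tens algmul_linearl tens_linearr.
Qed.

Lemma tensor_mul_tensl a b y : tensor_mul (a ⊗ₜ b) y = mul1 a b y.
Proof.
by apply: tlift_tens => [b'|a']; [exact: mul1_linearA | exact: mul1_linearB].
Qed.

Lemma tensor_mul_tens a b a' b' :
  tensor_mul (a ⊗ₜ b) (a' ⊗ₜ b') = (a ∙ a') ⊗ₜ (b ∙ b').
Proof. by rewrite tensor_mul_tensl mul1_tens. Qed.

Fact tensor_mul_linearl y : linear (fun x => tensor_mul x y).
Proof.
by apply: (tlift_linear (F := fun a b => mul1 a b y)) => [b'|a']; [exact: mul1_linearA | exact: mul1_linearB].
Qed.

Fact tensor_mul_linearr x : linear (tensor_mul x).
Proof.
move=> c y z; move: x; apply: tensor_eq => [||a b].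
- exact: tensor_mul_linearl.
- move=> d u v; rewrite !tensor_mul_linearl !scalerDr !scalerA mulrC.
  by rewrite -!addrA; congr (_ + _); rewrite !addrA; congr (_ + _); rewrite addrC.
- by rewrite !tensor_mul_tensl mul1_linear.
Qed.

Fact tensor_mulA : associative tensor_mul.
Proof.
move=> x y z; move: x; apply: tensor_eq => [||a b].
- exact: tensor_mul_linearl.
- by move=> c u v; rewrite !tensor_mul_linearl.
move: y; apply: tensor_eq => [||a' b'].
- by move=> c u v; rewrite tensor_mul_linearl tensor_mul_linearr.
- by move=> c u v; rewrite tensor_mul_linearr tensor_mul_linearl.
move: z; apply: tensor_eq => [||a'' b''].
- by move=> c u v; rewrite !tensor_mul_linearr.
- exact: tensor_mul_linearr.
by rewrite !tensor_mul_tens !algmulA.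
Qed.

Fact tensor_mul1x : left_id tensor_one tensor_mul.
Proof.
apply: tensor_eq => [||a b]; [exact: tensor_mul_linearr|by []|].
by rewrite tensor_mul_tens !algmul1x.
Qed.

Fact tensor_mulx1 : right_id tensor_one tensor_mul.
Proof.
apply: tensor_eq => [||a b]; [exact: tensor_mul_linearl|by []|].
by rewrite tensor_mul_tens !algmulx1.
Qed.

HB.instance Definition _ := Lmodule_isUnitalAlgebra.Build k T tensor_mulA
  tensor_mul1x tensor_mulx1 tensor_mul_linearl tensor_mul_linearr.

End TensorAlgebra.

Section TensorMaps.
Variable k : comPzRingType.
Implicit Types M N P : lmodType k.

Definition tmap M M' N N' (f : M -> M') (g : N -> N') : M ⊗ N -> M' ⊗ N' :=
  tlift (fun x y => f x ⊗ₜ g y).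

Definition tassoc M N P : M ⊗ N ⊗ P -> M ⊗ (N ⊗ P) :=
  tlift (fun t z => tlift (fun x y => x ⊗ₜ (y ⊗ₜ z)) t).

Definition tassocV M N P : M ⊗ (N ⊗ P) -> M ⊗ N ⊗ P :=
  tlift (fun x => tlift (fun y z => x ⊗ₜ y ⊗ₜ z)).

(* The odd derivation extending D on the left factor and E on the right one;  *)
(* [e] is the grading involution x |-> (-1)^|x| x of the left factor.         *)
Definition tder M N (D e : M -> M) (E : N -> N) (z : M ⊗ N) : M ⊗ N :=
  tmap D id z + tmap e E z.

Definition tdeg M N (degM : nat -> M -> Prop) (degN : nat -> N -> Prop)
    (n : nat) (z : M ⊗ N) : Prop :=
  exists2 s : seq (M * N),
    (forall p : M * N, p \in s ->
       exists i j, [/\ (i + j)%N = n, degM i p.1 & degN j p.2]) &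
    z = \sum_(p <- s) p.1 ⊗ₜ p.2.

End TensorMaps.

Section Forms.
Variable k : comPzRingType.
Implicit Types A : unitalAlgType k.

(* Omega A is the direct sum over n of A ⊗ (A/k1)^{⊗n}. The generator         *)
(* (a_0, [:: a_1; ...; a_n]) stands for a_0 da_1 ... da_n; the relators say   *)
(* that it is linear in each a_i and vanishes when a_i = 1 for some i > 0.    *)
Inductive form_rel A : seq (k * (A * seq A)) -> Prop :=
| FormRel0 c a a' w :
    form_rel [:: (1, (c *: a + a', w)); (- c, (a, w)); (-1, (a', w))]
| FormRelS c a0 u a a' v :
    form_rel [:: (1, (a0, u ++ (c *: a + a') :: v));
                 (- c, (a0, u ++ a :: v)); (-1, (a0, u ++ a' :: v))]
| FormRel1 a0 u v : form_rel [:: (1, (a0, u ++ 𝟙 :: v))].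

Definition Omega A := pres (@form_rel A).
HB.instance Definition _ A := GRing.Lmodule.on (Omega A).

Definition dform A (a0 : A) (w : seq A) : Omega A := pres_gen (@form_rel A) (a0, w).

Definition flift A (P : lmodType k) (F : A -> seq A -> P) : Omega A -> P :=
  pres_lift (fun p => F p.1 p.2).

Definition Omega_deg A (n : nat) (x : Omega A) : Prop :=
  exists2 s : seq (A * seq A),
    all (fun p => size p.2 == n) s & x = \sum_(p <- s) dform p.1 p.2.

Definition Omega_map A A' (f : A -> A') : Omega A -> Omega A' :=
  flift (fun a0 w => dform (f a0) (map f w)).

Definition grading A : Omega A -> Omega A :=
  flift (fun a0 w => (-1) ^+ size w *: dform a0 w).

(* The product (a_0 da_1 ... da_n) a, which the Leibniz rule                  *)
(* da_i a = d(a_i a) - a_i da turns into                                      *)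
(* sum_{0 <= i <= n} (-1)^(n-i) a_0 da_1 ... d(a_i a_{i+1}) ... da_n da,      *)
(* with a_{n+1} = a, and with (a_0 a_1) da_2 ... da for i = 0.                *)
Definition dform_rmul A (a0 : A) (w : seq A) (a : A) : Omega A :=
  let s := a0 :: rcons w a in
  \sum_(i < (size w).+1)
    let t := take i s ++ (nth 0 s i ∙ nth 0 s i.+1) :: drop i.+2 s in
    (-1) ^+ (size w - i) *: dform (head 0 t) (behead t).

(* b(omega da) = (-1)^|omega| (omega a - a omega), b = 0 in degree 0.         *)
Definition hochschild A : Omega A -> Omega A :=
  flift (fun a0 w =>
    if w is a1 :: w' then
      let u := belast a1 w' in let a := last a1 w' in
      (-1) ^+ size u *: (dform_rmul a0 u a - dform (a ∙ a0) u)
    else 0).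

Definition connes A : Omega A -> Omega A :=
  flift (fun a0 w => let s := a0 :: w in
    \sum_(i < size s) (-1) ^+ (size w * i) *: dform 𝟙 (rotr i s)).

Definition bB A (x : Omega A) : Omega A := hochschild x + connes x.

End Forms.

(* The shuffles of s and t, each with its signature (true when odd): putting  *)
(* the head of t first moves it across all of s.                              *)
Fixpoint shuffles (T : Type) (s : seq T) : seq T -> seq (bool * seq T) :=
  fix shuffles_s t :=
    match s, t with
    | [::], _ => [:: (false, t)]
    | _, [::] => [:: (false, s)]
    | x :: s', y :: t' =>
        [seq (e.1, x :: e.2) | e <- shuffles s' t] ++
        [seq (odd (size s) (+) e.1, y :: e.2) | e <- shuffles_s t']
    end.

Section EilenbergZilber.
Variables (k : comPzRingType) (A B : unitalAlgType k).

Definition inA (a : A) : A ⊗ B := a ⊗ₜ 𝟙.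
Definition inB (b : B) : A ⊗ B := 𝟙 ⊗ₜ b.

(* (a_0 dw_1 ... dw_m) Sh(da_1, ..., da_p, db_1, ..., db_q)                   *)
Definition dform_sh (a0 : A ⊗ B) (w : seq (A ⊗ B)) (s : seq A) (t : seq B) :
    Omega (A ⊗ B) :=
  \sum_(e <- shuffles (map inA s) (map inB t))
    (-1) ^+ e.1 *: dform a0 (w ++ e.2).

Definition sh : Omega A ⊗ Omega B -> Omega (A ⊗ B) :=
  tlift (fun x y =>
    flift (fun a0 s => flift (fun b0 t => dform_sh (a0 ⊗ₜ b0) [::] s t) y) x).

(* Extends F, given on (a_0 ⊗ b_0) d(a_1 ⊗ b_1) ... d(a_n ⊗ b_n) as           *)
(* F a_0 b_0 [:: (a_1, b_1); ...; (a_n, b_n)], to Omega (A ⊗ B).              *)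
Fixpoint wlift (P : lmodType k) (F : seq (A * B) -> P) (w : seq (A ⊗ B)) : P :=
  if w is t :: w' then
    tlift (fun a b => wlift (fun s => F ((a, b) :: s)) w') t
  else F [::].

Definition tflift (P : lmodType k) (F : A -> B -> seq (A * B) -> P) :
    Omega (A ⊗ B) -> P :=
  flift (fun t0 w => tlift (fun a0 b0 => wlift (F a0 b0) w) t0).

Definition AW : Omega (A ⊗ B) -> Omega A ⊗ Omega B :=
  tflift (fun a0 b0 s =>
    let a := unzip1 s in let b := unzip2 s in
    \sum_(i < (size s).+1)
      dform (algprod (drop i a) ∙ a0) (take i a) ⊗ₜ
      dform (b0 ∙ algprod (take i b)) (drop i b)).

Definition phi_rp (r p : nat) (a0 : A) (b0 : B) (s : seq (A * B)) :
    Omega (A ⊗ B) :=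
  let w := take (size s - r) s in
  let a := unzip1 (drop (size s - r) s) in
  let b := unzip2 (drop (size s - r) s) in
  dform_sh (inA (algprod (drop p a)) ∙ (a0 ⊗ₜ b0))
    (rcons [seq q.1 ⊗ₜ q.2 | q <- w] (inB (algprod (take p b))))
    (take p a) (drop p b).

Definition phi : Omega (A ⊗ B) -> Omega (A ⊗ B) :=
  tflift (fun a0 b0 s =>
    \sum_(r < (size s).+1) \sum_(p < r.+1 | (0 < p)%N)
      (-1) ^+ (size s + r) *: phi_rp r p a0 b0 s).

(* A sum with finitely many nonzero terms: every d in (phi B)^m phi(omega)    *)
(* carries at least one of the at most 2n+2 factors a_i, b_i of a summand of  *)
(* omega of degree n, so the terms with n + 2m + 1 > 2n + 2 are zero.         *)
Definition phi_inf (x : Omega (A ⊗ B)) : Omega (A ⊗ B) :=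
  \sum_(m \in [set: nat]) iter m (fun y => phi (connes y)) (phi x).

Definition sh_inf (z : Omega A ⊗ Omega B) : Omega (A ⊗ B) :=
  sh z + phi_inf (connes (sh z)).

Definition AW_inf (x : Omega (A ⊗ B)) : Omega A ⊗ Omega B :=
  AW (x + connes (phi_inf x)).

End EilenbergZilber.

Section Triple.
Variables (k : comPzRingType) (A B C : unitalAlgType k).

Definition Omega3 : lmodType k := Omega A ⊗ Omega B ⊗ Omega C.

Definition Omega3_deg : nat -> Omega3 -> Prop :=
  tdeg (tdeg (@Omega_deg k A) (@Omega_deg k B)) (@Omega_deg k C).

Definition bB3 : Omega3 -> Omega3 :=
  tder (tder (@bB k A) (@grading k A) (@bB k B))
    (tmap (@grading k A) (@grading k B)) (@bB k C).

Definition sh_inf_left (z : Omega3) : Omega (A ⊗ B ⊗ C) :=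
  sh_inf (tmap (@sh_inf k A B) id z).

Definition sh_inf_right (z : Omega3) : Omega (A ⊗ B ⊗ C) :=
  Omega_map (@tassocV k A B C) (sh_inf (tmap id (@sh_inf k B C) (tassoc z))).

Definition AW_inf_left (x : Omega (A ⊗ B ⊗ C)) : Omega3 :=
  tmap (@AW_inf k A B) id (AW_inf x).

Definition AW_inf_right (x : Omega (A ⊗ B ⊗ C)) : Omega3 :=
  tassocV (tmap id (@AW_inf k B C) (AW_inf (Omega_map (@tassoc k A B C) x))).

End Triple.

Definition Omega3_map (k : comPzRingType) (A B C A' B' C' : unitalAlgType k)
    (f : A -> A') (g : B -> B') (h : C -> C') : Omega3 A B C -> Omega3 A' B' C' :=
  tmap (tmap (Omega_map f) (Omega_map g)) (Omega_map h).

(* h is a homotopy from g to f, with respect to the differentials dX and dY,  *)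
(* of the kind relating coextensions: the latter are sums of components of    *)
(* degrees 2m, m >= 0, and h is a sum of components of degrees 2m+1, m >= 0.  *)
Definition homotopy (k : comPzRingType) (X Y : lmodType k)
    (degX : nat -> X -> Prop) (degY : nat -> Y -> Prop)
    (dX : X -> X) (dY : Y -> Y) (f g h : X -> Y) : Prop :=
  (forall n x, degX n x -> exists N (y : nat -> Y),
     (forall m, degY (n + m.*2.+1)%N (y m)) /\ h x = \sum_(m < N) y m) /\
  (forall x, f x - g x = dY (h x) + h (dX x)).

Section LinearClosure.
Variable k : comPzRingType.
Implicit Types M N P : lmodType k.

Lemma lin_sum M N (I : Type) (r : seq I) (Q : pred I) (f : I -> M -> N) :
  (forall i, Q i -> linear (f i)) -> linear (fun x => \sum_(i <- r | Q i) f i x).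
Proof.
move=> fl c x y; rewrite scaler_sumr -big_split /=.
by apply: eq_bigr => i Qi; rewrite fl.
Qed.

Lemma lin_scale M N (d : k) (f : M -> N) :
  linear f -> linear (fun x => d *: f x).
Proof. by move=> fl c x y; rewrite fl scalerDr !scalerA mulrC. Qed.

Lemma lin_add M N (f g : M -> N) :
  linear f -> linear g -> linear (fun x => f x + g x).
Proof. by move=> fl gl c x y; rewrite fl gl scalerDr addrACA. Qed.

Lemma lin_comp M N P (f : N -> P) (g : M -> N) :
  linear f -> linear g -> linear (fun x => f (g x)).
Proof. by move=> fl gl c x y; rewrite gl fl. Qed.

Lemma lin_eq M N (f g : M -> N) : f =1 g -> linear g -> linear f.
Proof. by move=> e gl c x y; rewrite !e gl. Qed.

End LinearClosure.

Section FormFacts.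
Variables (k : comPzRingType) (A : unitalAlgType k).
Implicit Types (P : lmodType k) (a : A) (s u v w : seq A).

Definition compat P (F : A -> seq A -> P) :=
  [/\ forall w, linear (F^~ w),
      forall a0 u v, linear (fun a => F a0 (u ++ a :: v)) &
      forall a0 u v, F a0 (u ++ 𝟙 :: v) = 0].

Lemma form_compat : compat (@dform k A).
Proof.
split.
- move=> w c a a'; apply/rel3.
  by have := pres_rel (FormRel0 c a a' w); rewrite !big_cons big_nil.
- move=> a0 u v c a a'; apply/rel3.
  by have := pres_rel (FormRelS c a0 u a a' v); rewrite !big_cons big_nil.
- move=> a0 u v; have := pres_rel (FormRel1 a0 u v).
  by rewrite big_seq1 scale1r.
Qed.

Lemma compat_respects P (F : A -> seq A -> P) : compat F ->
  respects (@form_rel k A) (fun p => F p.1 p.2).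
Proof.
move=> [F0 FS F1] r []; first by
  move=> c a a' w; rewrite !big_cons big_nil; apply/rel3; apply: F0.
  by move=> c a0 u a a' v; rewrite !big_cons big_nil; apply/rel3; apply: FS.
by move=> a0 u v; rewrite big_seq1 F1 scaler0.
Qed.

Lemma flift_form P (F : A -> seq A -> P) a0 w : compat F ->
  flift F (dform a0 w) = F a0 w.
Proof. by move/compat_respects => h; apply: (lift_gen h). Qed.

Lemma flift_linear P (F : A -> seq A -> P) : compat F -> linear (flift F).
Proof. by move/compat_respects => h; apply: (lift_linear h). Qed.

Lemma Omega_ind (Q : Omega A -> Prop) :
  (forall a0 w, Q (dform a0 w)) -> (forall c x y, Q x -> Q y -> Q (c *: x + y)) ->
  Q 0 -> forall x, Q x.
Proof. by move=> Qt; apply: pres_ind; case. Qed.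

Definition G0 s : Omega A := dform (head 0 s) (behead s).

Definition wcompat P (G : seq A -> P) :=
  (forall u v, linear (fun a => G (u ++ a :: v))) /\
  (forall x u v, G (x :: u ++ 𝟙 :: v) = 0).

Lemma wcompatP P (G : seq A -> P) : wcompat G -> compat (fun a0 w => G (a0 :: w)).
Proof.
case=> Gl G1; split=> //.
- by move=> w; apply: (Gl [::] w).
- by move=> a0 u v; apply: (Gl (a0 :: u) v).
Qed.

Lemma G0_compat : wcompat G0.
Proof.
case: form_compat => F0 FS F1; split.
- move=> [|x u] v; [exact: F0 | exact: FS].
- by move=> x u v; apply: F1.
Qed.

Lemma wcompat_sum P (G : nat -> nat -> seq A -> P) (b : nat -> nat):
  (forall n i u v, linear (fun a => G n i (u ++ a :: v))) ->
  (forall n x u v, n = size (x :: u ++ 𝟙 :: v) ->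
     \sum_(i < b n) G n i (x :: u ++ 𝟙 :: v) = 0) ->
  wcompat (fun s => \sum_(i < b (size s)) G (size s) i s).
Proof.
move=> Gl G1; split=> [u v|x u v]; last exact: G1.
apply: (@lin_eq _ _ _ _ (fun a =>
   \sum_(i < b (size u + (size v).+1)%N) G (size u + (size v).+1)%N i (u ++ a :: v))).
  by move=> a; rewrite size_cat.
by apply: lin_sum => i _.
Qed.

Lemma grading_form a0 w : grading (dform a0 w) = (-1) ^+ size w *: dform a0 w.
Proof.
apply: flift_form; split=> [w'|a u v|a u v]; case: form_compat => F0 FS F1.
- exact: lin_scale.
- apply: (@lin_eq _ _ _ _ (fun a' => (-1) ^+ (size u + (size v).+1) *: dform a (u ++ a' :: v))).
    by move=> a'; rewrite size_cat.
  exact: lin_scale.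
- by rewrite F1 scaler0.
Qed.

Lemma rot_slot n u v : exists u' v', forall a, rot n (u ++ a :: v) = u' ++ a :: v'.
Proof.
rewrite /rot; case: (leqP n (size u)) => h.
  exists (drop n u), (v ++ take n u) => a.
  rewrite drop_cat take_cat; case: ltnP => h'; first by rewrite -catA.
  have e : n = size u by apply/eqP; rewrite eqn_leq h h'.
  by rewrite e subnn drop0 take0 cats0 drop_size take_size.
exists (drop (n - size u).-1 v ++ u), (take (n - size u).-1 v) => a.
rewrite drop_cat take_cat ltnNge ltnW //=.
by case: (n - size u)%N (subn_gt0 (size u) n) => [|m] /=; rewrite ?h // -?catA.
Qed.

Lemma rotr_slot n u v : exists u' v', forall a, rotr n (u ++ a :: v) = u' ++ a :: v'.
Proof.
have [u' [v' e]] := rot_slot (size u + (size v).+1 - n) u v.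
by exists u', v' => a; rewrite /rotr size_cat /= e.
Qed.

Lemma connes_form a0 w :
  connes (dform a0 w) = \sum_(i < (size w).+1) (-1) ^+ (size w * i) *: dform 𝟙 (rotr i (a0 :: w)).
Proof.
rewrite /connes flift_form //.
apply: (@wcompatP _ (fun s => \sum_(i < size s) (-1) ^+ ((size s).-1 * i) *: dform 𝟙 (rotr i s))).
case: form_compat => F0 FS F1.
apply: (@wcompat_sum _ (fun n i s => (-1) ^+ (n.-1 * i) *: dform 𝟙 (rotr i s)) id).
- move=> n i u v; apply: lin_scale.
  have [u' [v' e]] := rotr_slot i u v.
  by apply: (@lin_eq _ _ _ _ (fun a => dform 𝟙 (u' ++ a :: v'))) => [a|//]; rewrite e.
- move=> n x u v ->; apply: big1 => i _.
  have [u' [v' e]] := rotr_slot i (x :: u) v.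
  rewrite (_ : rotr i _ = u' ++ 𝟙 :: v') ?F1 ?scaler0 //.
  exact: e.
Qed.


Definition merge i s : seq A :=
  take i s ++ (nth 0 s i ∙ nth 0 s i.+1) :: drop i.+2 s.

Lemma mergeS i x s : merge i.+1 (x :: s) = x :: merge i s. Proof. by []. Qed.
Lemma merge0 x y s : merge 0 (x :: y :: s) = x ∙ y :: s.
Proof. by rewrite /merge /= drop0. Qed.

Definition slotlinear P (G : seq A -> P) := forall u v, linear (fun a => G (u ++ a :: v)).

Lemma slotlinear_cons P (G : seq A -> P) x : slotlinear G -> slotlinear (fun s => G (x :: s)).
Proof. by move=> h u v; apply: (h (x :: u) v). Qed.

Lemma merge_linear P i u v (G : seq A -> P) : slotlinear G ->
  (i < size u + size v)%N -> linear (fun a => G (merge i (u ++ a :: v))).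
Proof.
elim: u i G => [|x u IHu] [|i] G Gl h.
- case: v h => [//|y v] _.
  apply: (@lin_eq _ _ _ _ (fun a => G (a ∙ y :: v))) => [a|]; first by rewrite merge0.
  by apply: (lin_comp (Gl [::] v)); apply: algmul_linearl.
- exact: (Gl [::] (merge i v)).
- case: u {IHu} h => [|y u] _.
    apply: (@lin_eq _ _ _ _ (fun a => G (x ∙ a :: v))) => [a|]; first by rewrite merge0.
    by apply: (lin_comp (Gl [::] v)); apply: algmul_linearr.
  apply: (@lin_eq _ _ _ _ (fun a => G ((x ∙ y :: u) ++ a :: v))) => [a|]; last exact: Gl.
  by rewrite !cat_cons merge0.
- have h' : (i < size u + size v)%N by rewrite -ltnS -addSn.
  exact: (IHu i (fun s => G (x :: s)) (@slotlinear_cons _ _ x Gl) h').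
Qed.

Definition DD P (G : seq A -> P) s : P := \sum_(i < (size s).-1) (-1) ^+ i *: G (merge i s).

Lemma DD_cons P (G : seq A -> P) x y s :
  DD G (x :: y :: s) = G (x ∙ y :: s) - DD (fun s => G (x :: s)) (y :: s).
Proof.
rewrite /DD /= big_ord_recl /= merge0 expr0 scale1r; congr (_ + _).
rewrite -sumrN; apply: eq_bigr => i _.
by rewrite /bump /= add1n mergeS exprS -scalerA scaleNr scale1r.
Qed.

Lemma DD_kill P (G : seq A -> P) x u v :
  (forall x u v, G (x :: u ++ 𝟙 :: v) = 0) ->
  DD G (x :: u ++ 𝟙 :: v) = if v is [::] then (-1) ^+ size u *: G (x :: u) else 0.
Proof.
elim: u v x G => [|y u IHu] v x G G1.
  rewrite cat0s DD_cons algmulx1; case: v => [|y v].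
    by rewrite {1}/DD big_ord0 subr0 expr0 scale1r.
  rewrite DD_cons algmul1x /DD opprB addrCA subrr addr0 big1 // => i _.
  by rewrite (G1 x [::]) scaler0.
rewrite cat_cons DD_cons -cat_cons (G1 (x ∙ y) u) sub0r IHu.
  by case: (v) => [|z v0]; rewrite ?oppr0 // -scaleNr exprS mulN1r.
by move=> z s t; rewrite -cat_cons G1.
Qed.

Definition bword s : Omega A :=
  DD G0 s + (-1) ^+ (size s).-1 *: G0 ((last 0 s ∙ head 0 s) :: behead (belast (head 0 s) (behead s))).

Lemma bword_eq x w a : bword (x :: rcons w a) =
  (-1) ^+ size w *: (dform_rmul x w a - dform (a ∙ x) w).
Proof.
rewrite /bword /DD /= size_rcons /= last_rcons belast_rcons /= scalerBr; congr (_ + _).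
  rewrite scaler_sumr; apply: eq_bigr => i _; rewrite scalerA -exprD.
  congr (_ *: _); rewrite -signr_odd -[RHS]signr_odd oddD oddB ?addKb //.
  by rewrite -ltnS.
by rewrite exprS mulN1r scaleNr.
Qed.

Lemma bword_wcompat : wcompat (fun s => if size s == 1%N then 0 else bword s).
Proof.
have [Gl G1] := G0_compat; split=> [u v|x u v]; last first.
  rewrite /= size_cat addnS /= /bword DD_kill //= size_cat /= addnS /=.
  case: v => [|z v].
    rewrite addn0 last_cat /= algmul1x cats1 belast_rcons /=.
    by rewrite exprS mulN1r scaleNr subrr.
  rewrite add0r last_cat /= (_ : belast x _ = x :: u ++ 𝟙 :: belast z v) ?G1 ?scaler0 //.
  by rewrite belast_cat /= -cat_rcons -lastI.
apply: (@lin_eq _ _ _ _ (fun a =>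
  if (size u + size v)%N == 0%N then 0 else
   \sum_(i < (size u + size v)%N) (-1) ^+ i *: G0 (merge i (u ++ a :: v)) +
   (-1) ^+ (size u + size v) *: G0 ((last 0 (u ++ a :: v) ∙ head 0 (u ++ a :: v)) ::
     behead (belast (head 0 (u ++ a :: v)) (behead (u ++ a :: v)))))).
  by move=> a; rewrite size_cat /= addnS eqSS /bword /DD size_cat addnS.
case: eqP => [_|/eqP n0]; first by move=> c a a'; rewrite scaler0 addr0.
apply: lin_add.
  apply: lin_sum => i _; apply: lin_scale; exact: merge_linear.
apply: lin_scale; case: u n0 => [|x u] n0.
  case/lastP: v n0 => [//|v y] _.
  apply: (@lin_eq _ _ _ _ (fun a => G0 (y ∙ a :: v))) => [a|].
    by rewrite /= last_rcons belast_rcons.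
  by apply: (lin_comp (Gl [::] v)); apply: algmul_linearr.
case/lastP: v {n0} => [|v y].
  apply: (@lin_eq _ _ _ _ (fun a => G0 (a ∙ x :: u))) => [a|].
    by rewrite cats1 /= last_rcons belast_rcons.
  by apply: (lin_comp (Gl [::] u)); apply: algmul_linearl.
apply: (@lin_eq _ _ _ _ (fun a => G0 ((y ∙ x :: u) ++ a :: v))) => [a|]; last exact: Gl.
by rewrite -rcons_cons -rcons_cat /= last_rcons belast_rcons.
Qed.

Lemma hochschild_form a0 w a :
  hochschild (dform a0 (rcons w a)) = (-1) ^+ size w *: (dform_rmul a0 w a - dform (a ∙ a0) w).
Proof.
rewrite -bword_eq.
have e s x : (if s is a1 :: w' then
      let u := belast a1 w' in let a := last a1 w' in
      (-1) ^+ size u *: (dform_rmul x u a - dform (a ∙ x) u)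
    else 0) = (if size (x :: s) == 1%N then 0 else bword (x :: s)).
  by case/lastP: s => [//|[|y s] z]; rewrite bword_eq //= last_rcons belast_rcons.
rewrite /hochschild flift_form.
  by rewrite e /= size_rcons eqSS.
have [F0 FS F1] := wcompatP bword_wcompat.
by split=> [s|x u v|x u v]; [move=> c y z | move=> c y z |]; rewrite !e; [apply: F0|apply: FS|apply: F1].
Qed.

Lemma hochschild_form0 a0 : hochschild (dform a0 [::]) = 0.
Proof. 
have e s x : (if s is a1 :: w' then
      let u := belast a1 w' in let a := last a1 w' in
      (-1) ^+ size u *: (dform_rmul x u a - dform (a ∙ x) u)
    else 0) = (if size (x :: s) == 1%N then 0 else bword (x :: s)).
  by case/lastP: s => [//|[|y s] z]; rewrite bword_eq //= last_rcons belast_rcons.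
rewrite /hochschild flift_form //.
have [F0 FS F1] := wcompatP bword_wcompat.
by split=> [s|x u v|x u v]; [move=> c y z | move=> c y z |]; rewrite !e; [apply: F0|apply: FS|apply: F1].
Qed.

End FormFacts.

Lemma Omega_map_form (k : comPzRingType) (A A' : unitalAlgType k)
    (f : A -> A') a0 w :
  algebra_morphism f -> Omega_map f (dform a0 w) = dform (f a0) (map f w).
Proof.
case: (form_compat A') => F0 FS F1 [fl f1 _]; apply: flift_form; split.
- by move=> u c a a'; rewrite fl F0.
- by move=> a u v c b b'; rewrite !map_cat /= fl FS.
- by move=> a u v; rewrite map_cat /= f1 F1.
Qed.

Section Tlift.
Variable k : comPzRingType.
Implicit Types M N P : lmodType k.
Lemma tlift_ext M N P (F G : M -> N -> P) t : (forall a b, F a b = G a b) -> tlift F t = tlift G t.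
Proof. by move=> e; apply: eq_bigr => p _; rewrite e. Qed.
Lemma tlift_fun_lin M N P c (F G : M -> N -> P) t :
  tlift (fun a b => c *: F a b + G a b) t = c *: tlift F t + tlift G t.
Proof.
rewrite /tlift /pres_lift scaler_sumr -big_split /=; apply: eq_bigr => p _.
by rewrite scalerDr !scalerA mulrC.
Qed.
Lemma tlift_zero M N P (F : M -> N -> P) t : (forall a b, F a b = 0) -> tlift F t = 0.
Proof. by move=> e; apply: big1 => p _; rewrite e scaler0. Qed.
Lemma lin_tl P M N (g : P -> M) (y : N) : linear g -> linear (fun x => g x ⊗ₜ y).
Proof. by move=> gl c a b; rewrite gl tens_linearl. Qed.
Lemma lin_tr P M N (g : P -> N) (y : M) : linear g -> linear (fun x => y ⊗ₜ g x).
Proof. by move=> gl c a b; rewrite gl tens_linearr. Qed.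
Lemma lin_ml P (A : unitalAlgType k) (g : P -> A) (y : A) : linear g -> linear (fun x => g x ∙ y).
Proof. by move=> gl c a b; rewrite gl algmul_linearl. Qed.
Lemma lin_mr P (A : unitalAlgType k) (g : P -> A) (y : A) : linear g -> linear (fun x => y ∙ g x).
Proof. by move=> gl c a b; rewrite gl algmul_linearr. Qed.
Lemma lin_d0 P (A : unitalAlgType k) (g : P -> A) w : linear g -> linear (fun x => dform (g x) w).
Proof. by case: (form_compat A) => F0 _ _ gl c a b; rewrite gl F0. Qed.
Lemma lin_sh0 P (A B : unitalAlgType k) (g : P -> A ⊗ B) w s t : linear g -> linear (fun x => dform_sh (g x) w s t).
Proof.
case: (form_compat (A ⊗ B)) => F0 _ _ gl c a b; rewrite gl.
rewrite /dform_sh scaler_sumr -big_split /=; apply: eq_bigr => e _.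
by rewrite F0 scalerDr !scalerA mulrC.
Qed.
End Tlift.

Section S.
Variables (k : comPzRingType) (A B : unitalAlgType k).
Local Notation T := (A ⊗ B).
Implicit Types (P : lmodType k).

Definition SH P (H : seq T -> P) s t : P := \sum_(e <- shuffles s t) (-1) ^+ e.1 *: H e.2.

Lemma SH_nil P (H : seq T -> P) t : SH H [::] t = H t.
Proof. by rewrite /SH; case: t => [|y t]; rewrite /= big_seq1 expr0 scale1r. Qed.
Lemma SH_nilr P (H : seq T -> P) s : SH H s [::] = H s.
Proof. by rewrite /SH; case: s => [|y t]; rewrite /= big_seq1 expr0 scale1r. Qed.
Lemma SH_cons P (H : seq T -> P) x s y t : SH H (x :: s) (y :: t) =
  SH (fun w => H (x :: w)) s (y :: t) + (-1) ^+ (size s).+1 *: SH (fun w => H (y :: w)) (x :: s) t.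
Proof.
rewrite /SH /= big_cat !big_map /= scaler_sumr; congr (_ + _).
apply: eq_bigr => e _; rewrite scalerA; congr (_ *: _).
by rewrite -[(-1) ^+ (size s).+1]signr_odd -signr_addb.
Qed.

Lemma SH_linear1 P (H : seq T -> P) u v t : slotlinear H ->
  linear (fun x => SH H (u ++ x :: v) t).
Proof.
move: {2}(size u + size t)%N (leqnn (size u + size t)) => n.
elim: n u t H => [|n IH] u [|y t] H le_n Hl.
- apply: (@lin_eq _ _ _ _ (fun x => H (u ++ x :: v))) => [x|]; [exact: SH_nilr|exact: Hl].
- by move: le_n; rewrite /= addnS.
- apply: (@lin_eq _ _ _ _ (fun x => H (u ++ x :: v))) => [x|]; [exact: SH_nilr|exact: Hl].
have l2 : linear (fun x => SH (fun w => H (y :: w)) (u ++ x :: v) t).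
  by apply: IH; [move: le_n; rewrite /= addnS|apply: slotlinear_cons].
case: u le_n l2 => [|z u] le_n l2.
  apply: (@lin_eq _ _ _ _ (fun x => SH (fun w => H (x :: w)) v (y :: t) +
     (-1) ^+ (size v).+1 *: SH (fun w => H (y :: w)) (x :: v) t)) => [x|]; first exact: SH_cons.
  apply: lin_add; last exact: lin_scale.
  rewrite /SH; apply: lin_sum => e _; apply: lin_scale; apply: (Hl [::]).
apply: (@lin_eq _ _ _ _ (fun x => SH (fun w => H (z :: w)) (u ++ x :: v) (y :: t) +
     (-1) ^+ (size u + size v).+2 *: SH (fun w => H (y :: w)) (z :: u ++ x :: v) t)) => [x|].
  by rewrite SH_cons size_cat /= addnS.
apply: lin_add; last exact: lin_scale.
by apply: IH => //; apply: slotlinear_cons.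
Qed.

Lemma SH_linear2 P (H : seq T -> P) s u v : slotlinear H ->
  linear (fun x => SH H s (u ++ x :: v)).
Proof.
move: {2}(size s + size u)%N (leqnn (size s + size u)) => n.
elim: n s u H => [|n IH] [|y s] u H le_n Hl.
- apply: (@lin_eq _ _ _ _ (fun x => H (u ++ x :: v))) => [x|]; [exact: SH_nil|exact: Hl].
- by [].
- apply: (@lin_eq _ _ _ _ (fun x => H (u ++ x :: v))) => [x|]; [exact: SH_nil|exact: Hl].
have l2 : linear (fun x => SH (fun w => H (y :: w)) s (u ++ x :: v)).
  by apply: IH => //; apply: slotlinear_cons.
case: u le_n l2 => [|z u] le_n l2.
  apply: (@lin_eq _ _ _ _ (fun x => SH (fun w => H (y :: w)) s (x :: v) +
     (-1) ^+ (size s).+1 *: SH (fun w => H (x :: w)) (y :: s) v)) => [x|]; first exact: SH_cons.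
  apply: lin_add => //; apply: lin_scale.
  rewrite /SH; apply: lin_sum => e _; apply: lin_scale; apply: (Hl [::]).
apply: (@lin_eq _ _ _ _ (fun x => SH (fun w => H (y :: w)) s (z :: u ++ x :: v) +
     (-1) ^+ (size s).+1 *: SH (fun w => H (z :: w)) (y :: s) (u ++ x :: v))) => [x|].
  by rewrite SH_cons.
apply: lin_add; first by [].
apply: lin_scale; apply: IH; last exact: slotlinear_cons.
by move: le_n; rewrite /= addnS.
Qed.

Lemma mem_shuffles (U : eqType) (s t : seq U) e : e \in shuffles s t -> perm_eq e.2 (s ++ t).
Proof.
elim: s t e => [|x s IHs] t e; first by case: t => [|y t]; rewrite /= inE => /eqP->.
elim: t e => [|y t IHt] e; first by rewrite /= inE => /eqP->; rewrite cats0.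
rewrite [shuffles _ _]/= mem_cat => /orP[] /mapP[e' he ->] /=.
  by rewrite perm_cons; apply: IHs.
apply: (@perm_trans _ (y :: (x :: s) ++ t)); first by rewrite perm_cons; apply: IHt.
rewrite -[x :: s ++ y :: t]/((x :: s) ++ [:: y] ++ t).
by rewrite perm_sym perm_catCA.
Qed.

Lemma SH_kill P (H : seq T -> P) s t : (forall u v, H (u ++ 𝟙 :: v) = 0) ->
  𝟙 \in s ++ t -> SH H s t = 0.
Proof.
move=> H1 st1; rewrite /SH big1_seq // => e /andP[_ /mem_shuffles pe].
by have := perm_mem pe 𝟙; rewrite st1 => /splitPr[u v]; rewrite H1 scaler0.
Qed.

Lemma inA_linear : linear (@inA k A B). Proof. exact: tens_linearl. Qed.
Lemma inB_linear : linear (@inB k A B). Proof. exact: tens_linearr. Qed.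

Lemma dsh_SH a0 w (s : seq A) (t : seq B) : dform_sh a0 w s t =
  SH (fun u => dform a0 (w ++ u)) (map (@inA k A B) s) (map (@inB k A B) t).
Proof. by []. Qed.

Lemma slot_dform (a0 : T) w : slotlinear (fun u => dform a0 (w ++ u)).
Proof.
have [_ FS _] := form_compat T; move=> u v.
by apply: (@lin_eq _ _ _ _ (fun x => dform a0 ((w ++ u) ++ x :: v))) => [x|//]; rewrite catA.
Qed.
Lemma kill_dform (a0 : T) w u v : dform a0 (w ++ (u ++ 𝟙 :: v)) = 0.
Proof. by have [_ _ F1] := form_compat T; rewrite catA F1. Qed.

Lemma dsh_l0 w s t : linear (fun a0 => @dform_sh k A B a0 w s t).
Proof.
have [F0 _ _] := form_compat T.
by apply: lin_sum => e _; apply: lin_scale.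
Qed.
Lemma dsh_lw a0 u v s t : linear (fun x => @dform_sh k A B a0 (u ++ x :: v) s t).
Proof.
have [_ FS _] := form_compat T.
apply: lin_sum => e _; apply: lin_scale.
by apply: (@lin_eq _ _ _ _ (fun x => dform a0 (u ++ x :: (v ++ e.2)))) => [x|//]; rewrite -catA.
Qed.
Lemma dsh_kw a0 u v s t : @dform_sh k A B a0 (u ++ 𝟙 :: v) s t = 0.
Proof.
have [_ _ F1] := form_compat T.
by apply: big1 => e _; rewrite -catA F1 scaler0.
Qed.
Lemma dsh_l1 a0 w u v t : linear (fun x => @dform_sh k A B a0 w (u ++ x :: v) t).
Proof.
apply: (@lin_eq _ _ _ _ (fun x => SH (fun u => dform a0 (w ++ u))
   (map (@inA k A B) u ++ inA B x :: map (@inA k A B) v) (map (@inB k A B) t))) => [x|].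
  by rewrite dsh_SH map_cat.
have h := @SH_linear1 _ (fun u => dform a0 (w ++ u)) (map (@inA k A B) u)
  (map (@inA k A B) v) (map (@inB k A B) t) (slot_dform a0 w).
exact: (lin_comp h inA_linear).
Qed.
Lemma dsh_l2 a0 w s u v : linear (fun x => @dform_sh k A B a0 w s (u ++ x :: v)).
Proof.
apply: (@lin_eq _ _ _ _ (fun x => SH (fun u => dform a0 (w ++ u))
   (map (@inA k A B) s) (map (@inB k A B) u ++ inB A x :: map (@inB k A B) v))) => [x|].
  by rewrite dsh_SH map_cat.
have h := @SH_linear2 _ (fun u => dform a0 (w ++ u)) (map (@inA k A B) s)
  (map (@inB k A B) u) (map (@inB k A B) v) (slot_dform a0 w).
exact: (lin_comp h inB_linear).
Qed.
Lemma dsh_k1 a0 w s t : 𝟙 \in s -> @dform_sh k A B a0 w s t = 0.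
Proof.
move=> h; rewrite dsh_SH SH_kill // => [u v|]; first exact: kill_dform.
by rewrite mem_cat; apply/orP; left; apply/mapP; exists 𝟙.
Qed.
Lemma dsh_k2 a0 w s t : 𝟙 \in t -> @dform_sh k A B a0 w s t = 0.
Proof.
move=> h; rewrite dsh_SH SH_kill // => [u v|]; first exact: kill_dform.
by rewrite mem_cat; apply/orP; right; apply/mapP; exists 𝟙.
Qed.

Lemma sh_form a0 s b0 t :
  sh (dform a0 s ⊗ₜ dform b0 t) = @dform_sh k A B (a0 ⊗ₜ b0) [::] s t.
Proof.
have c2 a0' s' : compat (fun (b0 : B) (t : seq B) => @dform_sh k A B (a0' ⊗ₜ b0) [::] s' t).
  split=> [w|b u v|b u v]; last by rewrite dsh_k2 // mem_cat mem_head orbT.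
    apply: (lin_comp (dsh_l0 [::] s' w)); exact: tens_linearr.
  exact: dsh_l2.
have c1 y : compat (fun (a0 : A) (s : seq A) =>
   flift (fun b0 t => @dform_sh k A B (a0 ⊗ₜ b0) [::] s t) y).
  split=> [w|a u v|a u v].
  - by rewrite /flift /pres_lift; apply: lin_sum => p _; apply: lin_scale;
      apply: (lin_comp (dsh_l0 [::] w p.2.2)); exact: tens_linearl.
  - by rewrite /flift /pres_lift; apply: lin_sum => p _; apply: lin_scale; exact: dsh_l1.
  - by apply: big1 => p _; rewrite dsh_k1 ?scaler0 // mem_cat mem_head orbT.
rewrite /sh tlift_tens.
- by rewrite flift_form ?flift_form.
- by move=> y; exact: (flift_linear (c1 y)).
- move=> x; rewrite /flift /pres_lift; apply: lin_sum => p _; apply: lin_scale; exact: (flift_linear (c2 _ _)).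
Qed.

Definition plin P (H : seq (A * B) -> P) :=
  (forall u v b, linear (fun a => H (u ++ (a, b) :: v))) /\
  (forall u v a, linear (fun b => H (u ++ (a, b) :: v))).

Lemma wlift_ext P (H K : seq (A * B) -> P) w : (forall s, H s = K s) -> wlift H w = wlift K w.
Proof.
elim: w H K => [|t w IH] H K e /=; first exact: e.
by apply: tlift_ext => a b; apply: IH.
Qed.
Lemma wlift_fun_lin P c (H K : seq (A * B) -> P) w :
  wlift (fun s => c *: H s + K s) w = c *: wlift H w + wlift K w.
Proof.
elim: w H K => [//|t w IH] H K /=; rewrite -tlift_fun_lin.
by apply: tlift_ext => a b; rewrite -IH.
Qed.
Lemma wlift_zero P (H : seq (A * B) -> P) w : (forall s, H s = 0) -> wlift H w = 0.
Proof.
elim: w H => [|t w IH] H e /=; first exact: e.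
by apply: tlift_zero => a b; apply: IH.
Qed.

Lemma plin_cons P (H : seq (A * B) -> P) p : plin H -> plin (fun s => H (p :: s)).
Proof. by case=> h1 h2; split=> u v; [apply: (h1 (p :: u))|apply: (h2 (p :: u))]. Qed.

Lemma wlift_bil P (H : seq (A * B) -> P) w : plin H ->
  (forall b, linear (fun a => wlift (fun s => H ((a, b) :: s)) w)) /\
  (forall a, linear (fun b => wlift (fun s => H ((a, b) :: s)) w)).
Proof.
move=> [h1 h2]; split=> z c x y; rewrite -wlift_fun_lin; apply: wlift_ext => s.
  exact: (h1 [::]).
exact: (h2 [::]).
Qed.

Lemma wlift_linear P (H : seq (A * B) -> P) u v : plin H ->
  linear (fun t => wlift H (u ++ t :: v)).
Proof.
elim: u H => [|t0 u IH] H Hl.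
  have [b1 b2] := wlift_bil v Hl.
  exact: (tlift_linear b1 b2).
apply: lin_sum => p _; apply: lin_scale.
exact/IH/plin_cons.
Qed.

Lemma wlift_kill P (H : seq (A * B) -> P) u v : plin H ->
  (forall u v, H (u ++ (𝟙, 𝟙) :: v) = 0) -> wlift H (u ++ 𝟙 :: v) = 0.
Proof.
elim: u H => [|t0 u IH] H Hl H1 /=.
  have [b1 b2] := wlift_bil v Hl.
  rewrite -[𝟙]/(𝟙 ⊗ₜ 𝟙) tlift_tens //; apply: wlift_zero => s; exact: (H1 [::]).
apply: tlift_zero => a b; apply: IH; first exact: plin_cons.
by move=> u' v'; apply: (H1 (_ :: u')).
Qed.

Lemma wlift_pure P (H : seq (A * B) -> P) s : plin H ->
  wlift H [seq q.1 ⊗ₜ q.2 | q <- s] = H s.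
Proof.
elim: s H => [//|[a b] s IH] H Hl /=.
have [b1 b2] := wlift_bil [seq q.1 ⊗ₜ q.2 | q <- s] Hl.
rewrite tlift_tens //; exact/IH/plin_cons.
Qed.

Definition pcompat P (F : A -> B -> seq (A * B) -> P) :=
  [/\ forall b s, linear (fun a => F a b s), forall a s, linear (fun b => F a b s),
      forall a b, plin (F a b) & forall a b u v, F a b (u ++ (𝟙, 𝟙) :: v) = 0].

Lemma tflift_compat P (F : A -> B -> seq (A * B) -> P) : pcompat F ->
  compat (fun t0 w => tlift (fun a0 b0 => wlift (F a0 b0) w) t0).
Proof.
case=> Fa Fb Fl F1; split=> [w|a u v|a u v].
- apply: (@tlift_linear _ _ _ _ (fun a0 b0 => wlift (F a0 b0) w)) => z c x y;
    by rewrite -wlift_fun_lin; apply: wlift_ext => s; rewrite ?Fa ?Fb.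
- apply: lin_sum => p _; apply: lin_scale; exact: wlift_linear.
- by apply: tlift_zero => x y; apply: wlift_kill.
Qed.

Lemma tflift_form P (F : A -> B -> seq (A * B) -> P) a0 b0 s : pcompat F ->
  tflift F (dform (a0 ⊗ₜ b0) [seq q.1 ⊗ₜ q.2 | q <- s]) = F a0 b0 s.
Proof.
move=> cF; rewrite /tflift flift_form; last exact: tflift_compat.
case: cF => Fa Fb Fl F1.
rewrite tlift_tens ?wlift_pure // => z c x y;
    by rewrite -wlift_fun_lin; apply: wlift_ext => s'; rewrite ?Fa ?Fb.
Qed.
End S.

Section Prod.
Variables (k : comPzRingType) (A : unitalAlgType k).
Lemma algprod_linear : slotlinear (@algprod k A).
Proof.
elim=> [|x u IH] v /=; first exact: (algmul_linearl).
by apply: (lin_comp (algmul_linearr x)); apply: IH.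
Qed.
Lemma take_slot (X : Type) i (u v : seq X) :
  (exists u' v', (forall x, take i (u ++ x :: v) = u' ++ x :: v') /\
     (exists w, forall x, drop i (u ++ x :: v) = w)) \/
  (exists u' v', (forall x, drop i (u ++ x :: v) = u' ++ x :: v') /\
     (exists w, forall x, take i (u ++ x :: v) = w)).
Proof.
case: (leqP i (size u)) => h; [right|left].
  exists (drop i u), v; split=> [x|].
    rewrite drop_cat; case: ltnP => // h'.
    by rewrite (_ : i = size u) ?subnn ?drop_size ?drop0 //; apply/eqP; rewrite eqn_leq h h'.
  exists (take i u) => x; rewrite take_cat; case: ltnP => // h'.
  by rewrite (_ : i = size u) ?subnn ?take_size ?take0 ?cats0 //; apply/eqP; rewrite eqn_leq h h'.
have [j ej] : exists j, i = (size u + j.+1)%N.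
  by exists (i - (size u).+1)%N; rewrite addnS -addSn subnKC.
exists u, (take j v); split=> [x|].
  by rewrite ej take_cat ltnNge leq_addr /= addKn.
by exists (drop j v) => x; rewrite ej drop_cat ltnNge leq_addr /= addKn.
Qed.

Lemma td_linear (P : lmodType k) i u v (K : seq A -> seq A -> P) :
  (forall w, slotlinear (fun s => K s w)) -> (forall w, slotlinear (K w)) ->
  linear (fun a => K (take i (u ++ a :: v)) (drop i (u ++ a :: v))).
Proof.
move=> K1 K2; case: (take_slot i u v) => [[u' [v' [e [w e']]]]|[u' [v' [e [w e']]]]].
  apply: (@lin_eq _ _ _ _ (fun a => K (u' ++ a :: v') w)) => [a|]; last exact: K1.
  by rewrite e e'.
apply: (@lin_eq _ _ _ _ (fun a => K w (u' ++ a :: v'))) => [a|]; last exact: K2.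
by rewrite e e'.
Qed.
End Prod.

Section AWphi.
Variables (k : comPzRingType) (A B : unitalAlgType k).

Let unz1 (u v : seq (A * B)) a b : unzip1 (u ++ (a, b) :: v) = unzip1 u ++ a :: unzip1 v.
Proof. by rewrite /unzip1 map_cat. Qed.
Let unz2 (u v : seq (A * B)) a b : unzip2 (u ++ (a, b) :: v) = unzip2 u ++ b :: unzip2 v.
Proof. by rewrite /unzip2 map_cat. Qed.

Lemma slot_comp (P Q : lmodType k) (C : unitalAlgType k) (f : P -> Q) (G : seq C -> P) :
  linear f -> slotlinear G -> slotlinear (fun s => f (G s)).
Proof. by move=> fl Gl u v; apply: lin_comp. Qed.

Definition AWF a0 b0 (s : seq (A * B)) : Omega A ⊗ Omega B :=
    let a := unzip1 s in let b := unzip2 s in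
    \sum_(i < (size s).+1)
      dform (algprod (drop i a) ∙ a0) (take i a) ⊗ₜ
      dform (b0 ∙ algprod (take i b)) (drop i b).

Lemma AWF_compat : pcompat AWF.
Proof.
have [A0 AS A1] := form_compat A; have [B0 BS B1] := form_compat B.
split.
- move=> b s; apply: lin_sum => i _.
  apply: lin_tl; apply: lin_d0; exact: algmul_linearr.
- move=> b s; apply: lin_sum => i _.
  apply: lin_tr; apply: lin_d0; exact: algmul_linearl.
- move=> a0 b0; split=> u v z.
    apply: (@lin_eq _ _ _ _ (fun a => \sum_(i < (size u + (size v).+1).+1)
      dform (algprod (drop i (unzip1 u ++ a :: unzip1 v)) ∙ a0) (take i (unzip1 u ++ a :: unzip1 v)) ⊗ₜ
      dform (b0 ∙ algprod (take i (unzip2 u ++ z :: unzip2 v))) (drop i (unzip2 u ++ z :: unzip2 v)))).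
      by move=> a; rewrite /AWF unz1 unz2 size_cat.
    apply: lin_sum => i _; apply: lin_tl.
    apply: (@td_linear _ _ _ i _ _ (fun t d => dform (algprod d ∙ a0) t)) => w.
      by move=> u' v'; apply: AS.
    move=> u' v'; apply: lin_d0; apply: lin_ml; exact: algprod_linear.
  apply: (@lin_eq _ _ _ _ (fun b => \sum_(i < (size u + (size v).+1).+1)
      dform (algprod (drop i (unzip1 u ++ z :: unzip1 v)) ∙ a0) (take i (unzip1 u ++ z :: unzip1 v)) ⊗ₜ
      dform (b0 ∙ algprod (take i (unzip2 u ++ b :: unzip2 v))) (drop i (unzip2 u ++ b :: unzip2 v)))).
    by move=> a; rewrite /AWF unz1 unz2 size_cat.
  apply: lin_sum => i _; apply: lin_tr.
  apply: (@td_linear _ _ _ i _ _ (fun t d => dform (b0 ∙ algprod t) d)) => w.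
    move=> u' v'; apply: lin_d0; apply: lin_mr; exact: algprod_linear.
  by move=> u' v'; apply: BS.
- move=> a0 b0 u v; apply: big1 => i _; rewrite unz1 unz2.
  have su : size (unzip1 u) = size (unzip2 u) by rewrite !size_map.
  case: (leqP i (size (unzip1 u))) => h.
    have -> : drop i (unzip2 u ++ 𝟙 :: unzip2 v) = drop i (unzip2 u) ++ 𝟙 :: unzip2 v.
      rewrite drop_cat -su; case: ltnP => // h'.
      by rewrite (_ : nat_of_ord i = size (unzip2 u)) ?su ?subnn ?drop_size ?drop0 // -su; apply/eqP; rewrite eqn_leq h h'.
    by rewrite B1 linear0f //; exact: tens_linearr.
  have [j ->] : exists j, (i : nat) = (size (unzip1 u) + j.+1)%N.
    by exists (i - (size (unzip1 u)).+1)%N; rewrite addnS -addSn subnKC.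
  have -> : take (size (unzip1 u) + j.+1) (unzip1 u ++ 𝟙 :: unzip1 v) = unzip1 u ++ 𝟙 :: take j (unzip1 v).
    by rewrite take_cat ltnNge leq_addr /= addKn.
  by rewrite A1; apply: (@linear0f _ _ _ (fun x => x ⊗ₜ _)); exact: tens_linearl.
Qed.

Lemma AW_form a0 b0 s : AW (dform (a0 ⊗ₜ b0) [seq q.1 ⊗ₜ q.2 | q <- s]) = AWF a0 b0 s.
Proof. exact/tflift_form/AWF_compat. Qed.

Definition phiK (p : nat) (a0 : A) (b0 : B) (w t : seq (A * B)) : Omega (A ⊗ B) :=
  dform_sh (inA B (algprod (drop p (unzip1 t))) ∙ (a0 ⊗ₜ b0))
    (rcons [seq q.1 ⊗ₜ q.2 | q <- w] (inB A (algprod (take p (unzip2 t)))))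
    (take p (unzip1 t)) (drop p (unzip2 t)).

Lemma phiKE r p a0 b0 s : phi_rp r p a0 b0 s = phiK p a0 b0 (take (size s - r) s) (drop (size s - r) s).
Proof. by []. Qed.

Lemma phiK_w p a0 b0 t : plin (fun w => phiK p a0 b0 w t).
Proof.
split=> u v z; rewrite /phiK.
  set X := inA _ _ ∙ _. set Y := inB _ _.
  apply: (@lin_eq _ _ _ _ (fun a => dform_sh X ([seq q.1 ⊗ₜ q.2 | q <- u] ++ (a ⊗ₜ z) :: rcons [seq q.1 ⊗ₜ q.2 | q <- v] Y) (take p (unzip1 t)) (drop p (unzip2 t)))).
    by move=> a; rewrite map_cat rcons_cat.
  have h := @dsh_lw k A B X [seq q.1 ⊗ₜ q.2 | q <- u] (rcons [seq q.1 ⊗ₜ q.2 | q <- v] Y) (take p (unzip1 t)) (drop p (unzip2 t)).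
  apply: (lin_comp h); exact: tens_linearl.
set X := inA _ _ ∙ _. set Y := inB _ _.
apply: (@lin_eq _ _ _ _ (fun b => dform_sh X ([seq q.1 ⊗ₜ q.2 | q <- u] ++ (z ⊗ₜ b) :: rcons [seq q.1 ⊗ₜ q.2 | q <- v] Y) (take p (unzip1 t)) (drop p (unzip2 t)))).
  by move=> a; rewrite map_cat rcons_cat.
have h := @dsh_lw k A B X [seq q.1 ⊗ₜ q.2 | q <- u] (rcons [seq q.1 ⊗ₜ q.2 | q <- v] Y) (take p (unzip1 t)) (drop p (unzip2 t)).
apply: (lin_comp h); exact: tens_linearr.
Qed.

Lemma phiK_t p a0 b0 w : plin (fun t => phiK p a0 b0 w t).
Proof.
split=> u v z.
  apply: (@lin_eq _ _ _ _ (fun a => 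
    dform_sh (inA B (algprod (drop p (unzip1 u ++ a :: unzip1 v))) ∙ (a0 ⊗ₜ b0))
    (rcons [seq q.1 ⊗ₜ q.2 | q <- w] (inB A (algprod (take p (unzip2 u ++ z :: unzip2 v)))))
    (take p (unzip1 u ++ a :: unzip1 v)) (drop p (unzip2 u ++ z :: unzip2 v)))).
    by move=> a; rewrite /phiK unz1 unz2.
  set W := rcons _ _.
  apply: (@td_linear _ _ _ p _ _ (fun t d => dform_sh (inA B (algprod d) ∙ (a0 ⊗ₜ b0)) W t _)) => w'.
    by move=> u' v'; apply: dsh_l1.
  move=> u' v'; apply: lin_sh0; apply: lin_ml.
  by apply: (lin_comp (@inA_linear _ _ _)); exact: algprod_linear.
apply: (@lin_eq _ _ _ _ (fun b => 
    dform_sh (inA B (algprod (drop p (unzip1 u ++ z :: unzip1 v))) ∙ (a0 ⊗ₜ b0))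
    (rcons [seq q.1 ⊗ₜ q.2 | q <- w] (inB A (algprod (take p (unzip2 u ++ b :: unzip2 v)))))
    (take p (unzip1 u ++ z :: unzip1 v)) (drop p (unzip2 u ++ b :: unzip2 v)))).
  by move=> a; rewrite /phiK unz1 unz2.
set X := inA _ _ ∙ _.
apply: (@td_linear _ _ _ p _ _ (fun t d => dform_sh X (rcons _ (inB A (algprod t))) _ d)) => w'.
  move=> u' v'.
  apply: (@lin_eq _ _ _ _ (fun b => dform_sh X ([seq q.1 ⊗ₜ q.2 | q <- w] ++ inB A (algprod (u' ++ b :: v')) :: [::]) (take p (unzip1 u ++ z :: unzip1 v)) w')) => [b|].
    by rewrite cats1.
  have h := @dsh_lw k A B X [seq q.1 ⊗ₜ q.2 | q <- w] [::] (take p (unzip1 u ++ z :: unzip1 v)) w'.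
  apply: (lin_comp h); apply: (lin_comp (@inB_linear _ _ _)); exact: algprod_linear.
by move=> u' v'; apply: dsh_l2.
Qed.

Lemma phi_compat : pcompat (fun a0 b0 (s : seq (A * B)) =>
    \sum_(r < (size s).+1) \sum_(p < r.+1 | (0 < p)%N)
      (-1) ^+ (size s + r) *: phi_rp r p a0 b0 s).
Proof.
split.
- move=> b s; apply: lin_sum => r _; apply: lin_sum => p _; apply: lin_scale.
  apply: lin_sh0; apply: lin_mr; exact: tens_linearl.
- move=> b s; apply: lin_sum => r _; apply: lin_sum => p _; apply: lin_scale.
  apply: lin_sh0; apply: lin_mr; exact: tens_linearr.
- move=> a0 b0; split=> u v z.
    apply: (@lin_eq _ _ _ _ (fun a => let n := (size u + (size v).+1)%N in
     \sum_(r < n.+1) \sum_(p < r.+1 | (0 < p)%N) (-1) ^+ (n + r) *: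
      phiK p a0 b0 (take (n - r) (u ++ (a, z) :: v)) (drop (n - r) (u ++ (a, z) :: v)))).
      by move=> a; rewrite size_cat /=; do 2!(apply: eq_bigr => ? _); rewrite phiKE size_cat.
    move: (size u + _)%N => n /=.
    apply: lin_sum => r _; apply: lin_sum => p _; apply: lin_scale.
    case: (take_slot (n - r) u v) => [[u' [v' [e [w e']]]]|[u' [v' [e [w e']]]]].
      apply: (@lin_eq _ _ _ _ (fun a => phiK p a0 b0 (u' ++ (a, z) :: v') w)) => [a|].
        by rewrite e e'.
      by case: (phiK_w p a0 b0 w) => h _; exact: h.
    apply: (@lin_eq _ _ _ _ (fun a => phiK p a0 b0 w (u' ++ (a, z) :: v'))) => [a|].
      by rewrite e e'.
    by case: (phiK_t p a0 b0 w) => h _; exact: h.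
  apply: (@lin_eq _ _ _ _ (fun a => let n := (size u + (size v).+1)%N in
     \sum_(r < n.+1) \sum_(p < r.+1 | (0 < p)%N) (-1) ^+ (n + r) *:
      phiK p a0 b0 (take (n - r) (u ++ (z, a) :: v)) (drop (n - r) (u ++ (z, a) :: v)))).
    by move=> a; rewrite size_cat /=; do 2!(apply: eq_bigr => ? _); rewrite phiKE size_cat.
  move: (size u + _)%N => n /=.
  apply: lin_sum => r _; apply: lin_sum => p _; apply: lin_scale.
  case: (take_slot (n - r) u v) => [[u' [v' [e [w e']]]]|[u' [v' [e [w e']]]]].
    apply: (@lin_eq _ _ _ _ (fun a => phiK p a0 b0 (u' ++ (z, a) :: v') w)) => [a|].
      by rewrite e e'.
    by case: (phiK_w p a0 b0 w) => _ h; exact: h.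
  apply: (@lin_eq _ _ _ _ (fun a => phiK p a0 b0 w (u' ++ (z, a) :: v'))) => [a|].
    by rewrite e e'.
  by case: (phiK_t p a0 b0 w) => _ h; exact: h.
- move=> a0 b0 u v; apply: big1 => r _; apply: big1 => p _; rewrite phiKE.
  set n := size _; move: (n - r)%N => i.
  case: (take_slot i u v) => [[u' [v' [e [w e']]]]|[u' [v' [e [w e']]]]]; rewrite e e' /phiK.
    by rewrite map_cat rcons_cat /= -[𝟙 ⊗ₜ 𝟙]/(@algone k (A ⊗ B)) dsh_kw scaler0.
  rewrite unz1 unz2; case: (take_slot p u' v') => [[x [y [f _]]]|[x [y [f _]]]].
    have : 𝟙 \in take p (unzip1 u' ++ 𝟙 :: unzip1 v').
      by rewrite -(unz1 u' v' 𝟙 𝟙) -map_take f map_cat mem_cat mem_head orbT.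
    by move=> h; rewrite dsh_k1 ?scaler0.
  have : 𝟙 \in drop p (unzip2 u' ++ 𝟙 :: unzip2 v').
    by rewrite -(unz2 u' v' 𝟙 𝟙) -map_drop f map_cat mem_cat mem_head orbT.
  by move=> h; rewrite dsh_k2 ?scaler0.
Qed.

Lemma phi_form (a0 : A) (b0 : B) (s : seq (A * B)) :
  phi (dform (a0 ⊗ₜ b0) [seq q.1 ⊗ₜ q.2 | q <- s]) =
    \sum_(r < (size s).+1) \sum_(p < r.+1 | (0 < p)%N)
      (-1) ^+ (size s + r) *: phi_rp r p a0 b0 s.
Proof. exact: (tflift_form a0 b0 s phi_compat). Qed.
End AWphi.

(* Main.v *)
Require Import Defs.
From HB Require Import structures.
From mathcomp Require Import all_boot all_order all_algebra.
From mathcomp Require Import boolp classical_sets fsbigop.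

Set Implicit Arguments.
Unset Strict Implicit.
Unset Printing Implicit Defensive.

Import GRing.Theory.
Local Open Scope ring_scope.

(** Write b for the Hochschild operator, B for Connes' operator, S and A for the
    coextended shuffle and Alexander-Whitney maps, S_l and S_r (A_l and A_r) for
    the two composites of S (of A) on three factors, and [_, _] for the graded
    commutator.

    All the homotopies come from a single operator. Before coextension, sh and AW
    form a contraction of Omega(A ⊗ B) onto Omega(A) ⊗ Omega(B) with homotopy
    phi: AW sh = 1 and b phi + phi b = sh AW - 1 ([AW_sh], [phi_homotopy]), with
    the side conditions phi sh = 0 and AW phi = 0 ([phi_sh], [AW_phi]). As B is a
    perturbation of b, the perturbation lemma makes phi_inf = sum (phi B)^m phi a
    homotopy for b + B, namely [b + B, phi_inf] = S A - 1
    ([phi_inf_homotopy]). Pasting two such homotopies gives on three factors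
    H = phi_inf + S (phi_inf ⊗ 1) A with [b + B, H] = S_l A_l - 1
    ([H3_homotopy]). Now A_l S_r = 1 and A_r S_l = 1 ([Al_Sr], [Ar_Sl]), and all
    these composites are chain maps, so
      [b + B, H S_r] = S_l A_l S_r - S_r = S_l - S_r,
      [b + B, A_r H] = A_r S_l A_l - A_r = A_l - A_r.

    To see that A_l S_r = 1, split both maps into components of degrees 0, 2, 4,
    and so on. In degree 0 the composite is 1 because sh is associative, AW is
    coassociative ([sh_assoc], [AW_coassoc]) and AW sh = 1. In degree 2 it is 0
    by the side conditions. From degree 4 on it is 0 because there are too few
    letters: every operator in sight multiplies, moves and shuffles the entries
    of a form a_0 da_1 ... da_n without creating an entry other than 1, and a
    form with an entry d1 vanishes. An element of degree n on three factors has
    at most n + 3 letters, hence no image in degree n + 4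
    ([truncation_cancel]). The same count bounds the number of nonzero terms of
    phi_inf, and shows that AW B phi B sh = 0 and so on: the operator which the
    perturbation lemma transfers to Omega(A) ⊗ Omega(B) is AW B sh
    ([AW_connes_tail]), which is Connes' operator there ([AW_connes_sh]). This
    is why S and A commute with b + B ([bB_sh_inf], [AW_inf_bB]).

    The identity b phi + phi b = sh AW - 1 is proved on words. The form
    y a_0 da_1 ... da_n is a function of the word (a_0, ..., a_n) and of the
    coefficient y, and in terms of this function b is the differential of the bar
    resolution, in which a_n is multiplied into the coefficient. The operators sh,
    AW and phi act on functions of words and coefficients. The bar resolution is
    contractible by the insertion of a first entry, and phi is the homotopy that
    this contraction determines recursively ([phi_word]), so that the identity
    follows by induction on the word ([phi_word_homotopy]). *)

(** * Identities in abelian groups *)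
Module ZmodTac.
Inductive zexpr := ZVar of nat | ZZero | ZAdd of zexpr & zexpr | ZOpp of zexpr.

Fixpoint zcoef (e : zexpr) (i : nat) : int :=
  match e with
  | ZVar j => (i == j)%:Z
  | ZZero => 0
  | ZAdd e f => zcoef e i + zcoef f i
  | ZOpp e => - zcoef e i
  end.

Section Eval.
Variable V : zmodType.

Fixpoint zeval (env : seq V) (e : zexpr) : V :=
  match e with
  | ZVar j => env`_j
  | ZZero => 0
  | ZAdd e f => zeval env e + zeval env f
  | ZOpp e => - zeval env e
  end.

Lemma zevalE env e : zeval env e = \sum_(i < size env) env`_i *~ zcoef e i.
Proof.
elim: e => [j||e IHe f IHf|e IHe] /=.
- case: (ltnP j (size env)) => h; last first.
    rewrite nth_default // big1 // => i _.
    by rewrite (_ : (i == j :> nat) = false) // ltn_eqF // (leq_trans (ltn_ord i)).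
  rewrite (bigD1 (Ordinal h)) //= eqxx big1 ?addr0 // => i ne.
  by rewrite (_ : (i == j :> nat) = false) //; apply: contraNF ne => /eqP e; apply/eqP/val_inj.
- by rewrite big1.
- by rewrite IHe IHf -big_split; apply: eq_bigr => i _; rewrite mulrzDr.
- by rewrite IHe -sumrN; apply: eq_bigr => i _; rewrite mulrNz.
Qed.

Lemma zevalP env e f :
  all (fun i => zcoef e i == zcoef f i) (iota 0 (size env)) ->
  zeval env e = zeval env f.
Proof.
move/allP=> h; rewrite !zevalE; apply: eq_bigr => i _.
by rewrite (eqP (h i _)) // mem_iota /= add0n.
Qed.
End Eval.

(** Atoms are compared up to unification, since the same operator may be applied
   through different canonical structures. *)
Ltac lookup x env n :=
  match env with
  | ?y :: _ => let _ := match goal with _ => first [constr_eq x y | unify x y] end in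
      constr:(n)
  | _ :: ?env' => lookup x env' (S n)
  end.
Ltac insert x env :=
  match env with
  | _ => let _ := lookup x env 0%N in env
  | _ => constr:(x :: env)
  end.
Ltac atoms env t :=
  match t with
  | GRing.add ?a ?b => let env' := atoms env a in atoms env' b
  | GRing.opp ?a => atoms env a
  | GRing.zero => env
  | _ => insert t env
  end.
Ltac reify env t :=
  match t with
  | GRing.add ?a ?b => let a' := reify env a in let b' := reify env b in
      constr:(ZAdd a' b')
  | GRing.opp ?a => let a' := reify env a in constr:(ZOpp a')
  | GRing.zero => constr:(ZZero)
  | _ => let n := lookup t env 0%N in constr:(ZVar n)
  end.
End ZmodTac.

(** Compares the integer coefficients of the atoms of both sides. *)
Ltac zmod :=
  lazymatch goal with
  | |- @eq ?T ?s ?t =>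
      let env := ZmodTac.atoms constr:(@nil T) s in
      let env := ZmodTac.atoms env t in
      let e := ZmodTac.reify env s in
      let f := ZmodTac.reify env t in
      apply: (@ZmodTac.zevalP _ env e f); vm_compute; reflexivity
  end.

(** * Sums over the cuts and the shuffles of words *)
Section WordSums.
Variables (k : comPzRingType) (P : lmodType k).

(** The operators on forms are sums over the ways to cut a word or to shuffle two
    words. Taking the summand as an argument allows proofs by induction on the
    word in which the summand absorbs the first entry. *)
Fixpoint splitsum (X : Type) (F : seq X -> seq X -> P) (s : seq X) : P :=
  if s is x :: s' then F [::] s + splitsum (fun u v => F (x :: u) v) s'
  else F [::] [::].

Definition shufflesum (X : Type) (H : seq X -> P) (s t : seq X) : P :=
  \sum_(e <- shuffles s t) (-1) ^+ e.1 *: H e.2.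

Lemma splitsum_ext X (F G : seq X -> seq X -> P) s :
  (forall u v, u ++ v = s -> F u v = G u v) -> splitsum F s = splitsum G s.
Proof.
elim: s F G => [|x s IH] F G e /=; first exact: e.
by rewrite e // (IH _ (fun u v => G (x :: u) v)) // => u v es; apply: e; rewrite /= es.
Qed.

Lemma splitsum0 X (s : seq X) : splitsum (fun _ _ => 0) s = 0.
Proof. by elim: s => //= x s ->; rewrite addr0. Qed.

Lemma splitsumD X (F G : seq X -> seq X -> P) s :
  splitsum (fun u v => F u v + G u v) s = splitsum F s + splitsum G s.
Proof. by elim: s F G => //= x s IH F G; rewrite IH; zmod. Qed.

Lemma splitsumN X (F : seq X -> seq X -> P) s :
  splitsum (fun u v => - F u v) s = - splitsum F s.
Proof. by elim: s F => //= x s IH F; rewrite IH; zmod. Qed.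

Lemma splitsumB X (F G : seq X -> seq X -> P) s :
  splitsum (fun u v => F u v - G u v) s = splitsum F s - splitsum G s.
Proof. by rewrite splitsumD splitsumN. Qed.

Lemma splitsumZ X c (F : seq X -> seq X -> P) s :
  splitsum (fun u v => c *: F u v) s = c *: splitsum F s.
Proof. by elim: s F => //= x s IH F; rewrite IH scalerDr. Qed.

Lemma splitsum_map X Y (f : X -> Y) (F : seq Y -> seq Y -> P) s :
  splitsum F (map f s) = splitsum (fun u v => F (map f u) (map f v)) s.
Proof. by elim: s F => //= x s IH F; rewrite IH. Qed.

Lemma splitsum_coassoc X (F : seq X -> seq X -> seq X -> P) s :
  splitsum (fun u v => splitsum (fun u1 u2 => F u1 u2 v) u) s =
  splitsum (fun u v => splitsum (fun v1 v2 => F u v1 v2) v) s.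
Proof.
elim: s F => [//|x s IH] F /=.
rewrite splitsumD (IH (fun u1 u2 v => F (x :: u1) u2 v)); zmod.
Qed.

Lemma splitsum_cat X (F : seq X -> seq X -> P) s t :
  splitsum F (s ++ t) =
  splitsum (fun u v => F u (v ++ t)) s + splitsum (fun u v => F (s ++ u) v) t
  - F s t.
Proof.
elim: s F => [|x s IH] F /=; first by case: t => [|y t] /=; zmod.
by rewrite IH; zmod.
Qed.

Lemma splitsum_rcons X (F : seq X -> seq X -> P) s x :
  splitsum F (rcons s x) =
  splitsum (fun u v => F u (rcons v x)) s + F (rcons s x) [::].
Proof. by elim: s F => [|y s IH] F //=; rewrite IH addrA. Qed.

Lemma splitsum_ord X (F : seq X -> seq X -> P) s :
  splitsum F s = \sum_(i < (size s).+1) F (take i s) (drop i s).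
Proof.
elim: s F => [|x s IH] F; first by rewrite big_ord1.
by rewrite big_ord_recl [LHS]/= IH.
Qed.

Lemma shufflesum_nil X (H : seq X -> P) t : shufflesum H [::] t = H t.
Proof.
by rewrite /shufflesum; case: t => [|y t]; rewrite big_seq1 expr0 scale1r.
Qed.

Lemma shufflesum_nilr X (H : seq X -> P) s : shufflesum H s [::] = H s.
Proof.
by rewrite /shufflesum; case: s => [|x s]; rewrite big_seq1 expr0 scale1r.
Qed.

Lemma shufflesum_cons X (H : seq X -> P) x s y t :
  shufflesum H (x :: s) (y :: t) =
  shufflesum (fun w => H (x :: w)) s (y :: t) +
  (-1) ^+ (size s).+1 *: shufflesum (fun w => H (y :: w)) (x :: s) t.
Proof.
rewrite /shufflesum /= big_cat !big_map /= scaler_sumr; congr (_ + _).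
apply: eq_bigr => e _; rewrite scalerA; congr (_ *: _).
by rewrite -[(-1) ^+ (size s).+1]signr_odd -signr_addb.
Qed.

Lemma shuffle_ind (X Y : Type) (Q : seq X -> seq Y -> Prop) :
  (forall t, Q [::] t) -> (forall s, Q s [::]) ->
  (forall x s y t, Q s (y :: t) -> Q (x :: s) t -> Q (x :: s) (y :: t)) ->
  forall s t, Q s t.
Proof.
move=> Q0 Q1 QS; elim=> [//|x s IHs]; elim=> [//|y t IHt].
exact: QS.
Qed.

Lemma shufflesum_ext X (H K : seq X -> P) s t :
  (forall w, size w = (size s + size t)%N -> H w = K w) ->
  shufflesum H s t = shufflesum K s t.
Proof.
move: s t H K.
apply: shuffle_ind => [t|s|x s y t IH1 IH2] H K e.
- by rewrite !shufflesum_nil; apply: e.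
- by rewrite !shufflesum_nilr; apply: e; rewrite addn0.
rewrite !shufflesum_cons; congr (_ + _ *: _).
  by apply: IH1 => w sw; apply: e; rewrite /= sw.
by apply: IH2 => w sw; apply: e; rewrite /= sw /= addnS.
Qed.

Lemma shufflesum0 X (s t : seq X) : shufflesum (fun _ => 0) s t = 0.
Proof. by rewrite /shufflesum big1 // => e _; rewrite scaler0. Qed.

Lemma shufflesumD X (H K : seq X -> P) s t :
  shufflesum (fun w => H w + K w) s t = shufflesum H s t + shufflesum K s t.
Proof.
rewrite /shufflesum -big_split; apply: eq_bigr => e _ /=.
by rewrite scalerDr.
Qed.

Lemma shufflesumB X (H K : seq X -> P) s t :
  shufflesum (fun w => H w - K w) s t = shufflesum H s t - shufflesum K s t.
Proof.
rewrite /shufflesum -sumrN -big_split; apply: eq_bigr => e _ /=.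
by rewrite scalerBr.
Qed.

Lemma shufflesumZ X c (H : seq X -> P) s t :
  shufflesum (fun w => c *: H w) s t = c *: shufflesum H s t.
Proof.
rewrite /shufflesum scaler_sumr; apply: eq_bigr => e _ /=.
by rewrite !scalerA mulrC.
Qed.

Lemma shufflesum_map X Y (f : X -> Y) (H : seq Y -> P) s t :
  shufflesum H (map f s) (map f t) = shufflesum (fun w => H (map f w)) s t.
Proof.
move: s t H; apply: shuffle_ind => [t|s|x s y t IH1 IH2] H.
- by rewrite !shufflesum_nil.
- by rewrite !shufflesum_nilr.
by rewrite /= !shufflesum_cons -/map (IH1 (fun w => H (f x :: w)))
  (IH2 (fun w => H (f y :: w))) size_map.
Qed.

(** Both sides expand into three sums, according to the word that provides the
    first entry, and these agree by induction on the total length. *)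
Lemma shufflesum_assoc X (H : seq X -> P) r s t :
  shufflesum (fun w => shufflesum H w t) r s =
  shufflesum (fun w => shufflesum H r w) s t.
Proof.
move: {2}(size r + size s + size t)%N (leqnn (size r + size s + size t)) => n.
elim: n r s t H => [|n IH] [|x r] [|y s] [|z t] H h //;
  rewrite ?shufflesum_nil ?shufflesum_nilr ?shufflesum_nil //;
  try by apply: shufflesum_ext => w _; rewrite ?shufflesum_nil ?shufflesum_nilr.
move: h; rewrite /= !addSn !addnS !ltnS => h.
have e1 := IH r (y :: s) (z :: t) (fun w => H (x :: w)).
have e2 := IH (x :: r) s (z :: t) (fun w => H (y :: w)).
have e3 := IH (x :: r) (y :: s) t (fun w => H (z :: w)).
move: e1 e2 e3; rewrite /= !addSn !addnS => /(_ h) e1 /(_ h) e2 /(_ h) e3.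
rewrite shufflesum_cons [in RHS]shufflesum_cons.
have -> : shufflesum (fun w => shufflesum H (x :: w) (z :: t)) r (y :: s) =
    shufflesum (fun w => shufflesum (fun v => H (x :: v)) w (z :: t)) r (y :: s)
    + (-1) ^+ (size r + size s) *:
      shufflesum (fun w => shufflesum (fun v => H (z :: v)) (x :: w) t) r (y :: s).
  rewrite -shufflesumZ -shufflesumD; apply: shufflesum_ext => w sw.
  by rewrite shufflesum_cons sw /= addnS !exprS !mulN1r opprK.
have -> : shufflesum (fun w => shufflesum H (y :: w) (z :: t)) (x :: r) s =
    shufflesum (fun w => shufflesum (fun v => H (y :: v)) w (z :: t)) (x :: r) s
    + (-1) ^+ (size r + size s) *:
      shufflesum (fun w => shufflesum (fun v => H (z :: v)) (y :: w) t) (x :: r) s.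
  rewrite -shufflesumZ -shufflesumD; apply: shufflesum_ext => w sw.
  by rewrite shufflesum_cons sw /= addSn !exprS !mulN1r opprK.
have -> : shufflesum (fun w => shufflesum H (x :: r) (y :: w)) s (z :: t) =
    shufflesum (fun w => shufflesum (fun v => H (x :: v)) r (y :: w)) s (z :: t)
    + (-1) ^+ (size r).+1 *:
      shufflesum (fun w => shufflesum (fun v => H (y :: v)) (x :: r) w) s (z :: t).
  rewrite -shufflesumZ -shufflesumD; apply: shufflesum_ext => w _.
  by rewrite shufflesum_cons.
have -> : shufflesum (fun w => shufflesum H (x :: r) (z :: w)) (y :: s) t =
    shufflesum (fun w => shufflesum (fun v => H (x :: v)) r (z :: w)) (y :: s) t
    + (-1) ^+ (size r).+1 *:
      shufflesum (fun w => shufflesum (fun v => H (z :: v)) (x :: r) w) (y :: s) t.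
  rewrite -shufflesumZ -shufflesumD; apply: shufflesum_ext => w _.
  by rewrite shufflesum_cons.
rewrite e1 e2 -e3 !shufflesum_cons.
have eE (v : P) : (-1) ^+ (size r + size s) *: v =
    (-1) ^+ (size r).+1 *: ((-1) ^+ (size s).+1 *: v).
  by rewrite scalerA exprD !exprS !mulN1r mulrNN.
have eC (v : P) : (-1) ^+ (size s).+1 *: ((-1) ^+ (size r).+1 *: v) =
    (-1) ^+ (size r).+1 *: ((-1) ^+ (size s).+1 *: v).
  by rewrite !scalerA mulrC.
by rewrite !eE !scalerDr !eC; zmod.
Qed.
End WordSums.

(** * The bar differential on functions of words *)
Section Bar.
Variables (k : comPzRingType) (P : lmodType k) (X : Type) (mul : X -> X -> X).
Hypothesis mulA : associative mul.
Implicit Types (G H : seq X -> X -> P) (x y t : X) (w : seq X).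

(** A function G of words and coefficients is a cochain. Its differential at the
    word x :: w multiplies neighbouring entries, the last one being multiplied
    into the coefficient y. The augmentation, at a word of one entry, is part of
    [bar_aug] but not of [bar]. *)
Fixpoint bar_aug G x w y : P :=
  if w is t :: w' then
    G (mul x t :: w') y - bar_aug (fun u z => G (x :: u) z) t w' y
  else G [::] (mul x y).

Definition bar G x w y : P := if w is [::] then 0 else bar_aug G x w y.

(** Operators treat the first entry of a word apart; on the empty word, where
    there is no first entry, a cochain is 0. *)
Definition cochain (F : X -> seq X -> X -> P) (u : seq X) (z : X) : P :=
  if u is x :: w then F x w z else 0.

Lemma bar_augE G x w y :
  bar_aug G x w y =
  bar G x w y + (if w is [::] then G [::] (mul x y) else 0).
Proof. by case: w => [|t w] /=; rewrite ?add0r ?addr0. Qed.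

Lemma bar_aug_cochain F x w y :
  bar_aug (cochain F) x w y = bar (cochain F) x w y.
Proof. by case: w. Qed.

Lemma bar_cons G x t w y :
  bar G x (t :: w) y =
  G (mul x t :: w) y - bar_aug (fun u z => G (x :: u) z) t w y.
Proof. by []. Qed.

Lemma bar_aug_ext G H x w y :
  (forall u z, size u = size w -> G u z = H u z) ->
  bar_aug G x w y = bar_aug H x w y.
Proof.
elim: w G H x => [|t w IH] G H x e /=; first exact: e.
rewrite e // (IH _ (fun u z => H (x :: u) z)) // => u z su.
by apply: e; rewrite /= su.
Qed.

Lemma bar_ext G H x w y :
  (forall u z, size u = size w -> G u z = H u z) -> bar G x w y = bar H x w y.
Proof. by case: w => // t w; apply: bar_aug_ext. Qed.

Lemma bar_augD G H x w y :
  bar_aug (fun u z => G u z + H u z) x w y = bar_aug G x w y + bar_aug H x w y.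
Proof. by elim: w G H x => [//|t w IH] G H x /=; rewrite IH; zmod. Qed.

Lemma bar_augB G H x w y :
  bar_aug (fun u z => G u z - H u z) x w y = bar_aug G x w y - bar_aug H x w y.
Proof. by elim: w G H x => [//|t w IH] G H x /=; rewrite IH; zmod. Qed.

Lemma bar_augZ c G x w y :
  bar_aug (fun u z => c *: G u z) x w y = c *: bar_aug G x w y.
Proof. by elim: w G x => [//|t w IH] G x /=; rewrite IH scalerBr. Qed.

Lemma bar_mull G c x w y :
  bar (cochain (fun t u z => G (mul c t :: u) z)) x w y = bar G (mul c x) w y.
Proof. by case: w => [//|t w] /=; rewrite mulA. Qed.
End Bar.

Lemma bar_aug_map (k : comPzRingType) (P : lmodType k) (X X' : Type)
    (mul : X -> X -> X) (mul' : X' -> X' -> X') (f : X -> X') G x w y :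
  (forall x y, f (mul x y) = mul' (f x) (f y)) ->
  bar_aug (P := P) mul' G (f x) (map f w) (f y) =
  bar_aug mul (fun u z => G (map f u) (f z)) x w y.
Proof.
move=> fM; elim: w G x => [|t w IH] G x /=; rewrite -fM //.
by rewrite (IH (fun u => G (f x :: u))).
Qed.

Lemma bar_map (k : comPzRingType) (P : lmodType k) (X X' : Type)
    (mul : X -> X -> X) (mul' : X' -> X' -> X') (f : X -> X') G x w y :
  (forall x y, f (mul x y) = mul' (f x) (f y)) ->
  bar (P := P) mul' G (f x) (map f w) (f y) =
  bar mul (fun u z => G (map f u) (f z)) x w y.
Proof. by move=> fM; case: w => // t w; apply: bar_aug_map. Qed.

(** * The shuffle map on words *)
Section PairWords.
Variables (k : comPzRingType) (A B : unitalAlgType k) (P : lmodType k).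
Implicit Types (X Y : A * B) (s : seq A) (t : seq B) (w : seq (A * B)).

Definition pmul X Y : A * B := (X.1 ∙ Y.1, X.2 ∙ Y.2).
Definition pone : A * B := (𝟙, 𝟙).

Lemma pmulA : associative pmul.
Proof. by move=> [a b] [c d] [e f]; rewrite /pmul /= !algmulA. Qed.

Lemma pmul1x X : pmul pone X = X.
Proof. by case: X => a b; rewrite /pmul !algmul1x. Qed.

Local Notation barA := (bar (@algmul k A)).
Local Notation barB := (bar (@algmul k B)).
Local Notation barP := (bar pmul).

Definition pairA (a : A) : A * B := (a, 𝟙).
Definition pairB (b : B) : A * B := (𝟙, b).

Definition sh_word (G : seq (A * B) -> A * B -> P) X s t Y : P :=
  shufflesum (fun w => G (X :: w) Y) (map pairA s) (map pairB t).

Definition sh_cochain (G : seq (A * B) -> A * B -> P) s (a : A) t (b : B) : P :=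
  match s, t with
  | a0 :: s', b0 :: t' => sh_word G (a0, b0) s' t' (a, b)
  | _, _ => 0
  end.

(** Differentials in each of the two words; [tensor_bar] combines them by the
   Koszul rule, in which the first word, with its first entry, has degree one
   less than its length. *)
Definition bar1 (K : seq A -> A -> seq B -> B -> P) s a t b : P :=
  cochain (barA (fun s' a' => K s' a' t b)) s a.
Definition bar2 (K : seq A -> A -> seq B -> B -> P) s a t b : P :=
  cochain (barB (fun t' b' => K s a t' b')) t b.

Definition tensor_bar (K : seq A -> A -> seq B -> B -> P) s a t b : P :=
  bar1 K s a t b + (-1) ^+ (size s).-1 *: bar2 K s a t b.

Lemma sh_word_cons G X a s b t Y :
  sh_word G X (a :: s) (b :: t) Y =
  sh_word (fun u => G (X :: u)) (pairA a) s (b :: t) Y +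
  (-1) ^+ (size s).+1 *: sh_word (fun u => G (X :: u)) (pairB b) (a :: s) t Y.
Proof. by rewrite /sh_word /= shufflesum_cons size_map. Qed.

Lemma sh_word_consl G X u b t Y :
  sh_word G X u (b :: t) Y =
  sh_cochain (fun v => G (X :: v)) u Y.1 (𝟙 :: b :: t) Y.2 +
  (-1) ^+ size u *: sh_word (fun v => G (X :: v)) (pairB b) u t Y.
Proof.
case: Y => a' b'; case: u => [|a s]; last exact: sh_word_cons.
by rewrite /sh_word /= !shufflesum_nil add0r scale1r.
Qed.

Lemma sh_word_consr G X a s v Y :
  sh_word G X (a :: s) v Y =
  sh_word (fun u => G (X :: u)) (pairA a) s v Y +
  (-1) ^+ (size s).+1 *:
    sh_cochain (fun u => G (X :: u)) (𝟙 :: a :: s) Y.1 v Y.2.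
Proof.
case: Y => a' b'; case: v => [|b t]; last exact: sh_word_cons.
by rewrite /sh_word /= !shufflesum_nilr scaler0 addr0.
Qed.

Lemma sh_word_bar_cons G X T s t Y : (0 < size s + size t)%N ->
  sh_word (fun u => cochain (barP G) (X :: u)) T s t Y =
  sh_word G (pmul X T) s t Y -
  sh_word (cochain (barP (fun u => G (X :: u)))) T s t Y.
Proof.
move=> st; rewrite /sh_word -shufflesumB; apply: shufflesum_ext => w.
by rewrite !size_map => sw; case: w sw st => [|x w] //= <-.
Qed.

Lemma bar1_sh_cons G X a s b t Y :
  bar1 (sh_cochain G) (X.1 :: a :: s) Y.1 (X.2 :: b :: t) Y.2 =
  sh_word G (X.1 ∙ a, X.2) s (b :: t) Y -
  bar1 (sh_cochain (fun u => G (X :: u))) (a :: s) Y.1 (𝟙 :: b :: t) Y.2 -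
  (-1) ^+ size s *:
    (sh_word (fun u => G (X :: u)) (a, b) s t Y -
     bar1 (sh_cochain (fun u => G (X :: u))) (𝟙 :: a :: s) Y.1 (b :: t) Y.2).
Proof.
case: X Y => [x1 x2] [y1 y2] /=.
rewrite opprB algmul1x.
rewrite (bar_aug_ext _ _ _ (H := fun u z =>
  sh_cochain (fun v => G ((x1, x2) :: v)) u z (𝟙 :: b :: t) y2 +
  (-1) ^+ size s *: sh_word (fun v => G ((x1, x2) :: v)) (pairB b) u t (z, y2))).
  rewrite bar_augD bar_augZ (bar_augE _ (fun u z => sh_cochain _ u z _ _)) /=.
  rewrite (_ : match s with [::] => 0 | _ :: _ => 0 end = 0); last by case: (s).
  by rewrite !scalerDr !scalerN /pairB; zmod.
by move=> u z su; rewrite sh_word_consl su.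
Qed.

Lemma bar2_sh_cons G X a s b t Y :
  bar2 (sh_cochain G) (X.1 :: a :: s) Y.1 (X.2 :: b :: t) Y.2 =
  sh_word G (X.1, X.2 ∙ b) (a :: s) t Y -
  (sh_word (fun u => G (X :: u)) (a, b) s t Y -
     bar2 (sh_cochain (fun u => G (X :: u))) (a :: s) Y.1 (𝟙 :: b :: t) Y.2) +
  (-1) ^+ size s *:
  bar2 (sh_cochain (fun u => G (X :: u))) (𝟙 :: a :: s) Y.1 (b :: t) Y.2.
Proof.
case: X Y => [x1 x2] [y1 y2] /=.
rewrite algmul1x.
rewrite (bar_aug_ext _ _ _ (H := fun v z =>
  sh_word (fun u => G ((x1, x2) :: u)) (pairA a) s v (y1, z) +
  (-1) ^+ (size s).+1 *:
    sh_cochain (fun u => G ((x1, x2) :: u)) (𝟙 :: a :: s) y1 v z)).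
  rewrite bar_augD bar_augZ [X in _ - (_ + _ *: X)]bar_augE /=.
  rewrite (_ : match t with [::] => 0 | _ :: _ => 0 end = 0); last by case: (t).
  by rewrite exprS mulN1r scaleNr addr0 /pairA; zmod.
by move=> v z _; rewrite sh_word_consr.
Qed.

(** By induction on both words. Of the terms in which two neighbouring entries of
    a shuffle are multiplied, those with entries from different words cancel in
    pairs, since (a, 1) (1, b) = (1, b) (a, 1) occurs with both signs; they are
    the terms headed by (a, b) in [bar1_sh_cons] and [bar2_sh_cons]. *)
Lemma sh_word_bar G X s t Y :
  sh_word (cochain (barP G)) X s t Y =
  tensor_bar (sh_cochain G) (X.1 :: s) Y.1 (X.2 :: t) Y.2.
Proof.
move: s t X G Y; apply: shuffle_ind.
- elim=> [|b t IH] [x1 x2] G [y1 y2]; rewrite /tensor_bar /=.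
    by rewrite /sh_word /= shufflesum_nil scaler0 addr0.
  rewrite sh_word_consl /= add0r !expr0 !scale1r add0r.
  case: t IH => [|b' t] IH.
    by rewrite /sh_word /= !shufflesum_nil /pmul /= algmulx1 algmul1x.
  rewrite sh_word_bar_cons // IH /tensor_bar /= add0r !scale1r /=.
  rewrite /pmul /= algmulx1; congr (_ - (_ - _)).
    by rewrite /sh_word /= !shufflesum_nil.
  by apply: bar_aug_ext => u z su; rewrite /sh_word /= !shufflesum_nil.
- elim=> [|a s IH] [x1 x2] G [y1 y2]; rewrite /tensor_bar /=.
    by rewrite /sh_word /= shufflesum_nil scaler0 addr0.
  rewrite sh_word_consr /= !scaler0 !addr0.
  case: s IH => [|a' s] IH.
    by rewrite /sh_word /= !shufflesum_nil /pmul /= algmulx1 algmul1x.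
  rewrite sh_word_bar_cons // IH /tensor_bar /= !scaler0 !addr0.
  rewrite /pmul /= algmulx1; congr (_ - (_ - _)).
    by rewrite /sh_word /= !shufflesum_nilr.
  by apply: bar_aug_ext => u z su; rewrite /sh_word /= !shufflesum_nilr.
move=> a s b t IH1 IH2 X G Y.
rewrite sh_word_cons !sh_word_bar_cons ?addnS // IH1 IH2 /tensor_bar.
rewrite bar1_sh_cons bar2_sh_cons /= /pmul /= !algmulx1 !exprS !mulN1r.
set e := (-1) ^+ size s.
have ee (v : P) : e *: (e *: v) = v.
  by rewrite scalerA -expr2 sqrr_sign scale1r.
by rewrite !scaleNr !(scalerDr, scalerN, ee) /pairA /pairB; zmod.
Qed.
End PairWords.

(** * The Alexander-Whitney map and the homotopy on words *)
Section AWWords.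
Variables (k : comPzRingType) (A B : unitalAlgType k) (P : lmodType k).
Implicit Types (X Y T : A * B) (s : seq A) (t : seq B) (w : seq (A * B)).
Implicit Types (K L : seq A -> A -> seq B -> B -> P).
Implicit Types (G H : seq (A * B) -> A * B -> P).

Local Notation barP := (bar (@pmul k A B)).
Local Notation barP_aug := (bar_aug (@pmul k A B)).

Definition aw_word K X w Y : P :=
  splitsum (fun u v => K (X.1 :: unzip1 u) (algprod (unzip1 v) ∙ Y.1)
                         (X.2 ∙ algprod (unzip2 u) :: unzip2 v) Y.2) w.

Lemma aw_word_cons K X T w Y :
  aw_word K X (T :: w) Y =
  K [:: X.1] (T.1 ∙ algprod (unzip1 w) ∙ Y.1) [:: X.2, T.2 & unzip2 w] Y.2 +
  aw_word (fun s => K (X.1 :: s)) (T.1, X.2 ∙ T.2) w Y.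
Proof.
rewrite /aw_word /= algmulx1; congr (_ + _); apply: splitsum_ext => u v _ /=.
by rewrite algmulA.
Qed.

(** The entries of the first factor are multiplied in order into the coefficient,
    so their product is not affected by the differential. *)
Lemma bar_aug_prod (Q : A -> seq B -> B -> P) T w Y :
  barP_aug (fun u z => Q (algprod (unzip1 u) ∙ z.1) (unzip2 u) z.2) T w Y =
  bar_aug (@algmul k B) (Q (T.1 ∙ algprod (unzip1 w) ∙ Y.1)) T.2 (unzip2 w) Y.2.
Proof.
elim: w Q T => [|T' w IH] Q T /=; first by rewrite algmul1x algmulx1.
rewrite !algmulA; congr (_ - _).
rewrite (bar_aug_ext _ _ _ (H := fun u z =>
  (fun a v => Q (T.1 ∙ a) (T.2 :: v)) (algprod (unzip1 u) ∙ z.1) (unzip2 u) z.2)).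
  by rewrite (IH (fun a v => Q (T.1 ∙ a) (T.2 :: v))) !algmulA.
by move=> u z _; rewrite /= !algmulA.
Qed.

Lemma splitsum_if (F : seq (A * B) -> P) w :
  splitsum (fun u v => if u is [::] then F v else 0) w = F w.
Proof. by case: w => //= T w; rewrite splitsum0 addr0. Qed.

(** For an entry t of the word, the last term of the differential of the prefix, at
    the cut after t, and the first term of that of the suffix, at the cut before
    t, both multiply t in A into the coefficient and in B into the head. They
    cancel. *)
Lemma aw_word_bar K X w Y :
  aw_word (tensor_bar K) X w Y = barP (cochain (aw_word K)) X w Y.
Proof.
elim: w K X => [|T w IH] K [x1 x2].
  by rewrite /aw_word /= /tensor_bar /= scaler0 addr0.
rewrite aw_word_cons bar_cons /=.
pose L s := K (x1 :: s).
have -> : aw_word (fun s => tensor_bar K (x1 :: s)) (T.1, x2 ∙ T.2) w Y =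
    aw_word K (x1 ∙ T.1, x2 ∙ T.2) w Y -
    (aw_word (tensor_bar L) (T.1, x2 ∙ T.2) w Y +
     L [::] (T.1 ∙ algprod (unzip1 w) ∙ Y.1) (x2 ∙ T.2 :: unzip2 w) Y.2).
  rewrite -[L [::] _ _ _](splitsum_if (fun v =>
    L [::] (T.1 ∙ algprod (unzip1 v) ∙ Y.1) (x2 ∙ T.2 :: unzip2 v) Y.2)).
  rewrite -splitsumD -splitsumB; apply: splitsum_ext => u v _.
  rewrite /tensor_bar /= bar_augE /L exprS mulN1r scaleNr.
  case: u => [|T' u] /=; rewrite ?algmulx1 ?algmulA; zmod.
rewrite IH /tensor_bar /= expr0 scale1r add0r.
rewrite (bar_aug_ext _ _ _ (H := fun u z =>
  (K [:: x1])^~ (x2 :: unzip2 u) (algprod (unzip1 u) ∙ z.1) z.2 +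
  cochain (fun T' u' z => cochain (aw_word L)
     (pmul (𝟙, x2) T' :: u') z) u z)).
  rewrite bar_augD bar_aug_cochain.
  rewrite (bar_aug_prod (fun a v => K [:: x1] a (x2 :: v))).
  rewrite (bar_mull (@pmulA _ _ _)) /pmul /= algmul1x /L; zmod.
move=> [|T' u] z _ /=; first by rewrite /aw_word /= algmulx1 addr0.
by rewrite aw_word_cons /pmul /= algmul1x.
Qed.

(** The action on cochains of the composite of the shuffle map after the
   Alexander-Whitney map. *)
Definition shaw_word G X w Y : P := aw_word (sh_cochain G) X w Y.

Lemma sh_cochain_ext G H n : (forall u z, size u = n.+1 -> G u z = H u z) ->
  forall s a t b, (size s + size t)%N = n.+2 ->
  sh_cochain G s a t b = sh_cochain H s a t b.
Proof.
move=> e [|x s] a [|y t] b //=; rewrite addnS => -[st].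
by apply: shufflesum_ext => w; rewrite !size_map => sw; apply: e; rewrite /= sw st.
Qed.

Lemma shaw_word_ext G H X w Y :
  (forall u z, size u = (size w).+1 -> G u z = H u z) ->
  shaw_word G X w Y = shaw_word H X w Y.
Proof.
move=> e; apply: splitsum_ext => u v uv.
by apply: (sh_cochain_ext e); rewrite /= !size_map addSn addnS -size_cat uv.
Qed.

Lemma shaw_word_bar G X w Y :
  shaw_word (cochain (barP G)) X w Y = barP (cochain (shaw_word G)) X w Y.
Proof.
rewrite /shaw_word -aw_word_bar; apply: splitsum_ext => u v _.
exact: sh_word_bar.
Qed.

Lemma shaw_wordB G H X w Y :
  shaw_word (fun u z => G u z - H u z) X w Y =
  shaw_word G X w Y - shaw_word H X w Y.
Proof.
rewrite -splitsumB; apply: splitsum_ext => u v _; exact: shufflesumB.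
Qed.

Lemma shaw_word_mull G X T w Y :
  shaw_word (cochain (fun T' u z => G (pmul X T' :: u) z)) T w Y =
  shaw_word G (pmul X T) w Y.
Proof.
by apply: splitsum_ext => u v _; rewrite /sh_cochain /sh_word /pmul /= algmulA.
Qed.

(** Passing from G to the cochain u => G (X :: u) is a contraction of the bar
    resolution. The homotopy from the identity to [shaw_word] that it determines
    satisfies this recursion, and unrolling it gives back the sum that defines
    phi, see [phi_word_split]. *)
Fixpoint phi_word G X w Y : P :=
  if w is T :: w' then
    shaw_word (fun u => G (X :: u)) (pone A B) w Y -
    phi_word (fun u => G (X :: u)) T w' Y
  else 0.

Lemma phi_word_ext G H X w Y :
  (forall u z, size u = (size w).+2 -> G u z = H u z) ->
  phi_word G X w Y = phi_word H X w Y.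
Proof.
elim: w G H X => [//|T w IH] G H X e /=; congr (_ - _).
  by apply: shaw_word_ext => u z su; apply: e; rewrite /= su.
by apply: IH => u z su; apply: e; rewrite /= su.
Qed.

Lemma phi_wordB G H X w Y :
  phi_word (fun u z => G u z - H u z) X w Y =
  phi_word G X w Y - phi_word H X w Y.
Proof.
elim: w G H X => [|T w IH] G H X /=; first by rewrite subr0.
rewrite IH (shaw_wordB (fun u => G (X :: u)) (fun u => H (X :: u))).
zmod.
Qed.

Lemma phi_word_mull G X T w Y :
  phi_word (cochain (fun T' u z => G (pmul X T' :: u) z)) T w Y =
  phi_word G (pmul X T) w Y.
Proof. by case: w. Qed.

Definition normalized G :=
  forall X u v Y, G (X :: u ++ pone A B :: v) Y = 0.

Lemma shaw_word_one G X Y : normalized G ->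
  shaw_word (fun u => G (X :: u)) (pone A B) [::] Y = 0.
Proof.
move=> nG; rewrite /shaw_word /aw_word /= /sh_word /= shufflesum_nil algmulx1.
exact: (nG X [::] [::]).
Qed.

(** By induction on the word. In the recursion for phi applied to the differential
    of G, and in the differential of phi applied to G, the values of phi at the
    product X T cancel and [shaw_word] commutes with the differential. What is
    left is the identity for the shorter word, with G' in place of G. *)
Lemma phi_word_homotopy G X w Y : normalized G ->
  phi_word (cochain (barP G)) X w Y + barP (cochain (phi_word G)) X w Y =
  shaw_word G X w Y - G (X :: w) Y.
Proof.
elim: w G X => [|T w IH] G [x1 x2] nG.
  rewrite /= addr0 /shaw_word /aw_word /= /sh_word /= shufflesum_nil algmulx1.
  by case: Y => y1 y2; rewrite algmul1x subrr.
set X := (x1, x2).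
pose G' := cochain (fun T u z => G [:: X, T & u] z).
have nG' : normalized G'.
  by move=> T' u v Z; rewrite /G' /=; apply: (nG X (T' :: u)).
have eG (u : seq (A * B)) Z n : size u = n.+1 -> G (X :: u) Z = G' u Z.
  by case: u.
rewrite bar_cons /=.
have -> : phi_word (fun u => cochain (barP G) (X :: u)) T w Y =
    phi_word G (pmul X T) w Y - phi_word (cochain (barP G')) T w Y.
  rewrite -(phi_word_mull G X T) -phi_wordB; apply: phi_word_ext => u z.
  case: u => [|T1 [|T2 u]] //= _; congr (_ - (_ - _)).
have -> : shaw_word (fun u => cochain (barP G) (X :: u)) (pone A B) (T :: w) Y =
    shaw_word G X (T :: w) Y -
    shaw_word (cochain (barP G')) (pone A B) (T :: w) Y.
  rewrite -[in shaw_word G X](_ : pmul X (pone A B) = X); last first.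
    by rewrite /pmul /= !algmulx1.
  rewrite -(shaw_word_mull G X) -shaw_wordB; apply: shaw_word_ext => u z.
  case: u => [|T1 [|T2 u]] //= _; congr (_ - (_ - _)).
rewrite shaw_word_bar bar_cons /= pmul1x.
have -> : barP_aug (fun u z => phi_word G X u z) T w Y =
    barP_aug (fun u z => shaw_word G' (pone A B) u z) T w Y -
    barP (cochain (phi_word G')) T w Y.
  rewrite -bar_aug_cochain -bar_augB; apply: bar_aug_ext => u z _.
  case: u => [|T' u] /=.
    rewrite subr0 /shaw_word /aw_word /= /sh_word /= shufflesum_nil algmulx1.
    by rewrite [RHS](nG X [::] [::]).
  congr (_ - _).
  by apply: phi_word_ext => v z' sv; apply: (eG _ _ _ sv).
have := IH G' T nG'.
rewrite -[G [:: X, T & w] Y]/(G' (T :: w) Y) => /(canRL (addrK _)) ->.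
zmod.
Qed.

End AWWords.

(** * Linear maps out of tensor products and forms *)
Section TensorMaps.
Variable k : comPzRingType.

Lemma tmap_tens (M M' N N' : lmodType k) (f : M -> M') (g : N -> N') x y :
  linear f -> linear g -> tmap f g (x ⊗ₜ y) = f x ⊗ₜ g y.
Proof.
by move=> fl gl; apply: tlift_tens => z; [apply: lin_tl|apply: lin_tr].
Qed.

Lemma tmap_linear (M M' N N' : lmodType k) (f : M -> M') (g : N -> N') :
  linear f -> linear g -> linear (tmap f g).
Proof.
by move=> fl gl; apply: tlift_linear => z; [apply: lin_tl|apply: lin_tr].
Qed.

Lemma tder_linear (M N : lmodType k) (D e : M -> M) (E : N -> N) :
  linear D -> linear e -> linear E -> linear (tder D e E).
Proof.
move=> Dl el El; apply: lin_add; apply: tmap_linear => //.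
Qed.

Lemma tder_tens (M N : lmodType k) (D e : M -> M) (E : N -> N) x y :
  linear D -> linear e -> linear E ->
  tder D e E (x ⊗ₜ y) = D x ⊗ₜ y + e x ⊗ₜ E y.
Proof. by move=> Dl el El; rewrite /tder !tmap_tens. Qed.

End TensorMaps.

Ltac lin := repeat first
  [ lazymatch goal with |- linear (fun x => x) => by [] end
  | lazymatch goal with
    | |- linear (tmap _ _) => apply: tmap_linear
    | |- linear (tder _ _ _) => apply: tder_linear
    end
  | exact: linearP
  | exact: tens_linearl
  | exact: tens_linearr
  | lazymatch goal with
    | |- linear (fun x => ?f (@?g x)) =>
        lazymatch g with
        | (fun x => x) => change (linear f)
        | _ => apply: (@lin_comp _ _ _ _ f g)
        end
    end ].

Section Extensionality.
Variable k : comPzRingType.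
Implicit Types P : lmodType k.

Lemma lin_opp (M N : lmodType k) (f : M -> N) :
  linear f -> linear (fun x => - f x).
Proof. by move=> fl c x y; rewrite fl opprD scalerN. Qed.

Lemma lin_sub (M N : lmodType k) (f g : M -> N) :
  linear f -> linear g -> linear (fun x => f x - g x).
Proof. by move=> fl gl; apply: lin_add => //; apply: lin_opp. Qed.

Lemma Omega_eq (A : unitalAlgType k) P (f g : Omega A -> P) :
  linear f -> linear g ->
  (forall a w, f (dform a w) = g (dform a w)) -> f =1 g.
Proof.
move=> fl gl e; apply: Omega_ind => [//|c x y ex ey|]; first by rewrite fl gl ex ey.
by rewrite !linear0f.
Qed.

(** Stated as an induction principle, so that it applies to the pure tensors
   through their own induction principle. *)
Definition spanning (T : lmodType k) (Q : Type) (h : Q -> T) :=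
  forall R : T -> Prop, (forall q, R (h q)) ->
  (forall c x y, R x -> R y -> R (c *: x + y)) -> R 0 -> forall x, R x.

(** Forms are linear in each entry, so that the entries can be replaced one by one
    by generators. *)
Lemma Omega_spanning_eq (T : unitalAlgType k) (Q : Type) (h : Q -> T)
    P (f g : Omega T -> P) :
  spanning h -> linear f -> linear g ->
  (forall q w, f (dform (h q) (map h w)) = g (dform (h q) (map h w))) -> f =1 g.
Proof.
move=> hT fl gl e; have [F0 FS _] := form_compat T.
apply: Omega_eq => // t0 w0.
suff e' q w pre : f (dform (h q) (map h pre ++ w)) = g (dform (h q) (map h pre ++ w)).
  move: t0; apply: hT => [q|c x y ex ey|]; first exact: (e' q w0 [::]).
    by rewrite F0 fl gl ex ey.
  by rewrite (linear0f (F0 w0)) !linear0f.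
elim: w pre => [|t w IH] pre; first by rewrite cats0.
move: t; apply: hT => [q'|c x y ex ey|].
- by rewrite -cat_rcons -map_rcons.
- by rewrite FS fl gl ex ey.
by rewrite (linear0f (FS _ _ _)) !linear0f.
Qed.

Lemma tens_spanning (A B : lmodType k) :
  spanning (fun q : A * B => q.1 ⊗ₜ q.2).
Proof. by move=> R Rh Rl R0; apply: tensor_ind => // x y; apply: (Rh (x, y)). Qed.
End Extensionality.

(** * Operators on forms as sums over words *)
Section Operators.
Variables (k : comPzRingType) (A : unitalAlgType k).

Lemma hochschild_wordE (a : A) w :
  (if w is a1 :: w' then
      let u := belast a1 w' in let a' := last a1 w' in
      (-1) ^+ size u *: (dform_rmul a u a' - dform (a' ∙ a) u)
    else 0) = (if size (a :: w) == 1%N then 0 else bword (a :: w)).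
Proof.
by case/lastP: w => [//|[|y s] z]; rewrite bword_eq //= last_rcons belast_rcons.
Qed.

Lemma hochschild_linear : linear (@hochschild k A).
Proof.
have -> : @hochschild k A =
    flift (fun a w => if size (a :: w) == 1%N then 0 else bword (a :: w)).
  congr flift; apply/funext => a; apply/funext => w; exact: hochschild_wordE.
exact: (flift_linear (wcompatP (@bword_wcompat k A))).
Qed.
HB.instance Definition _ :=
  GRing.isLinear.Build k (Omega A) (Omega A) *:%R (@hochschild k A) hochschild_linear.

Lemma connes_linear : linear (@connes k A).
Proof.
apply: (@flift_linear k A).
apply: (@wcompatP _ _ _ (fun s =>
  \sum_(i < size s) (-1) ^+ ((size s).-1 * i) *: dform 𝟙 (rotr i s))).
have [F0 FS F1] := form_compat A.
apply: (@wcompat_sum _ _ _ (fun n i s => (-1) ^+ (n.-1 * i) *: dform 𝟙 (rotr i s)) id).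
- move=> n i u v; apply: lin_scale; have [u' [v' e]] := rotr_slot i u v.
  by apply: (@lin_eq _ _ _ _ (fun a => dform 𝟙 (u' ++ a :: v'))) => [a|//]; rewrite e.
- move=> n x u v ->; apply: big1 => i _.
  have [u' [v' e]] := rotr_slot i (x :: u) v.
  rewrite (_ : rotr i _ = u' ++ 𝟙 :: v') ?F1 ?scaler0 //.
  exact: e.
Qed.
HB.instance Definition _ :=
  GRing.isLinear.Build k (Omega A) (Omega A) *:%R (@connes k A) connes_linear.

Lemma grading_linear : linear (@grading k A).
Proof.
have [F0 FS F1] := form_compat A.
apply: flift_linear; split=> [w|a u v|a u v]; last by rewrite F1 scaler0.
  exact: lin_scale.
apply: (@lin_eq _ _ _ _ (fun a' =>
  (-1) ^+ (size u + (size v).+1) *: dform a (u ++ a' :: v))) => [a'|].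
  by rewrite size_cat.
exact: lin_scale.
Qed.
HB.instance Definition _ :=
  GRing.isLinear.Build k (Omega A) (Omega A) *:%R (@grading k A) grading_linear.

Lemma bB_linear : linear (@bB k A).
Proof. apply: lin_add; exact: linearP. Qed.
HB.instance Definition _ :=
  GRing.isLinear.Build k (Omega A) (Omega A) *:%R (@bB k A) bB_linear.

(** The form y a_0 da_1 ... da_n, of which the value at y = 1 is of interest. *)
Definition form_cochain : seq A -> A -> Omega A :=
  cochain (fun a w y => dform (y ∙ a) w).

Lemma bar_aug_last (P : lmodType k) (G : seq A -> A -> P) x w y :
  bar_aug (@algmul k A) G x w y =
  DD (fun s => G s y) (x :: w) +
  (-1) ^+ size w *: G (belast x w) (last x w ∙ y).
Proof.
elim: w G x => [|t w IH] G x; first by rewrite /DD big_ord0 add0r scale1r.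
by rewrite [LHS]/= IH DD_cons /= exprS mulN1r scaleNr; zmod.
Qed.

(** The last term of b, in which a_n moves to the front, is the multiplication of
    a_n into the coefficient y. *)
Lemma hochschild_bar x w :
  hochschild (dform x w) = bar (@algmul k A) form_cochain x w 𝟙.
Proof.
case/lastP: w => [|w a]; first exact: hochschild_form0.
rewrite hochschild_form -bword_eq /bword /=.
have -> : bar (@algmul k A) form_cochain x (rcons w a) 𝟙 =
    bar_aug (@algmul k A) form_cochain x (rcons w a) 𝟙 by case: w.
rewrite bar_aug_last size_rcons /= last_rcons belast_rcons /= algmulx1.
congr (_ + _); rewrite /DD; apply: eq_bigr => i _; congr (_ *: _).
rewrite /form_cochain /cochain /G0; case e: (Defs.merge i (x :: rcons w a)) => [|a0 s] /=.
  by have := congr1 size e; rewrite /Defs.merge size_cat /= addnS.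
by rewrite algmul1x.
Qed.

Lemma connes_split x w :
  connes (dform x w) =
  splitsum (P := Omega A) (fun u v => (-1) ^+ (size w * size v) *: dform 𝟙 (v ++ x :: u)) w.
Proof.
rewrite connes_form splitsum_ord (reindex_inj rev_ord_inj) /=.
apply: eq_bigr => i _; rewrite subSS size_drop; congr (_ *: dform _ _).
rewrite /rotr /= subSn ?leq_subr // subKn -1?ltnS //.
Qed.
End Operators.

Section PairOperators.
Variables (k : comPzRingType) (A B : unitalAlgType k).
Implicit Types (X Y : A * B) (w : seq (A * B)).

Lemma sh_linear : linear (@sh k A B).
Proof.
have c2 a0' s' : compat (fun (b0 : B) (t : seq B) => @dform_sh k A B (a0' ⊗ₜ b0) [::] s' t).
  split=> [w|b u v|b u v]; last by rewrite dsh_k2 // mem_cat mem_head orbT.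
    apply: (lin_comp (dsh_l0 [::] s' w)); exact: tens_linearr.
  exact: dsh_l2.
have c1 y : compat (fun (a0 : A) (s : seq A) =>
   flift (fun b0 t => @dform_sh k A B (a0 ⊗ₜ b0) [::] s t) y).
  split=> [w|a u v|a u v].
  - by rewrite /flift /pres_lift; apply: lin_sum => p _; apply: lin_scale;
      apply: (lin_comp (dsh_l0 [::] w p.2.2)); exact: tens_linearl.
  - by rewrite /flift /pres_lift; apply: lin_sum => p _; apply: lin_scale; exact: dsh_l1.
  - by apply: big1 => p _; rewrite dsh_k1 ?scaler0 // mem_cat mem_head orbT.
apply: tlift_linear => [y|x]; first exact: (flift_linear (c1 y)).
rewrite /flift /pres_lift; apply: lin_sum => p _; apply: lin_scale.
exact: (flift_linear (c2 _ _)).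
Qed.
HB.instance Definition _ := GRing.isLinear.Build k (Omega A ⊗ Omega B)
  (Omega (A ⊗ B)) *:%R (@sh k A B) sh_linear.

Lemma AW_linear : linear (@AW k A B).
Proof. exact/flift_linear/tflift_compat/AWF_compat. Qed.
HB.instance Definition _ := GRing.isLinear.Build k (Omega (A ⊗ B))
  (Omega A ⊗ Omega B) *:%R (@AW k A B) AW_linear.

Lemma phi_linear : linear (@phi k A B).
Proof. exact/flift_linear/tflift_compat/phi_compat. Qed.
HB.instance Definition _ := GRing.isLinear.Build k (Omega (A ⊗ B))
  (Omega (A ⊗ B)) *:%R (@phi k A B) phi_linear.

Definition tens_pair X : A ⊗ B := X.1 ⊗ₜ X.2.
Definition pair_form X w : Omega (A ⊗ B) :=
  dform (tens_pair X) (map tens_pair w).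

Lemma Omega_pair_eq (P : lmodType k) (f g : Omega (A ⊗ B) -> P) :
  linear f -> linear g ->
  (forall X w, f (pair_form X w) = g (pair_form X w)) -> f =1 g.
Proof. by move=> fl gl e; apply: (Omega_spanning_eq (@tens_spanning k A B)). Qed.

Lemma Omega2_eq (P : lmodType k) (f g : Omega A ⊗ Omega B -> P) :
  linear f -> linear g ->
  (forall a s b t, f (dform a s ⊗ₜ dform b t) = g (dform a s ⊗ₜ dform b t)) ->
  f =1 g.
Proof.
move=> fl gl e; apply: tensor_eq => // x y; move: x; apply: Omega_eq.
- by apply: (lin_comp fl); exact: tens_linearl.
- by apply: (lin_comp gl); exact: tens_linearl.
move=> a s; move: y; apply: Omega_eq => //.
- by apply: (lin_comp fl); exact: tens_linearr.
- by apply: (lin_comp gl); exact: tens_linearr.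
Qed.

Lemma tens_pair_mul X Y : tens_pair (pmul X Y) = tens_pair X ∙ tens_pair Y.
Proof. by rewrite [RHS]tensor_mul_tens. Qed.

(** Pure tensors are represented by pairs, in order that the operators on
   Omega(A ⊗ B) be computed on words of pairs. *)
Definition pair_form_cochain : seq (A * B) -> A * B -> Omega (A ⊗ B) :=
  cochain (fun X w Y => pair_form (pmul Y X) w).

Lemma hochschild_pair X w :
  hochschild (pair_form X w) = bar (@pmul k A B) pair_form_cochain X w (pone A B).
Proof.
rewrite /pair_form hochschild_bar -[𝟙]/(tens_pair (pone A B)).
rewrite (bar_map _ _ _ _ tens_pair_mul); apply: bar_ext => -[|Z u] z _ //=.
by rewrite /pair_form tens_pair_mul.
Qed.

Lemma dform_shE (a0 : A ⊗ B) (w : seq (A ⊗ B)) s t : dform_sh a0 w s t =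
  shufflesum (fun u => dform a0 (w ++ u)) (map (@inA k A B) s) (map (@inB k A B) t).
Proof. by []. Qed.

Lemma sh_pair a s b t :
  sh (dform a s ⊗ₜ dform b t) = sh_word pair_form_cochain (a, b) s t (pone A B).
Proof.
rewrite sh_form /sh_word /= pmul1x dform_shE.
have -> : map (@inA k A B) s = map tens_pair (map (@pairA k A B) s).
  by rewrite -map_comp.
have -> : map (@inB k A B) t = map tens_pair (map (@pairB k A B) t).
  by rewrite -map_comp.
by rewrite shufflesum_map.
Qed.

Definition form2_cochain s (y1 : A) t (y2 : B) : Omega A ⊗ Omega B :=
  match s, t with
  | a :: s', b :: t' => dform (y1 ∙ a) s' ⊗ₜ dform (y2 ∙ b) t'
  | _, _ => 0
  end.

Lemma AW_split X w : AW (pair_form X w) =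
  splitsum (P := (Omega A ⊗ Omega B : lmodType k)) (fun u v =>
    dform (algprod (unzip1 v) ∙ X.1) (unzip1 u) ⊗ₜ
    dform (X.2 ∙ algprod (unzip2 u)) (unzip2 v)) w.
Proof.
rewrite [LHS]AW_form splitsum_ord; apply: eq_bigr => i _.
by rewrite /unzip1 /unzip2 !map_take !map_drop.
Qed.

Lemma AW_pair X w :
  AW (pair_form X w) = aw_word form2_cochain X w (pone A B).
Proof.
rewrite AW_split; apply: splitsum_ext => u v _ /=.
by rewrite algmulx1 algmul1x.
Qed.

Lemma pair_form_normalized : normalized pair_form_cochain.
Proof.
move=> X u v Y; rewrite /pair_form_cochain /= /pair_form map_cat /=.
by have [_ _ ->] := form_compat (A ⊗ B).
Qed.

(** Unrolling the recursion cuts the word at the place where [shaw_word] starts.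
    The cut at the end contributes 0 because G is normalized. *)
Lemma phi_word_split (P : lmodType k) (G : seq (A * B) -> A * B -> P) X w Y :
  normalized G ->
  phi_word G X w Y =
  splitsum (fun u v => (-1) ^+ size u *:
    shaw_word (fun z => G (X :: u ++ z)) (pone A B) v Y) w.
Proof.
elim: w G X => [|T w IH] G X nG /=; rewrite scale1r.
  by rewrite shaw_word_one.
rewrite IH => [|Z u v z]; last exact: (nG X (Z :: u)).
rewrite -splitsumN; congr (_ + _).
by apply: splitsum_ext => u v _; rewrite exprS mulN1r scaleNr.
Qed.

Lemma phi_pair X w :
  phi (pair_form X w) = phi_word pair_form_cochain X w (pone A B).
Proof.
rewrite [LHS]phi_form (phi_word_split _ _ _ pair_form_normalized) splitsum_ord.
rewrite (reindex_inj rev_ord_inj) /=.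
apply: eq_bigr => i _; rewrite subSS size_take_min (minn_idPl _) -1?ltnS //.
have -> : (-1) ^+ (size w + (size w - i)) = (-1) ^+ i :> k.
  rewrite -signr_odd oddD oddB -1?ltnS // addKb signr_odd //.
rewrite -scaler_sumr; congr (_ *: _).
under eq_bigr => p _ do rewrite phiKE subKn -1?ltnS //.
rewrite -(size_drop i w); move: (take i w) (drop i w) => u v.
rewrite /shaw_word /aw_word splitsum_ord big_mkcond; apply: eq_bigr => p _.
(* The sum for phi starts at p = 1, and in the term for p = 0 the product of the
   first p entries is 1, so that a factor d1 appears. *)
case: posnP => [->|_]; last first.
  rewrite /phiK dform_shE /= /sh_word.
  rewrite algmulx1 algmul1x [unzip1 (take p v)]map_take [unzip1 (drop p v)]map_drop
    [unzip2 (take p v)]map_take [unzip2 (drop p v)]map_drop.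
  have -> s : map (@inA k A B) s = map tens_pair (map (@pairA k A B) s).
    by rewrite -map_comp.
  have -> s : map (@inB k A B) s = map tens_pair (map (@pairB k A B) s).
    by rewrite -map_comp.
  rewrite shufflesum_map; apply: shufflesum_ext => z _.
  by rewrite /= /pair_form tens_pair_mul cat_rcons map_cat.
rewrite take0 drop0 /= /sh_word /= shufflesum_nil algmulx1.
by rewrite algmulx1; symmetry; apply: (pair_form_normalized X u _ (_, _)).
Qed.
End PairOperators.

(** * The contraction of the Hochschild complex of a tensor product *)
Section LinearImages.
Variables (k : comPzRingType) (P Q : lmodType k) (L : {linear P -> Q}).

Lemma splitsum_linear X (F : seq X -> seq X -> P) s :
  L (splitsum F s) = splitsum (fun u v => L (F u v)) s.
Proof. by elim: s F => [//|x s IH] F /=; rewrite linearD IH. Qed.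

Lemma shufflesum_linear X (H : seq X -> P) s t :
  L (shufflesum H s t) = shufflesum (fun w => L (H w)) s t.
Proof. by rewrite linear_sum; apply: eq_bigr => e _; rewrite linearZ. Qed.

Lemma bar_aug_linear X (mul : X -> X -> X) G x w y :
  L (bar_aug mul G x w y) = bar_aug mul (fun u z => L (G u z)) x w y.
Proof. by elim: w G x => [//|t w IH] G x /=; rewrite linearB IH. Qed.

Lemma bar_linear X (mul : X -> X -> X) G x w y :
  L (bar mul G x w y) = bar mul (fun u z => L (G u z)) x w y.
Proof. by case: w => [|t w]; rewrite ?linear0 ?bar_aug_linear. Qed.

Lemma cochain_linear X (F : X -> seq X -> X -> P) u z :
  L (cochain F u z) = cochain (fun x w y => L (F x w y)) u z.
Proof. by case: u => [|x w]; rewrite ?linear0. Qed.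

Variables (A B : unitalAlgType k).

Lemma sh_cochain_linear (G : seq (A * B) -> A * B -> P) s a t b :
  L (sh_cochain G s a t b) = sh_cochain (fun u z => L (G u z)) s a t b.
Proof. by case: s t => [|x s] [|y t] /=; rewrite ?linear0 ?shufflesum_linear. Qed.

Lemma shaw_word_linear (G : seq (A * B) -> A * B -> P) X w Y :
  L (shaw_word G X w Y) = shaw_word (fun u z => L (G u z)) X w Y.
Proof.
rewrite splitsum_linear; apply: splitsum_ext => u v _; exact: sh_cochain_linear.
Qed.

Lemma phi_word_linear (G : seq (A * B) -> A * B -> P) X w Y :
  L (phi_word G X w Y) = phi_word (fun u z => L (G u z)) X w Y.
Proof.
elim: w G X => [|T w IH] G X /=; first exact: linear0.
by rewrite linearB IH shaw_word_linear.
Qed.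
End LinearImages.

Section RightAction.
Variables (k : comPzRingType) (P : lmodType k).

Lemma bar_aug_mulr X (mul : X -> X -> X) G x w z y : associative mul ->
  bar_aug mul (fun u z => G u (mul z y)) x w z =
  bar_aug mul (P := P) G x w (mul z y).
Proof.
move=> mulA; elim: w G x => [|t w IH] G x /=; rewrite ?mulA //.
by rewrite (IH (fun u => G (x :: u))).
Qed.

Lemma bar_mulr X (mul : X -> X -> X) G x w z y : associative mul ->
  bar mul (fun u z => G u (mul z y)) x w z =
  bar mul (P := P) G x w (mul z y).
Proof. by case: w => // t w; apply: bar_aug_mulr. Qed.

Variables (A B : unitalAlgType k).

Lemma shaw_word_mulr (G : seq (A * B) -> A * B -> P) X w Z Y :
  shaw_word (fun u z => G u (pmul z Y)) X w Z = shaw_word G X w (pmul Z Y).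
Proof. by apply: splitsum_ext => u v _; rewrite /sh_cochain /pmul /= algmulA. Qed.

Lemma phi_word_mulr (G : seq (A * B) -> A * B -> P) X w Z Y :
  phi_word (fun u z => G u (pmul z Y)) X w Z = phi_word G X w (pmul Z Y).
Proof.
elim: w G X => [//|T w IH] G X /=; congr (_ - _).
  exact: (shaw_word_mulr (fun u => G (X :: u))).
exact: (IH (fun u => G (X :: u))).
Qed.
End RightAction.

Section ChainMaps.
Variables (k : comPzRingType).

(** Left multiplication by y can be read in the first entry or in the coefficient;
    this allows to apply the operators repeatedly. *)
Lemma hochschild_bar_mul (A : unitalAlgType k) (x y : A) w :
  hochschild (dform (y ∙ x) w) = bar (@algmul k A) (@form_cochain k A) x w y.
Proof.
rewrite hochschild_bar -(bar_mull (@algmulA k A)).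
rewrite -[in RHS](algmul1x y) -(bar_mulr _ _ _ _ _ (@algmulA k A)).
by apply: bar_ext => -[|t u] z _ //=; rewrite algmulA.
Qed.

Variables (A B : unitalAlgType k).
Implicit Types (X Y : A * B) (w : seq (A * B)).
Local Notation PFC := (@pair_form_cochain k A B).
Local Notation barP := (bar (@pmul k A B)).

Lemma hochschild_pair_mul X Y w :
  hochschild (pair_form (pmul Y X) w) = barP PFC X w Y.
Proof.
rewrite hochschild_pair -(bar_mull (@pmulA k A B)).
rewrite -[in RHS](pmul1x Y) -(bar_mulr _ _ _ _ _ (@pmulA k A B)).
by apply: bar_ext => -[|t u] z _ //=; rewrite pmulA.
Qed.

Lemma sh_cochain_pair s y1 t y2 :
  sh (form2_cochain s y1 t y2) = sh_cochain PFC s y1 t y2.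
Proof.
case: s t => [|a s] [|b t] /=; rewrite ?linear0 // sh_pair.
by apply: shufflesum_ext => w _ /=; rewrite pmul1x.
Qed.

Lemma AW_pair_mul X Y w :
  AW (pair_form (pmul Y X) w) = aw_word (@form2_cochain k A B) X w Y.
Proof. by rewrite AW_split; apply: splitsum_ext => u v _; rewrite /= !algmulA. Qed.

Lemma phi_pair_mul X Y w :
  phi (pair_form (pmul Y X) w) = phi_word PFC X w Y.
Proof.
rewrite phi_pair -phi_word_mull -[in RHS](pmul1x Y) -phi_word_mulr.
by apply: phi_word_ext => -[|t u] z //= _; rewrite pmulA.
Qed.

Local Notation b2 :=
  (tder (@hochschild k A) (@grading k A) (@hochschild k B)).

HB.instance Definition _ (M M' N N' : lmodType k) (f : {linear M -> M'})
    (g : {linear N -> N'}) :=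
  GRing.isLinear.Build k (M ⊗ N) (M' ⊗ N') *:%R (tmap f g)
    (tmap_linear (@linearP _ _ _ _ f) (@linearP _ _ _ _ g)).

HB.instance Definition _ (M N : lmodType k) (D e : {linear M -> M})
    (E : {linear N -> N}) :=
  GRing.isLinear.Build k (M ⊗ N) (M ⊗ N) *:%R (tder D e E)
    (tder_linear (@linearP _ _ _ _ D) (@linearP _ _ _ _ e) (@linearP _ _ _ _ E)).

HB.instance Definition _ (M N : lmodType k) (x : M) :=
  GRing.isLinear.Build k N (M ⊗ N) *:%R (@tens k M N x) (@tens_linearr k M N x).
Definition tensl (M N : lmodType k) (y : N) (x : M) : M ⊗ N := x ⊗ₜ y.
HB.instance Definition _ (M N : lmodType k) (y : N) :=
  GRing.isLinear.Build k M (M ⊗ N) *:%R (@tensl M N y) (@tens_linearl k M N y).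

Lemma tensZl (M N : lmodType k) c (x : M) (y : N) :
  (c *: x) ⊗ₜ y = c *: (x ⊗ₜ y).
Proof. by rewrite -[LHS]/(tensl y (c *: x)) linearZ. Qed.

Lemma tensZr (M N : lmodType k) c (x : M) (y : N) :
  x ⊗ₜ (c *: y) = c *: (x ⊗ₜ y).
Proof. exact: linearZ. Qed.

Lemma tensor_bar_form2 a s y1 b t y2 :
  tensor_bar (@form2_cochain k A B) (a :: s) y1 (b :: t) y2 =
  b2 (dform (y1 ∙ a) s ⊗ₜ dform (y2 ∙ b) t).
Proof.
rewrite tder_tens; try exact: linearP.
rewrite grading_form !hochschild_bar_mul /tensor_bar /=; congr (_ + _).
  rewrite -[RHS]/(tensl _ _) bar_linear; apply: bar_ext => u z _.
  by rewrite cochain_linear; case: u.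
rewrite -[RHS]/(tensl _ _) linearZ; congr (_ *: _).
rewrite [RHS]bar_linear; apply: bar_ext => u z _.
by rewrite cochain_linear; case: u.
Qed.

Lemma hochschild_sh (z : Omega A ⊗ Omega B) : hochschild (sh z) = sh (b2 z).
Proof.
move: z; apply: Omega2_eq; try lin.
move=> a s b t; rewrite sh_pair /sh_word shufflesum_linear.
have -> : sh (b2 (dform a s ⊗ₜ dform b t)) =
    sh (tensor_bar (@form2_cochain k A B) (a :: s) 𝟙 (b :: t) 𝟙).
  by rewrite tensor_bar_form2 !algmul1x.
transitivity (tensor_bar (sh_cochain PFC) (a :: s) 𝟙 (b :: t) 𝟙).
  rewrite -(sh_word_bar PFC (a, b) s t (pone A B)); apply: shufflesum_ext => w _.
  by rewrite /= hochschild_pair_mul.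
rewrite linearD linearZ !bar_linear; congr (_ + _ *: _).
  by apply: bar_ext => u z _; symmetry; apply: sh_cochain_pair.
by apply: bar_ext => u z _; symmetry; apply: sh_cochain_pair.
Qed.

Lemma AW_hochschild (x : Omega (A ⊗ B)) : AW (hochschild x) = b2 (AW x).
Proof.
move: x; apply: Omega_pair_eq; try lin.
move=> X w; rewrite hochschild_pair bar_linear AW_pair.
transitivity (barP (cochain (aw_word (@form2_cochain k A B))) X w (pone A B)).
  by apply: bar_ext => -[|T u] z _; rewrite /= ?linear0 // AW_pair_mul.
rewrite -aw_word_bar splitsum_linear; apply: splitsum_ext => u v _.
exact: tensor_bar_form2.
Qed.

(** Apply [phi_word_homotopy] to the cochain of a form; it is normalized since
    d1 = 0. *)
Lemma phi_homotopy (x : Omega (A ⊗ B)) :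
  hochschild (phi x) + phi (hochschild x) = sh (AW x) - x.
Proof.
move: x; apply: Omega_pair_eq; try (by apply: lin_add; lin).
move=> X w; rewrite addrC hochschild_pair bar_linear phi_pair phi_word_linear.
have -> : barP (fun u z => phi (PFC u z)) X w (pone A B) =
    barP (cochain (phi_word PFC)) X w (pone A B).
  by apply: bar_ext => -[|T u] z _; rewrite /= ?linear0 // phi_pair_mul.
have -> : phi_word (fun u z => hochschild (PFC u z)) X w (pone A B) =
    phi_word (cochain (barP PFC)) X w (pone A B).
  by apply: phi_word_ext => -[|T u] z //= _; rewrite hochschild_pair_mul.
rewrite addrC phi_word_homotopy; last exact: pair_form_normalized.
rewrite AW_pair splitsum_linear; congr (_ - _); last by rewrite /= pmul1x.
by apply: splitsum_ext => u v _; rewrite -sh_cochain_pair.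
Qed.
End ChainMaps.

(** * Connes' operator *)
Section Connes.
Variables (k : comPzRingType) (A : unitalAlgType k).
Implicit Types (P : lmodType k) (x : A) (u v w : seq A).

Lemma DD_ext P (G H : seq A -> P) w :
  (forall v, (size v).+1 = size w -> G v = H v) -> DD G w = DD H w.
Proof.
elim: w G H => [|x [|y w] IH] G H e; rewrite /DD ?big_ord0 // -!/(DD _ _).
rewrite -[LHS]/(DD _ _) -[RHS]/(DD _ _) !DD_cons e // (IH _ (fun s => H (x :: s))) //.
by move=> v sv; apply: e; rewrite /= sv.
Qed.

Lemma DDZ P c (G : seq A -> P) w : DD (fun s => c *: G s) w = c *: DD G w.
Proof.
by rewrite /DD scaler_sumr; apply: eq_bigr => i _; rewrite !scalerA mulrC.
Qed.

Lemma DDD P (G H : seq A -> P) w :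
  DD (fun s => G s + H s) w = DD G w + DD H w.
Proof.
by rewrite /DD -big_split; apply: eq_bigr => i _; rewrite scalerDr.
Qed.

Lemma DD0 P (G : seq A -> P) : DD G [::] = 0.
Proof. by rewrite /DD big_ord0. Qed.

Lemma DD1 P (G : seq A -> P) x : DD G [:: x] = 0.
Proof. by rewrite /DD big_ord0. Qed.

(** DD is a coderivation with respect to the cuts of a word. *)
Lemma DD_splitsum P (F : seq A -> seq A -> P) w :
  DD (splitsum F) w =
  splitsum (fun u v => DD (F^~ v) u + (-1) ^+ size u *: DD (F u) v) w.
Proof.
elim: w F => [|x [|y w] IH] F /=; rewrite ?DD0 ?DD1 ?scaler0 ?addr0 //.
rewrite DD_cons /= (_ : (fun s => _) =
  (fun s => F [::] (x :: s) + splitsum (fun u => F (x :: u)) s)) //.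
rewrite DDD (IH (fun u => F (x :: u))) /= ?DD0 ?DD1 !scale1r DD_cons.
have -> : splitsum (fun u v => DD (F^~ v) [:: x, y & u] +
     (-1) ^+ (size u).+2 *: DD (F [:: x, y & u]) v) w =
   splitsum (fun u => F (x ∙ y :: u)) w - splitsum (fun u v =>
     DD (fun s => F (x :: s) v) (y :: u) +
     (-1) ^+ (size u).+1 *: DD (F [:: x, y & u]) v) w.
  rewrite -splitsumB; apply: splitsum_ext => u v _.
  by rewrite DD_cons [in LHS]exprS mulN1r scaleNr; zmod.
rewrite expr1 scaleN1r; zmod.
Qed.

Lemma DD_cat P (G : seq A -> P) v x u :
  DD G (v ++ x :: u) =
  DD (fun s => G (s ++ x :: u)) v +
  (if v is c :: v' then
     (-1) ^+ size v' *: G (belast c v' ++ last c v' ∙ x :: u) else 0) +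
  (-1) ^+ size v *: DD (fun s => G (v ++ s)) (x :: u).
Proof.
elim: v G => [|c [|d v] IH] G /=; first by rewrite DD0 scale1r !add0r.
  by rewrite DD_cons DD1 add0r !scale1r expr1 scaleN1r.
rewrite !DD_cons (IH (fun s => G (c :: s))) /= !exprS !mulN1r !scaleNr; zmod.
Qed.

(** Moving one entry across the cut pairs off all cuts but the extreme ones. *)
Lemma splitsum_shift P (F H : seq A -> seq A -> P) s :
  (forall u c v, F (rcons u c) v = H u (c :: v)) ->
  splitsum F s - F [::] s = splitsum H s - H s [::].
Proof.
elim: s F H => [|c s IH] F H e /=; first by rewrite !subrr.
have := IH (fun u => F (c :: u)) (fun u => H (c :: u)) (fun u => e (c :: u)).
rewrite (e [::] c s) => /(canRL (subrK _)) ->; zmod.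
Qed.

Local Notation W := (@dform k A 𝟙).

Lemma hochschild_one z0 z : hochschild (W (z0 :: z)) =
  dform z0 z - DD W (z0 :: z) - (-1) ^+ size z *: dform (last z0 z) (belast z0 z).
Proof.
rewrite hochschild_bar /= !algmul1x.
rewrite (bar_aug_ext _ _ _ (H := fun u y => dform y u)); last first.
  by move=> u y _; rewrite algmulx1.
by rewrite bar_aug_last algmulx1; zmod.
Qed.

Lemma hochschild_cons x c r : hochschild (dform x (c :: r)) =
  dform (x ∙ c) r - DD (dform x) (c :: r) -
  (-1) ^+ size r *: dform (last c r ∙ x) (belast c r).
Proof.
rewrite hochschild_bar /= algmul1x bar_aug_last /= algmulx1.
by rewrite (DD_ext (H := dform x)) => [|v _]; rewrite ?algmul1x //; zmod.
Qed.

Lemma connesK (y : Omega A) : connes (connes y) = 0.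
Proof.
have [_ _ F1] := form_compat A.
move: y; apply: Omega_eq; try lin; first by move=> c y z; rewrite scaler0 addr0.
move=> x w; rewrite connes_split splitsum_linear.
rewrite -(@splitsum0 k (Omega A) _ w); apply: splitsum_ext => u v _.
rewrite linearZ /= connes_split -[RHS](scaler0 _ ((-1) ^+ (size w * size v))).
congr (_ *: _); rewrite -[RHS](@splitsum0 k (Omega A) _ (v ++ x :: u)).
by apply: splitsum_ext => u' v' _; rewrite F1 scaler0.
Qed.

Lemma hochschild_rotr z : hochschild (W z) =
  if z is [::] then 0 else
  G0 z - DD W z - (-1) ^+ (size z).-1 *: G0 (rotr 1 z).
Proof.
case: z => [|z0 z]; first exact: hochschild_form0.
by rewrite hochschild_one; congr (_ - _ *: _); rewrite lastI rotr1_rcons.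
Qed.

Lemma signZ (P : lmodType k) m n (x : P) : odd m = odd n ->
  (-1) ^+ m *: x = (-1) ^+ n *: x.
Proof. by rewrite -signr_odd => ->; rewrite signr_odd. Qed.

Lemma signSZ (P : lmodType k) n (x : P) :
  (-1) ^+ n.+1 *: x = - ((-1) ^+ n *: x).
Proof. by rewrite exprS mulN1r scaleNr. Qed.

(** In b (da_j ... da_n da_0 ... da_(j-1)) the terms in which the first or the
    last entry becomes the head are forms headed by an entry of the cycle; over
    all rotations they cancel in pairs ([splitsum_shift]). Only the terms that
    multiply two entries inside the rotated word remain. *)
Lemma hochschild_connes_word x w : hochschild (connes (dform x w)) =
  - splitsum (P := Omega A) (fun u v => (-1) ^+ (size w * size v) *: DD W (v ++ x :: u)) w.
Proof.
set n := size w.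
pose F u v : Omega A := (-1) ^+ (n * (size v).+1) *: G0 (rotr 1 (v ++ x :: u)).
pose H u v : Omega A := (-1) ^+ (n * size v) *: G0 (v ++ x :: u).
have FH : splitsum F w = splitsum H w.
  have : splitsum F w - F [::] w = splitsum H w - H w [::].
    apply: splitsum_shift => u c v; rewrite /F /H -rcons_cons -rcons_cat.
    by rewrite rotr1_rcons.
  have -> : F [::] w = H w [::].
    rewrite /F /H cats1 rotr1_rcons /= muln0 -(expr0 (-1)).
    by apply: signZ; rewrite -/n oddM /= andbN.
  exact: addIr.
rewrite connes_split splitsum_linear.
transitivity (splitsum (fun u v => H u v -
    (-1) ^+ (n * size v) *: DD W (v ++ x :: u) - F u v) w).
  apply: splitsum_ext => u v uv; rewrite linearZ /= hochschild_rotr.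
  rewrite (_ : (if _ is [::] then _ else _) = G0 (v ++ x :: u) -
    DD W (v ++ x :: u) - (-1) ^+ n *: G0 (rotr 1 (v ++ x :: u))).
    by rewrite !scalerBr scalerA -exprD -mulnSr.
  have -> : (size (v ++ x :: u)).-1 = n.
    by rewrite /n -uv !size_cat addnS /= addnC.
  by case: (v).
by rewrite !splitsumB FH; zmod.
Qed.

Lemma DD_splitsum_connes x w : connes (DD (dform x) w) =
  splitsum (P := Omega A) (fun u v =>
     (-1) ^+ ((size w).-1 * size v) *: DD (fun s => W (v ++ x :: s)) u -
     (-1) ^+ (size w * size v) *: DD (fun s => W (s ++ x :: u)) v) w.
Proof.
case: w => [|c r]; first by rewrite /= !DD0 linear0 !scaler0 subr0.
rewrite {1}/DD linear_sum.
under eq_bigr do rewrite linearZ.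
rewrite -[LHS]/(DD (fun s => connes (dform x s)) (c :: r)).
rewrite (DD_ext (H := splitsum (fun u v =>
  (-1) ^+ (size r * size v) *: W (v ++ x :: u)))); last first.
  by move=> v [sv]; rewrite connes_split sv.
rewrite DD_splitsum; apply: splitsum_ext => u v uv /=.
rewrite DDZ; congr (_ + _).
case: v uv => [|d v] uv; first by rewrite !DD0 !scaler0 oppr0.
rewrite (DD_ext (H := fun s => (-1) ^+ (size r * size v) *: W (s ++ x :: u))).
  rewrite DDZ scalerA -exprD -signSZ; apply: signZ.
  have <- : (size u + size v)%N = size r.
    by have := congr1 size uv; rewrite size_cat /= addnS => -[].
  by rewrite /= !(oddD, oddM, oddS) /=; case: (odd (size u)) (odd (size v)) => [] [].
by move=> s [ss]; rewrite ss.
Qed.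

(** Multiplying two neighbours in a rotation of (a_0, ..., a_n) gives a rotation of
    a word that occurs in b. The neighbours a_0, a_1 and a_n, a_0 correspond to
    the first and to the last term of b; M collects the latter. *)
Lemma hochschild_connes (y : Omega A) :
  hochschild (connes y) + connes (hochschild y) = 0.
Proof.
move: y; apply: Omega_eq; first by apply: lin_add; lin.
  by move=> c y z; rewrite scaler0 addr0.
move=> x [|c r]; rewrite hochschild_connes_word.
  by rewrite hochschild_form0 linear0 addr0 /= DD1 scaler0 oppr0.
have -> : connes (hochschild (dform x (c :: r))) =
    connes (dform (x ∙ c) r) - connes (DD (dform x) (c :: r)) -
    (-1) ^+ size r *: connes (dform (last c r ∙ x) (belast c r)).
  by rewrite hochschild_cons !linearB linearZ.
rewrite DD_splitsum_connes.
set n := size (c :: r).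
pose M u v : Omega A := if v is d :: v' then
  (-1) ^+ size v' *: W (belast d v' ++ last d v' ∙ x :: u) else 0.
have -> : splitsum (fun u v => (-1) ^+ (n * size v) *: DD W (v ++ x :: u)) (c :: r) =
    splitsum (fun u v =>
      (-1) ^+ (n * size v) *: DD (fun s => W (s ++ x :: u)) v +
      (-1) ^+ (n * size v) *: M u v +
      ((-1) ^+ (size r * size v) *:
         (if u is d :: u' then W (v ++ x ∙ d :: u') else 0) -
       (-1) ^+ (size r * size v) *: DD (fun s => W (v ++ x :: s)) u)) (c :: r).
  apply: splitsum_ext => u v _; rewrite DD_cat !scalerDr; congr (_ + _ + _).
  rewrite scalerA -exprD -mulSnr -scalerBr; set D := DD _ _.
  have -> : D = (if u is d :: u' then W (v ++ x ∙ d :: u') else 0) -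
      DD (fun s => W (v ++ x :: s)) u.
    by rewrite /D; case: (u) => [|d u']; rewrite ?DD1 ?DD0 ?subr0 // DD_cons.
  by apply: signZ; rewrite /n /= !(oddM, oddS) negbK.
rewrite !splitsumD !splitsumN.
have -> : splitsum (fun u v => (-1) ^+ (size r * size v) *:
    (if u is d :: u' then W (v ++ x ∙ d :: u') else 0)) (c :: r) =
    connes (dform (x ∙ c) r).
  by rewrite connes_split /= scaler0 add0r.
have -> : splitsum (fun u v => (-1) ^+ (n * size v) *: M u v) (c :: r) =
    - ((-1) ^+ size r *: connes (dform (last c r ∙ x) (belast c r))).
  have sr : size (belast c r) = size r by rewrite size_belast.
  move: sr; rewrite lastI splitsum_rcons scaler0 addr0 connes_split => ->.
  rewrite -signSZ -splitsumZ; apply: splitsum_ext => u v _.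
  have -> : M u (rcons v (last c r)) =
      (-1) ^+ size v *: W (v ++ last c r ∙ x :: u).
    by rewrite /M; case: v => [|a v] //=; rewrite last_rcons belast_rcons size_rcons.
  rewrite !scalerA -!exprD; apply: signZ.
  rewrite size_rcons !(oddD, oddM, oddS) /=.
  by case: (odd (size r)) (odd (size v)) => [] [].
zmod.
Qed.
End Connes.

(** * Cutting shuffles, and the side conditions *)
Section ShuffleSplit.
Variables (k : comPzRingType) (P : lmodType k) (S T X : Type).
Variables (f : S -> X) (g : T -> X).
Implicit Types (s : seq S) (t : seq T) (F : seq X -> seq X -> P).

Lemma splitsum_killl Y (F : seq Y -> seq Y -> P) w : (forall x u v, F (x :: u) v = 0) ->
  splitsum F w = F [::] w.
Proof.
case: w => //= x s F0; rewrite [X in _ + X](_ : _ = 0) ?addr0 //.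
by rewrite -[RHS](@splitsum0 k P _ s); apply: splitsum_ext => u v _.
Qed.

Lemma splitsum_killr Y (F : seq Y -> seq Y -> P) w : (forall x u v, F u (x :: v) = 0) ->
  splitsum F w = F w [::].
Proof.
elim: w F => //= x s IH F F0; rewrite F0 add0r.
by apply: (IH (fun u => F (x :: u))) => y u v; apply: F0.
Qed.

Lemma splitsum_kill_prefix Y (F : seq Y -> seq Y -> P) u m z :
  (forall u1 u2 v, F (u1 ++ m :: u2) v = 0) ->
  splitsum F (u ++ m :: z) = splitsum (fun u1 u2 => F u1 (u2 ++ m :: z)) u.
Proof.
move=> F0; rewrite splitsum_cat /= cats0 [X in _ + (_ + X)](_ : _ = 0).
  by zmod.
by rewrite -[RHS](@splitsum0 k P _ z); apply: splitsum_ext => p q _.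
Qed.

Lemma shufflesum_killl (H : seq X -> P) a s w :
  (forall u v x, H (u ++ f x :: v) = 0) ->
  shufflesum H (map f (a :: s)) w = 0.
Proof.
move=> H0; elim: w s a H H0 => [|y w IHw] s a H H0.
  by rewrite shufflesum_nilr (H0 [::]).
rewrite /= shufflesum_cons -/(map f (a :: s)).
rewrite (IHw s a (fun w => H (y :: w))) => [|u v x]; last exact: (H0 (y :: u)).
rewrite scaler0 addr0 -[RHS](shufflesum0 P (map f s) (y :: w)).
by apply: shufflesum_ext => v _; apply: (H0 [::]).
Qed.

Lemma shufflesum_killr (H : seq X -> P) b w t :
  (forall u v x, H (u ++ g x :: v) = 0) ->
  shufflesum H w (map g (b :: t)) = 0.
Proof.
move=> H0; elim: w t b H H0 => [|y w IHw] t b H H0.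
  by rewrite shufflesum_nil (H0 [::]).
rewrite /= shufflesum_cons -/(map g (b :: t)).
rewrite (IHw t b (fun w => H (y :: w))) => [|u v x]; last exact: (H0 (y :: u)).
rewrite add0r -(shufflesum0 P (y :: w) (map g t)).
rewrite (shufflesum_ext (K := fun => 0)) ?shufflesum0 ?scaler0 // => v _.
exact: (H0 [::]).
Qed.

(** A cut whose prefix contains an entry of the second word contributes 0, so that
    the prefix comes from the first word and is followed by a shuffle of the
    rest. *)
Lemma shufflesum_splitl F s t :
  (forall u1 u2 v y, F (u1 ++ g y :: u2) v = 0) ->
  shufflesum (splitsum F) (map f s) (map g t) =
  splitsum (fun s1 s2 => shufflesum (F (map f s1)) (map f s2) (map g t)) s.
Proof.
elim: s F => [|a s IH] F F0.
  rewrite /= !shufflesum_nil; case: t => [|b t] //.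
  rewrite /= (splitsum_killl (F := fun u => F (g b :: u))).
    by rewrite (F0 [::] [::]) addr0.
  by move=> x u v; apply: (F0 [::]).
have FS u v : splitsum F (u :: v) = F [::] (u :: v) + splitsum (fun w => F (u :: w)) v by [].
case: t IH => [|b t] IH.
  rewrite shufflesum_nilr splitsum_map; apply: splitsum_ext => u v _.
  by rewrite shufflesum_nilr.
rewrite [LHS]shufflesum_cons -/(map g t) -/(map f s) [RHS]/=.
have -> : shufflesum (fun w => splitsum F (g b :: w)) (f a :: map f s) (map g t) =
    shufflesum (fun w => F [::] (g b :: w)) (f a :: map f s) (map g t).
  apply: shufflesum_ext => w _; rewrite FS splitsum_killl ?(F0 [::]) ?addr0 //.
  by move=> x u v; apply: (F0 [::]).
have -> : shufflesum (fun w => splitsum F (f a :: w)) (map f s) (g b :: map g t) =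
    shufflesum (fun w => F [::] (f a :: w)) (map f s) (g b :: map g t) +
    splitsum (fun s1 s2 => shufflesum (F (f a :: map f s1)) (map f s2)
                             (g b :: map g t)) s.
  rewrite -(IH (fun u => F (f a :: u))) => [|u1 u2 v y]; last exact: (F0 (_ :: u1)).
  by rewrite -shufflesumD; apply: shufflesum_ext => w _.
by rewrite shufflesum_cons addrAC.
Qed.

(** As in [shufflesum_splitl], with the words exchanged: the sign is that of
    moving the prefix in front of the first word. *)
Lemma shufflesum_splitr F s t :
  (forall u1 u2 v x, F (u1 ++ f x :: u2) v = 0) ->
  shufflesum (splitsum F) (map f s) (map g t) =
  splitsum (fun t1 t2 => (-1) ^+ (size s * size t1) *:
    shufflesum (F (map g t1)) (map f s) (map g t2)) t.
Proof.
elim: t F => [|b t IH] F F0.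
  rewrite /= !shufflesum_nilr muln0 scale1r; case: s => [|a s] //.
  rewrite /= (splitsum_killl (F := fun u => F (f a :: u))).
    by rewrite (F0 [::] [::]) addr0.
  by move=> x u v; apply: (F0 [::]).
have FS u v : splitsum F (u :: v) = F [::] (u :: v) + splitsum (fun w => F (u :: w)) v by [].
case: s IH => [|a s] IH.
  rewrite shufflesum_nil splitsum_map; apply: splitsum_ext => u v _.
  by rewrite shufflesum_nil scale1r.
rewrite [LHS]shufflesum_cons -/(map g t) -/(map f s) [RHS]/= muln0 scale1r.
have -> : shufflesum (fun w => splitsum F (f a :: w)) (map f s) (g b :: map g t) =
    shufflesum (fun w => F [::] (f a :: w)) (map f s) (g b :: map g t).
  apply: shufflesum_ext => w _; rewrite FS splitsum_killl ?(F0 [::]) ?addr0 //.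
  by move=> x u v; apply: (F0 [::]).
have -> : shufflesum (fun w => splitsum F (g b :: w)) (f a :: map f s) (map g t) =
    shufflesum (fun w => F [::] (g b :: w)) (f a :: map f s) (map g t) +
    splitsum (fun t1 t2 => (-1) ^+ (size (a :: s) * size t1) *:
       shufflesum (F (g b :: map g t1)) (f a :: map f s) (map g t2)) t.
  rewrite -(IH (fun u => F (g b :: u))) => [|u1 u2 v y]; last exact: (F0 (_ :: u1)).
  by rewrite -shufflesumD; apply: shufflesum_ext => w _.
rewrite shufflesum_cons scalerDr addrA; congr (_ + _).
rewrite -splitsumZ; apply: splitsum_ext => u v _.
by rewrite scalerA -exprD size_map -mulnS.
Qed.

(** When moreover no suffix may contain an entry of the first word, the only cut
    left is the one between the two words. *)
Lemma shufflesum_cut F s t :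
  (forall u1 u2 v y, F (u1 ++ g y :: u2) v = 0) ->
  (forall u v1 v2 x, F u (v1 ++ f x :: v2) = 0) ->
  shufflesum (splitsum F) (map f s) (map g t) = F (map f s) (map g t).
Proof.
move=> F1 F2; rewrite shufflesum_splitl // splitsum_killr ?shufflesum_nil //.
by move=> x u v; apply: shufflesum_killl => v1 v2 y; apply: F2.
Qed.

Lemma shufflesum_cutC F s t :
  (forall u1 u2 v x, F (u1 ++ f x :: u2) v = 0) ->
  (forall u v1 v2 y, F u (v1 ++ g y :: v2) = 0) ->
  shufflesum (splitsum F) (map f s) (map g t) =
  (-1) ^+ (size s * size t) *: F (map g t) (map f s).
Proof.
move=> F1 F2; rewrite shufflesum_splitr // splitsum_killr ?shufflesum_nilr //.
move=> x u v; rewrite shufflesum_killr ?scaler0 // => v1 v2 y; exact: F2.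
Qed.
End ShuffleSplit.

Section PairIdentities.
Variables (k : comPzRingType) (A B : unitalAlgType k).
Implicit Types (X Y : A * B) (w : seq (A * B)) (s : seq A) (t : seq B).

Lemma unzip1_pairA s : unzip1 (map (@pairA k A B) s) = s.
Proof. by rewrite /unzip1 -map_comp map_id. Qed.
Lemma unzip2_pairB t : unzip2 (map (@pairB k A B) t) = t.
Proof. by rewrite /unzip2 -map_comp map_id. Qed.
Lemma prod2_pairA s : algprod (unzip2 (map (@pairA k A B) s)) = 𝟙.
Proof. by elim: s => //= a s ->; rewrite algmul1x. Qed.
Lemma prod1_pairB t : algprod (unzip1 (map (@pairB k A B) t)) = 𝟙.
Proof. by elim: t => //= b t ->; rewrite algmul1x. Qed.

Lemma algprod_cat (C : unitalAlgType k) (u v : seq C) :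
  algprod (u ++ v) = algprod u ∙ algprod v.
Proof. by elim: u => [|c u IH] /=; rewrite ?algmul1x // IH algmulA. Qed.

Lemma unzip1_insA s2 X s1 :
  unzip1 (map (@pairA k A B) s2 ++ X :: map (@pairA k A B) s1) = s2 ++ X.1 :: s1.
Proof. by rewrite /unzip1 map_cat /= -/unzip1 !unzip1_pairA. Qed.

Lemma unzip2_insB t2 X t1 :
  unzip2 (map (@pairB k A B) t2 ++ X :: map (@pairB k A B) t1) = t2 ++ X.2 :: t1.
Proof. by rewrite /unzip2 map_cat /= -/unzip2 !unzip2_pairB. Qed.

Lemma prod2_insA s2 X s1 :
  algprod (unzip2 (map (@pairA k A B) s2 ++ X :: map (@pairA k A B) s1)) = X.2.
Proof.
by rewrite /unzip2 map_cat /= algprod_cat /= !prod2_pairA algmul1x algmulx1.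
Qed.

Lemma prod1_insB t2 X t1 :
  algprod (unzip1 (map (@pairB k A B) t2 ++ X :: map (@pairB k A B) t1)) = X.1.
Proof.
by rewrite /unzip1 map_cat /= algprod_cat /= !prod1_pairB algmul1x algmulx1.
Qed.

Definition AW_term X u v : Omega A ⊗ Omega B :=
  dform (algprod (unzip1 v) ∙ X.1) (unzip1 u) ⊗ₜ
  dform (X.2 ∙ algprod (unzip2 u)) (unzip2 v).

Lemma AW_term_kill1 X u1 T u2 v : T.1 = 𝟙 -> AW_term X (u1 ++ T :: u2) v = 0.
Proof.
move=> T1; rewrite /AW_term /unzip1 [map _ (u1 ++ _)]map_cat /= T1.
have [_ _ ->] := form_compat A; exact: linear0f (tens_linearl _).
Qed.

Lemma AW_term_kill2 X u v1 T v2 : T.2 = 𝟙 -> AW_term X u (v1 ++ T :: v2) = 0.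
Proof.
move=> T2; rewrite /AW_term /unzip2 [map _ (v1 ++ _)]map_cat /= T2.
have [_ _ ->] := form_compat B; exact: linear0f (tens_linearr _).
Qed.

(** AW reads the entries of the prefix in A and those of the suffix in B, where
    the entries coming from the other factor are d1 = 0; by [shufflesum_cut] one
    cut of one shuffle remains. *)
Lemma AW_sh (z : Omega A ⊗ Omega B) : AW (sh z) = z.
Proof.
move: z; apply: Omega2_eq; try lin.
move=> a s b t; rewrite sh_pair /sh_word shufflesum_linear.
rewrite (shufflesum_ext (K := splitsum (AW_term (a, b)))); last first.
  by move=> w _; rewrite /= pmul1x -AW_split.
rewrite shufflesum_cut => [|*|*]; rewrite ?AW_term_kill1 ?AW_term_kill2 //.
rewrite /AW_term unzip1_pairA unzip2_pairB prod2_pairA prod1_pairB /=.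
by rewrite algmul1x algmulx1.
Qed.

Lemma connes_pair X w : connes (pair_form X w) =
  splitsum (P := Omega (A ⊗ B)) (fun u v =>
    (-1) ^+ (size w * size v) *: pair_form (pone A B) (v ++ X :: u)) w.
Proof.
rewrite connes_split splitsum_map; apply: splitsum_ext => u v _.
by rewrite !size_map /pair_form map_cat.
Qed.

(** Cut a rotation v a_0 u of a shuffle. If the cut lies in u, the prefix of the
    cut may only contain entries of A and the rest of the word only entries of B:
    hence v ++ a_0 :: u1 is a rotation in A, followed by the form on B. If the cut
    lies in v, the roles are exchanged. *)
Lemma AW_connes_sh (z : Omega A ⊗ Omega B) :
  AW (connes (sh z)) = tder (@connes k A) (@grading k A) (@connes k B) z.
Proof.
move: z; apply: Omega2_eq; try lin.
move=> a s b t; rewrite tder_tens; try exact: linearP.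
rewrite sh_pair /sh_word !shufflesum_linear grading_form.
set X := (a, b); set p := size s; set q := size t.
set sA := map _ s; set tB := map _ t.
pose Phi := AW_term (pone A B).
have PhiA u1 u2 v c : Phi (u1 ++ pairB A c :: u2) v = 0 by exact: AW_term_kill1.
have PhiB u v1 v2 c : Phi u (v1 ++ pairA B c :: v2) = 0 by exact: AW_term_kill2.
rewrite (shufflesum_ext (K := fun w =>
   splitsum (fun u v => (-1) ^+ ((p + q) * size v) *:
     splitsum (fun v1 v2 => Phi v1 (v2 ++ X :: u)) v) w +
   splitsum (fun u v => splitsum (fun u1 u2 => (-1) ^+ ((p + q) * size v) *:
     Phi (v ++ X :: u1) u2) u) w)); last first.
  move=> w; rewrite !size_map -/p -/q => sw; rewrite /= pmul1x connes_pair.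
  rewrite splitsum_linear -splitsumD; apply: splitsum_ext => u v _.
  rewrite linearZ splitsumZ -scalerDr sw; congr (_ *: _).
  rewrite -[LHS]/(AW _) AW_split splitsum_cat /= cats0 /Phi /AW_term /=; zmod.
rewrite shufflesumD addrC; congr (_ + _).
  rewrite (shufflesum_ext (K := splitsum (fun u1 v' => splitsum (fun u2 v =>
      (-1) ^+ ((p + q) * size v) *: Phi (v ++ X :: u1) u2) v'))); last first.
    move=> w _; exact: (splitsum_coassoc (fun u1 u2 v =>
      (-1) ^+ ((p + q) * size v) *: Phi (v ++ X :: u1) u2)).
  rewrite shufflesum_splitl.
    rewrite connes_split -[RHS]/(tensl _ _) splitsum_linear.
    apply: splitsum_ext => s1 s2 ss.
    rewrite shufflesum_cutC.
    - rewrite scalerA -exprD linearZ /= /Phi /AW_term /tensl size_map.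
      rewrite unzip2_pairB prod1_pairB unzip1_insA prod2_insA /= algmulx1 algmul1x.
      apply: signZ; rewrite -/p -/q !(oddD, oddM).
      by case: (odd p) (odd q) (odd (size s2)) => [] [] [].
    - by move=> *; rewrite PhiB scaler0.
    - by move=> u v1 v2 c; rewrite -catA cat_cons PhiA scaler0.
  move=> u1 u2 v c.
  rewrite -[RHS](@splitsum0 k (Omega A ⊗ Omega B) _ v).
  by apply: splitsum_ext => v1 v2 _; rewrite -cat_cons catA PhiA scaler0.
rewrite shufflesum_splitr; last first.
  move=> u1 u2 v c.
  rewrite -[RHS](scaler0 _ ((-1) ^+ ((p + q) * size v))); congr (_ *: _).
  rewrite -[RHS](@splitsum0 k (Omega A ⊗ Omega B) _ v).
  by apply: splitsum_ext => v1 v2 _; rewrite -cat_cons catA PhiB.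
rewrite connes_split -[RHS]/(tens _ _) splitsum_linear.
apply: splitsum_ext => t1 t2 tt.
rewrite (shufflesum_ext (K := fun v => (-1) ^+ ((p + q) * (p + size t2)) *:
   splitsum (fun v1 v2 => Phi v1 (v2 ++ X :: map (@pairB k A B) t1)) v)); last first.
  by move=> w; rewrite !size_map => ->.
rewrite shufflesumZ shufflesum_cut; last 2 first.
- by move=> *; apply: PhiA.
- by move=> u v1 v2 c; rewrite -catA cat_cons PhiB.
rewrite -[RHS]/(_ ⊗ₜ _) tensZr tensZl !scalerA -!exprD /Phi /AW_term.
rewrite unzip1_pairA prod2_pairA unzip2_insB prod1_insB /= algmulx1 algmul1x.
apply: signZ; have -> : q = (size t1 + size t2)%N by rewrite /q -tt size_cat.
rewrite -/p -tt size_cat !(oddD, oddM).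
by case: (odd p) (odd (size t1)) (odd (size t2)) => [] [] [].
Qed.

Lemma shufflesum_zero (P : lmodType k) (U : eqType) (H : seq U -> P) (s t : seq U) :
  (forall w : seq U, {subset w <= s ++ t} -> {subset s ++ t <= w} -> H w = 0) ->
  shufflesum H s t = 0.
Proof.
move=> H0; rewrite /shufflesum big1_seq // => e /andP[_ /mem_shuffles pe].
by rewrite H0 ?scaler0 // => x; rewrite (perm_mem pe).
Qed.

Lemma pair_form_one X w : pone A B \in w -> pair_form X w = 0.
Proof.
case/splitPr=> u v; rewrite /pair_form map_cat.
by have [_ _ ->] := form_compat (A ⊗ B).
Qed.

(** If every entry lies in A or in B, then either an entry of A that is shuffled is
    1, or all the entries whose B-parts are multiplied lie in A and their product
    is 1. In both cases d1 appears. *)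
Lemma phi_axis X w : {in w, forall T, (T.1 == 𝟙) || (T.2 == 𝟙)} ->
  phi (pair_form X w) = 0.
Proof.
move=> axis; rewrite phi_pair (phi_word_split _ _ _ (@pair_form_normalized k A B)).
rewrite -[RHS](@splitsum0 k (Omega (A ⊗ B)) _ w); apply: splitsum_ext => u v uv.
rewrite -[RHS](scaler0 _ ((-1) ^+ size u)); congr (_ *: _).
rewrite -[RHS](@splitsum0 k (Omega (A ⊗ B)) _ v); apply: splitsum_ext => v1 v2 v12.
case: (boolP (𝟙 \in unzip1 v1)) => [h|h]; apply: shufflesum_zero => z zs sz.
  rewrite /= pair_form_one // mem_cat in_cons sz ?orbT //.
  by rewrite mem_cat; apply/orP; left; apply/mapP; exists 𝟙.
suff e : algprod (unzip2 v1) = 𝟙.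
  by rewrite /= pair_form_one // mem_cat in_cons e algmulx1 eqxx orbT.
have {}axis : {in v1, forall T, (T.1 == 𝟙) || (T.2 == 𝟙)}.
  by move=> T Tv; apply: axis; rewrite -uv -v12 !mem_cat Tv orbT.
elim: v1 h axis {v12 zs sz} => //= T v1 IH; rewrite in_cons negb_or => /andP[T1 h] axis.
have := axis T (mem_head _ _); rewrite eq_sym (negPf T1) => /eqP ->.
rewrite algmul1x IH // => T' Tv; apply: axis; rewrite in_cons Tv orbT //.
Qed.

Lemma phi_sh (z : Omega A ⊗ Omega B) : phi (sh z) = 0.
Proof.
move: z; apply: Omega2_eq; try lin; first by move=> c x y; rewrite scaler0 addr0.
move=> a s b t; rewrite sh_pair shufflesum_linear.
apply: shufflesum_zero => w ws _; rewrite /= phi_axis // => T /ws.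
by rewrite mem_cat => /orP[] /mapP[x _ ->]; rewrite eqxx ?orbT.
Qed.

(** A term of phi contains the entries c = d(b_1 ... b_p) and d a_1 in this order.
    A cut of the word before the latter puts d a_1, which is d1 in B, in the
    suffix, and a cut after it puts c, which is d1 in A, in the prefix. *)
Lemma AW_phi (x : Omega (A ⊗ B)) : AW (phi x) = 0.
Proof.
move: x; apply: Omega_pair_eq; try lin; first by move=> c x y; rewrite scaler0 addr0.
move=> X w; rewrite phi_pair (phi_word_split _ _ _ (@pair_form_normalized k A B)).
rewrite splitsum_linear -[RHS](@splitsum0 k (Omega A ⊗ Omega B) _ w).
apply: splitsum_ext => u v _.
rewrite linearZ -[RHS](scaler0 _ ((-1) ^+ size u)); congr (_ *: _).
rewrite splitsum_linear -[RHS](@splitsum0 k (Omega A ⊗ Omega B) _ v).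
apply: splitsum_ext => v1 v2 _; rewrite sh_cochain_linear /=.
apply: shufflesum_zero => z _ sz /=.
set Y := pmul _ X; set m := (𝟙, _).
case: v1 sz @m => [|T v1] sz m.
  by rewrite pair_form_one ?linear0 // mem_cat in_cons /m /= algmul1x eqxx orbT.
have : pairA B T.1 \in z by rewrite sz //= mem_head.
case/splitPr=> z1 z2; rewrite AW_split.
rewrite (splitsum_kill_prefix (F := AW_term Y)); last first.
  by move=> u1 u2 v'; apply: AW_term_kill1.
rewrite -[RHS](@splitsum0 k (Omega A ⊗ Omega B) _ u); apply: splitsum_ext => u1 u2 _.
by rewrite -cat_cons catA AW_term_kill2.
Qed.
End PairIdentities.

(** * Naturality *)
Section Naturality.
Variable k : comPzRingType.
Implicit Types (A B C : unitalAlgType k).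

Lemma tmap_morphism A A' B B' (f : A -> A') (g : B -> B') :
  algebra_morphism f -> algebra_morphism g -> algebra_morphism (tmap f g).
Proof.
case=> fl f1 fM [gl g1 gM]; have tl := tmap_linear fl gl.
split=> //; first by rewrite tmap_tens // f1 g1.
move=> x y; move: x; apply: tensor_eq => [||a b].
- by apply: (lin_comp tl); apply: algmul_linearl.
- move=> c x z; rewrite tl; exact: algmul_linearl.
move: y; apply: tensor_eq => [||a' b'].
- by apply: (lin_comp tl); apply: algmul_linearr.
- by move=> c x z; rewrite tl; exact: algmul_linearr.
rewrite [_ ∙ _]tensor_mul_tens !tmap_tens // fM gM.
by rewrite [RHS]tensor_mul_tens.
Qed.

Lemma Omega_map_linear A A' (f : A -> A') :
  algebra_morphism f -> linear (Omega_map f).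
Proof.
case: (form_compat A') => F0 FS F1 [fl f1 _]; apply: flift_linear; split.
- by move=> u c a a'; rewrite fl F0.
- by move=> a u v c b b'; rewrite !map_cat /= fl FS.
- by move=> a u v; rewrite map_cat /= f1 F1.
Qed.

(** A map such as Omega_map f is linear only under a hypothesis on f, so that it
    has no canonical linear structure; the proof is carried by this constant. *)
Definition lin_pack (M N : lmodType k) (f : M -> N) (fl : linear f) := f.
HB.instance Definition _ (M N : lmodType k) (f : M -> N) (fl : linear f) :=
  GRing.isLinear.Build k M N *:%R (lin_pack fl) fl.

Lemma Omega_map_hochschild A A' (f : A -> A') (fm : algebra_morphism f) x :
  Omega_map f (hochschild x) = hochschild (Omega_map f x).
Proof.
have ml := Omega_map_linear fm; move: x; apply: Omega_eq.
- by apply: (lin_comp ml); exact: linearP.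
- by apply: (lin_comp _ ml); exact: linearP.
move=> a w; rewrite Omega_map_form // !hochschild_bar.
case: (fm) => fl f1 fM; rewrite -f1 (bar_map _ _ _ _ fM).
rewrite -[LHS]/(lin_pack ml _) bar_linear; apply: bar_ext => -[|t u] z _ //=.
  exact: linear0f ml.
by rewrite /lin_pack Omega_map_form // fM.
Qed.

Lemma Omega_map_connes A A' (f : A -> A') (fm : algebra_morphism f) x :
  Omega_map f (connes x) = connes (Omega_map f x).
Proof.
have ml := Omega_map_linear fm; move: x; apply: Omega_eq.
- by apply: (lin_comp ml); exact: linearP.
- by apply: (lin_comp _ ml); exact: linearP.
move=> a w; rewrite Omega_map_form // !connes_split splitsum_map.
rewrite -[LHS]/(lin_pack ml _) splitsum_linear; apply: splitsum_ext => u v _.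
rewrite linearZ /= /lin_pack Omega_map_form // map_cat !size_map /=.
by case: fm => _ ->.
Qed.

Lemma Omega_map_bB A A' (f : A -> A') (fm : algebra_morphism f) x :
  Omega_map f (bB x) = bB (Omega_map f x).
Proof.
rewrite /bB -Omega_map_hochschild // -Omega_map_connes //.
exact: (linearD (lin_pack (Omega_map_linear fm))).
Qed.

Lemma algprod_map A A' (f : A -> A') (s : seq A) : algebra_morphism f ->
  algprod (map f s) = f (algprod s).
Proof. by case=> _ f1 fM; elim: s => [|a s IH] /=; rewrite ?f1 // fM IH. Qed.

Section Pair.
Variables (A A' B B' : unitalAlgType k) (f : A -> A') (g : B -> B').
Hypotheses (fm : algebra_morphism f) (gm : algebra_morphism g).
Local Notation fg := (tmap f g).
Let fgm : algebra_morphism fg := tmap_morphism fm gm.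
Let ml := Omega_map_linear fgm.

Definition pair_map (X : A * B) : A' * B' := (f X.1, g X.2).

Let fm1 : f 𝟙 = 𝟙. Proof. by case: fm. Qed.
Let gm1 : g 𝟙 = 𝟙. Proof. by case: gm. Qed.
Let fM x y : f (x ∙ y) = f x ∙ f y. Proof. by case: fm => _ _ ->. Qed.
Let gM x y : g (x ∙ y) = g x ∙ g y. Proof. by case: gm => _ _ ->. Qed.

Lemma tmap_tens_pair X : fg (tens_pair X) = tens_pair (pair_map X).
Proof. by case: fm gm => fl _ _ [gl _ _]; rewrite /tens_pair tmap_tens. Qed.

Lemma Omega_map_pair X w :
  Omega_map fg (pair_form X w) = pair_form (pair_map X) (map pair_map w).
Proof.
rewrite Omega_map_form // /pair_form tmap_tens_pair -!map_comp.
by congr dform; apply: eq_map => Y; apply: tmap_tens_pair.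
Qed.

Lemma map_pairA s : map pair_map (map (@pairA k A B) s) = map (@pairA k A' B') (map f s).
Proof. by rewrite -!map_comp; apply: eq_map => a; rewrite /pair_map /= gm1. Qed.
Lemma map_pairB s : map pair_map (map (@pairB k A B) s) = map (@pairB k A' B') (map g s).
Proof. by rewrite -!map_comp; apply: eq_map => a; rewrite /pair_map /= fm1. Qed.

Lemma sh_word_map (P : lmodType k) (G : seq (A' * B') -> A' * B' -> P) X s t Y :
  sh_word G (pair_map X) (map f s) (map g t) (pair_map Y) =
  sh_word (fun u z => G (map pair_map u) (pair_map z)) X s t Y.
Proof. by rewrite /sh_word -map_pairA -map_pairB shufflesum_map. Qed.

Lemma unzip1_map w : unzip1 (map pair_map w) = map f (unzip1 w).
Proof. by rewrite /unzip1 -!map_comp. Qed.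
Lemma unzip2_map w : unzip2 (map pair_map w) = map g (unzip2 w).
Proof. by rewrite /unzip2 -!map_comp. Qed.

Lemma shaw_word_map (P : lmodType k) (G : seq (A' * B') -> A' * B' -> P) X w Y :
  shaw_word G (pair_map X) (map pair_map w) (pair_map Y) =
  shaw_word (fun u z => G (map pair_map u) (pair_map z)) X w Y.
Proof.
rewrite /shaw_word /aw_word splitsum_map; apply: splitsum_ext => u v _.
rewrite !unzip1_map !unzip2_map (algprod_map _ fm) (algprod_map _ gm) -fM -gM /=.
by rewrite -(sh_word_map _ (X.1, X.2 ∙ _) _ _ (_, Y.2)).
Qed.

Lemma phi_word_map (P : lmodType k) (G : seq (A' * B') -> A' * B' -> P) X w Y :
  phi_word G (pair_map X) (map pair_map w) (pair_map Y) =
  phi_word (fun u z => G (map pair_map u) (pair_map z)) X w Y.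
Proof.
elim: w G X => [//|T w IH] G X /=; rewrite (IH (fun u => G (pair_map X :: u))).
have -> : pone A' B' = pair_map (pone A B) by rewrite /pair_map fm1 gm1.
by rewrite -/(map pair_map (T :: w)) shaw_word_map.
Qed.

Lemma sh_natural z :
  Omega_map fg (sh z) = sh (tmap (Omega_map f) (Omega_map g) z).
Proof.
have fl := Omega_map_linear fm; have gl := Omega_map_linear gm.
have tl := tmap_linear fl gl.
move: z; apply: Omega2_eq.
- by apply: (lin_comp ml); exact: linearP.
- by apply: (lin_comp _ tl); exact: linearP.
move=> a s b t; rewrite tmap_tens // !Omega_map_form // !sh_pair.
rewrite -[LHS]/(lin_pack ml _) shufflesum_linear.
rewrite -[(f a, g b)]/(pair_map (a, b)).
have -> : pone A' B' = pair_map (pone A B) by rewrite /pair_map fm1 gm1.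
rewrite sh_word_map; apply: shufflesum_ext => w _ /=.
rewrite /lin_pack Omega_map_pair; congr pair_form.
by rewrite /pair_map /pmul /= fM gM.
Qed.

Lemma AW_natural x :
  tmap (Omega_map f) (Omega_map g) (AW x) = AW (Omega_map fg x).
Proof.
have fl := Omega_map_linear fm; have gl := Omega_map_linear gm.
have tl := tmap_linear fl gl.
move: x; apply: Omega_pair_eq.
- by apply: (lin_comp tl); exact: linearP.
- by apply: (lin_comp _ ml); exact: linearP.
move=> X w; rewrite Omega_map_pair !AW_split splitsum_map.
rewrite -[LHS]/(lin_pack tl _) splitsum_linear; apply: splitsum_ext => u v _.
rewrite /= /lin_pack tmap_tens // !Omega_map_form //.
by rewrite !unzip1_map !unzip2_map (algprod_map _ fm) (algprod_map _ gm) /= fM gM.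
Qed.

Lemma phi_natural x : Omega_map fg (phi x) = phi (Omega_map fg x).
Proof.
move: x; apply: Omega_pair_eq.
- by apply: (lin_comp ml); exact: linearP.
- by apply: (lin_comp _ ml); exact: linearP.
move=> X w; rewrite Omega_map_pair !phi_pair.
have -> : pone A' B' = pair_map (pone A B) by rewrite /pair_map fm1 gm1.
rewrite phi_word_map -[LHS]/(lin_pack ml _) phi_word_linear.
apply: phi_word_ext => -[|T u] z //= _; rewrite /lin_pack Omega_map_pair.
by congr pair_form; rewrite /pair_map /pmul /= fM gM.
Qed.
End Pair.
End Naturality.

(** * Associativity of the shuffle map and coassociativity of the Alexander-Whitney map *)
Section Associator.
Variables (k : comPzRingType) (M N P : lmodType k).

Let inner (z : P) : linear (tlift (fun (x : M) (y : N) => x ⊗ₜ (y ⊗ₜ z))).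
Proof.
apply: tlift_linear => [y|x]; first exact: tens_linearl.
apply: lin_tr; exact: tens_linearl.
Qed.
Let outer (t : M ⊗ N) :
  linear (fun z : P => tlift (fun x y => x ⊗ₜ (y ⊗ₜ z)) t).
Proof.
apply: lin_sum => p _; apply: lin_scale; apply: lin_tr; exact: tens_linearr.
Qed.
Let innerV (x : M) : linear (tlift (fun (y : N) (z : P) => x ⊗ₜ y ⊗ₜ z)).
Proof.
apply: tlift_linear => [z|y]; last exact: tens_linearr.
apply: lin_tl; exact: tens_linearr.
Qed.
Let outerV (t : N ⊗ P) :
  linear (fun x : M => tlift (fun y z => x ⊗ₜ y ⊗ₜ z) t).
Proof.
apply: lin_sum => p _; apply: lin_scale; apply: lin_tl; exact: tens_linearl.
Qed.

Lemma tassoc_linear : linear (@tassoc k M N P).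
Proof. exact: tlift_linear. Qed.
Lemma tassocV_linear : linear (@tassocV k M N P).
Proof. exact: tlift_linear. Qed.

Lemma tassoc_tens (x : M) (y : N) (z : P) :
  tassoc (x ⊗ₜ y ⊗ₜ z) = x ⊗ₜ (y ⊗ₜ z).
Proof.
rewrite /tassoc tlift_tens // tlift_tens // => [y' |x'].
  exact: tens_linearl.
apply: lin_tr; exact: tens_linearl.
Qed.
Lemma tassocV_tens (x : M) (y : N) (z : P) :
  tassocV (x ⊗ₜ (y ⊗ₜ z)) = x ⊗ₜ y ⊗ₜ z.
Proof.
rewrite /tassocV tlift_tens // tlift_tens // => [z' |y'].
  apply: lin_tl; exact: tens_linearr.
exact: tens_linearr.
Qed.
HB.instance Definition _ :=
  GRing.isLinear.Build k (M ⊗ N ⊗ P) (M ⊗ (N ⊗ P)) *:%R (@tassoc k M N P) tassoc_linear.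
HB.instance Definition _ :=
  GRing.isLinear.Build k (M ⊗ (N ⊗ P)) (M ⊗ N ⊗ P) *:%R (@tassocV k M N P) tassocV_linear.

Lemma tensor3_eq (Q : lmodType k) (f g : M ⊗ N ⊗ P -> Q) : linear f -> linear g ->
  (forall x y z, f (x ⊗ₜ y ⊗ₜ z) = g (x ⊗ₜ y ⊗ₜ z)) -> f =1 g.
Proof.
move=> fl gl e; apply: tensor_eq => // t z; move: t; apply: tensor_eq => // => x.
- by apply: (lin_comp fl); exact: tens_linearl.
by apply: (lin_comp gl); exact: tens_linearl.
Qed.
Lemma tensor3V_eq (Q : lmodType k) (f g : M ⊗ (N ⊗ P) -> Q) : linear f -> linear g ->
  (forall x y z, f (x ⊗ₜ (y ⊗ₜ z)) = g (x ⊗ₜ (y ⊗ₜ z))) -> f =1 g.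
Proof.
move=> fl gl e; apply: tensor_eq => // x t; move: t; apply: tensor_eq => // => y.
- by apply: (lin_comp fl); exact: tens_linearr.
by apply: (lin_comp gl); exact: tens_linearr.
Qed.

Lemma tassocK : cancel (@tassoc k M N P) (@tassocV k M N P).
Proof.
apply: tensor3_eq; try lin; move=> x y z.
by rewrite tassoc_tens tassocV_tens.
Qed.
Lemma tassocVK : cancel (@tassocV k M N P) (@tassoc k M N P).
Proof.
apply: tensor3V_eq; try lin; move=> x y z.
by rewrite tassocV_tens tassoc_tens.
Qed.
End Associator.

Section Associativity.
Variables (k : comPzRingType) (A B C : unitalAlgType k).

Lemma mul_tens (D E : unitalAlgType k) (a a' : D) (b b' : E) :
  (a ⊗ₜ b) ∙ (a' ⊗ₜ b') = (a ∙ a') ⊗ₜ (b ∙ b').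
Proof. exact: tensor_mul_tens. Qed.

Lemma tassoc_morphism : algebra_morphism (@tassoc k A B C).
Proof.
split; [exact: tassoc_linear | exact: tassoc_tens |] => x y.
have tl := @tassoc_linear k A B C.
move: x; apply: tensor3_eq => [||a b c].
- by move=> d u v; rewrite (algmul_linearl y d u v); apply: tl.
- exact: (lin_comp (algmul_linearl (tassoc y)) tl).
move: y; apply: tensor3_eq => [||a' b' c'].
- by move=> d u v; rewrite (algmul_linearr (a ⊗ₜ b ⊗ₜ c) d u v); apply: tl.
- exact: (lin_comp (algmul_linearr (tassoc (a ⊗ₜ b ⊗ₜ c))) tl).
by rewrite !mul_tens !tassoc_tens !mul_tens.
Qed.

Lemma tassocV_morphism : algebra_morphism (@tassocV k A B C).
Proof.
have K := @tassocK k A B C; have VK := @tassocVK k A B C.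
have [tl t1 tM] := tassoc_morphism.
split; first exact: tassocV_linear.
  exact: etrans (congr1 (@tassocV k A B C) (esym t1)) (K _).
move=> x y; have := tM (tassocV x) (tassocV y); rewrite (VK x) (VK y) => <-.
exact: K.
Qed.

Lemma Omega_mapK (D E : unitalAlgType k) (f : D -> E) (g : E -> D) :
  algebra_morphism f -> algebra_morphism g -> cancel f g ->
  cancel (Omega_map f) (Omega_map g).
Proof.
move=> fm gm fK; apply: Omega_eq => [||a w].
- apply: lin_comp; exact: Omega_map_linear.
- by [].
by rewrite !Omega_map_form // fK -map_comp map_id_in // => x _; apply: fK.
Qed.

Lemma Omega3_eq (P : lmodType k) (f g : Omega3 A B C -> P) :
  linear f -> linear g ->
  (forall a s b t c u,
    f (dform a s ⊗ₜ dform b t ⊗ₜ dform c u) =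
    g (dform a s ⊗ₜ dform b t ⊗ₜ dform c u)) -> f =1 g.
Proof.
move=> fl gl e; apply: tensor_eq => // x z; move: x; apply: Omega2_eq.
- by apply: (lin_comp fl); exact: tens_linearl.
- by apply: (lin_comp gl); exact: tens_linearl.
move=> a s b t; move: z; apply: Omega_eq => [||c u]; last exact: e.
- by apply: (lin_comp fl); exact: tens_linearr.
- by apply: (lin_comp gl); exact: tens_linearr.
Qed.

(** Both sides are the sum over the shuffles of three words. *)
Lemma sh_assoc (z : Omega3 A B C) :
  Omega_map (@tassocV k A B C) (sh (tmap id (@sh k B C) (tassoc z))) =
  sh (tmap (@sh k A B) id z).
Proof.
have tm := tassocV_morphism; have tl := Omega_map_linear tm.
have l1 : linear (tmap id (@sh k B C) : Omega A ⊗ (Omega B ⊗ Omega C) -> _).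
  by apply: tmap_linear => //; apply: sh_linear.
have l2 : linear (tmap (@sh k A B) id : Omega A ⊗ Omega B ⊗ Omega C -> _).
  by apply: tmap_linear => //; apply: sh_linear.
have sl := @sh_linear k; have al := @tassoc_linear k.
move: z; apply: Omega3_eq.
- exact: (lin_comp tl (lin_comp (sl A (B ⊗ C)) (lin_comp l1 (al _ _ _)))).
- exact: (lin_comp (sl (A ⊗ B) C) l2).
move=> a s b t c u; rewrite tassoc_tens !tmap_tens //; try exact: sl.
set X := a ⊗ₜ b ⊗ₜ c.
pose emb (y : B ⊗ C) : A ⊗ B ⊗ C := tassocV (𝟙 ⊗ₜ y).
pose sA := map (fun a => a ⊗ₜ 𝟙 ⊗ₜ 𝟙 : A ⊗ B ⊗ C) s.
have e w : Omega_map (@tassocV k A B C) (sh (dform a s ⊗ₜ dform (b ⊗ₜ c) w)) =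
    shufflesum (dform X) sA (map emb w).
  rewrite sh_form dform_shE -[LHS]/(lin_pack tl _) shufflesum_linear.
  have -> : sA = map (@tassocV k A B C) (map (@inA k A (B ⊗ C)) s).
    by rewrite -map_comp; apply: eq_map => y; rewrite /= tassocV_tens.
  have -> : map emb w = map (@tassocV k A B C) (map (@inB k A (B ⊗ C)) w).
    by rewrite -map_comp.
  rewrite shufflesum_map; apply: shufflesum_ext => v _ /=.
  by rewrite /lin_pack Omega_map_form // tassocV_tens.
have e' w : sh (dform (a ⊗ₜ b) w ⊗ₜ dform c u) =
    shufflesum (dform X) (map (@inA k (A ⊗ B) C) w) (map (@inB k (A ⊗ B) C) u).
  by rewrite sh_form dform_shE.
rewrite ![sh (dform _ _ ⊗ₜ dform _ _)]sh_form !dform_shE /=.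
transitivity (shufflesum (fun w => shufflesum (dform X) sA (map emb w))
  (map (@inA k B C) t) (map (@inB k B C) u)).
  have L : linear (fun x => Omega_map (@tassocV k A B C) (sh (dform a s ⊗ₜ x))).
    exact: (lin_comp tl (lin_comp (sl A (B ⊗ C)) (tens_linearr (dform a s)))).
  rewrite -[LHS]/(lin_pack L _) shufflesum_linear.
  by apply: shufflesum_ext => w _; exact: e.
transitivity (shufflesum (fun w => shufflesum (dform X)
   (map (@inA k (A ⊗ B) C) w) (map (@inB k (A ⊗ B) C) u))
  (map (@inA k A B) s) (map (@inB k A B) t)); last first.
  have L : linear (fun x => sh (x ⊗ₜ dform c u) : Omega (A ⊗ B ⊗ C)).
    by move=> d x y; rewrite (tens_linearl (dform c u) d x y); apply: sl.
  rewrite -[RHS]/(lin_pack L _) shufflesum_linear.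
  by apply: shufflesum_ext => w _; rewrite -e'.
rewrite -(shufflesum_map emb (fun w => shufflesum (dform X) sA w)).
rewrite -shufflesum_assoc.
have -> : sA = map (@inA k (A ⊗ B) C) (map (@inA k A B) s) by rewrite -map_comp.
have -> : map emb (map (@inA k B C) t) =
    map (@inA k (A ⊗ B) C) (map (@inB k A B) t).
  by rewrite -!map_comp; apply: eq_map => y; rewrite /= /emb tassocV_tens.
have -> : map emb (map (@inB k B C) u) = map (@inB k (A ⊗ B) C) u.
  by rewrite -!map_comp; apply: eq_map => y; rewrite /= /emb tassocV_tens.
by rewrite shufflesum_map.
Qed.

Definition triple (q : A * B * C) : A ⊗ B ⊗ C := q.1.1 ⊗ₜ q.1.2 ⊗ₜ q.2.

Lemma triple_spanning : spanning triple.
Proof.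
move=> R Rh Rl R0; apply: tensor_ind => // t c; move: t.
apply: tensor_ind => [a b|d x y Rx Ry|]; first exact: (Rh (a, b, c)).
  by rewrite tens_linearl; apply: Rl.
by rewrite (linear0f (tens_linearl c)).
Qed.

Lemma algprod_tens_pair (D E : unitalAlgType k) (w : seq (D * E)) :
  algprod (map (@tens_pair k D E) w) = algprod (unzip1 w) ⊗ₜ algprod (unzip2 w).
Proof. by elim: w => //= X w ->; rewrite mul_tens. Qed.

(** Both sides are the sum over the cuts of the word into three parts, with the
    summand F below. *)
Lemma AW_coassoc (x : Omega (A ⊗ B ⊗ C)) :
  tassocV (tmap id (@AW k B C) (AW (Omega_map (@tassoc k A B C) x))) =
  tmap (@AW k A B) id (AW x).
Proof.
have tm := tassoc_morphism; have tl := Omega_map_linear tm.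
have l1 : linear (tmap id (@AW k B C) : Omega A ⊗ Omega (B ⊗ C) -> _).
  by apply: tmap_linear => //; apply: AW_linear.
have l2 : linear (tmap (@AW k A B) id : Omega (A ⊗ B) ⊗ Omega C -> _).
  by apply: tmap_linear => //; apply: AW_linear.
have l3 : linear (fun x : Omega A ⊗ Omega (B ⊗ C) => tassocV (tmap id (@AW k B C) x)).
  by move=> d x' y'; rewrite (l1 d x' y'); apply: tassocV_linear.
have al := @AW_linear k.
move: x; apply: (Omega_spanning_eq triple_spanning).
- by move=> d x y; rewrite tl al l3.
- by move=> d x y; rewrite al l2.
move=> q w; rewrite Omega_map_form //.
have -> : dform (triple q) (map triple w) =
    pair_form (q.1.1 ⊗ₜ q.1.2, q.2) (map (fun q => (q.1.1 ⊗ₜ q.1.2, q.2)) w).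
  by rewrite /pair_form -map_comp.
have -> : dform (tassoc (triple q)) (map (@tassoc k A B C) (map triple w)) =
    pair_form (q.1.1, q.1.2 ⊗ₜ q.2) (map (fun q => (q.1.1, q.1.2 ⊗ₜ q.2)) w).
  rewrite /pair_form -!map_comp /triple tassoc_tens; congr dform.
  by apply: eq_map => y; rewrite /= tassoc_tens.
rewrite !AW_split !splitsum_map.
pose P : lmodType k := Omega A ⊗ Omega B ⊗ Omega C.
pose fa (q : A * B * C) := q.1.1.
pose fb (q : A * B * C) := q.1.2.
pose fc (q : A * B * C) := q.2.
pose F u1 u2 v : P :=
  dform (algprod (map fa u2) ∙ (algprod (map fa v) ∙ fa q)) (map fa u1) ⊗ₜ
  dform (algprod (map fb v) ∙ fb q ∙ algprod (map fb u1)) (map fb u2) ⊗ₜ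
  dform (fc q ∙ algprod (map fc u1) ∙ algprod (map fc u2)) (map fc v).
transitivity (splitsum (fun u v => splitsum (fun u1 u2 => F u1 u2 v) u) w); last first.
  rewrite -[RHS]/(lin_pack l2 _) splitsum_linear; apply: splitsum_ext => u v _.
  rewrite /= /lin_pack tmap_tens //; last exact: al.
  pose ab (q : A * B * C) := (fa q, fb q).
  have e (z : seq (A * B * C)) :
      unzip1 [seq (q.1.1 ⊗ₜ q.1.2, q.2) | q <- z] = map (@tens_pair k A B) (map ab z).
    by rewrite /unzip1 -!map_comp.
  have e1 z : unzip1 (map ab z) = map fa z by rewrite /unzip1 -map_comp.
  have e2 z : unzip2 (map ab z) = map fb z by rewrite /unzip2 -map_comp.
  have e3 (z : seq (A * B * C)) :
      unzip2 [seq (q.1.1 ⊗ₜ q.1.2, q.2) | q <- z] = map fc z.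
    by rewrite /unzip2 -map_comp.
  rewrite !e !e3 algprod_tens_pair e1 e2 mul_tens.
  rewrite -[dform (_ ⊗ₜ _) _]/(pair_form (_, _) (map ab u)) AW_split splitsum_map.
  rewrite -[RHS]/(tensl _ _) splitsum_linear; apply: splitsum_ext => u1 u2 <-.
  by rewrite /= /tensl !e1 !e2 map_cat algprod_cat /F !algmulA.
rewrite splitsum_coassoc -[LHS]/(lin_pack l3 _) [LHS]splitsum_linear.
apply: splitsum_ext => u v _.
rewrite /= /lin_pack tmap_tens //; last exact: al.
pose bc (q : A * B * C) := (fb q, fc q).
have e (z : seq (A * B * C)) :
    unzip2 [seq (q.1.1, q.1.2 ⊗ₜ q.2) | q <- z] = map (@tens_pair k B C) (map bc z).
  by rewrite /unzip2 -!map_comp.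
have e1 z : unzip1 (map bc z) = map fb z by rewrite /unzip1 -map_comp.
have e2 z : unzip2 (map bc z) = map fc z by rewrite /unzip2 -map_comp.
have e3 (z : seq (A * B * C)) :
    unzip1 [seq (q.1.1, q.1.2 ⊗ₜ q.2) | q <- z] = map fa z.
  by rewrite /unzip1 -map_comp.
rewrite !e !e3 algprod_tens_pair e1 e2 mul_tens.
rewrite -[dform (_ ⊗ₜ _) _]/(pair_form (_, _) (map bc v)) AW_split splitsum_map.
set x := dform _ (map fa u).
have L : linear (fun y => tassocV (x ⊗ₜ y) : Omega A ⊗ Omega B ⊗ Omega C).
  by move=> d y z; rewrite (tens_linearr x d y z); apply: tassocV_linear.
rewrite -[LHS]/(lin_pack L _) splitsum_linear; apply: splitsum_ext => v1 v2 vv.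
rewrite /= /lin_pack tassocV_tens !e1 !e2 /x -vv map_cat algprod_cat.
by rewrite /F !algmulA.
Qed.
End Associativity.

(** * Counting letters *)
Section Span.
Variable k : comPzRingType.
Implicit Types M N : lmodType k.

Inductive lspan M (S : M -> Prop) : M -> Prop :=
| Lspan0 : lspan S 0
| LspanS c x y of S x & lspan S y : lspan S (c *: x + y).

Lemma lspan_gen M (S : M -> Prop) x : S x -> lspan S x.
Proof. by move=> Sx; rewrite -[x]scale1r -[_ *: _]addr0; apply: LspanS => //; apply: Lspan0. Qed.

Lemma lspan_comb M (S : M -> Prop) c x y : lspan S x -> lspan S y -> lspan S (c *: x + y).
Proof.
move=> Sx Sy; elim: Sx => [|d z t Sz _ IH]; first by rewrite scaler0 add0r.
by rewrite scalerDr scalerA -addrA; apply: LspanS.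
Qed.

Lemma lspanD M (S : M -> Prop) x y : lspan S x -> lspan S y -> lspan S (x + y).
Proof. by move=> Sx Sy; rewrite -[x]scale1r; apply: lspan_comb. Qed.

Lemma lspanZ M (S : M -> Prop) c x : lspan S x -> lspan S (c *: x).
Proof. by move=> Sx; rewrite -[_ *: _]addr0; apply: lspan_comb => //; apply: Lspan0. Qed.

Lemma lspan_sum M (S : M -> Prop) (I : Type) (r : seq I) (Q : pred I) F :
  (forall i, Q i -> lspan S (F i)) -> lspan S (\sum_(i <- r | Q i) F i).
Proof.
by move=> h; elim/big_ind: _ => //; [apply: Lspan0 | move=> x y; apply: lspanD].
Qed.

Lemma lspan_map M N (S : M -> Prop) (S' : N -> Prop) (f : M -> N) :
  linear f -> (forall x, S x -> lspan S' (f x)) ->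
  forall x, lspan S x -> lspan S' (f x).
Proof.
move=> fl h x; elim=> [|c y z Sy _ IH]; first by rewrite (linear0f fl); apply: Lspan0.
by rewrite fl; apply: lspan_comb => //; apply: h.
Qed.

Lemma lspan_sub M (S S' : M -> Prop) x :
  (forall x, S x -> lspan S' x) -> lspan S x -> lspan S' x.
Proof. by move=> h; apply: (lspan_map (f := fun x => x)). Qed.

Lemma lspan_eq0 M (S : M -> Prop) x : (forall x, S x -> x = 0) -> lspan S x -> x = 0.
Proof.
by move=> h; elim=> // c y z /h -> _ ->; rewrite scaler0 addr0.
Qed.

Lemma lspan_splitsum M (S : M -> Prop) X (F : seq X -> seq X -> M) s :
  (forall u v, u ++ v = s -> lspan S (F u v)) -> lspan S (splitsum F s).
Proof.
elim: s F => [|x s IH] F h /=; first exact: h.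
apply: lspanD; first exact: h.
by apply: IH => u v uv; apply: h; rewrite /= uv.
Qed.
End Span.

(** The number of letters of an element: wt n a says that a is made of at most n
    letters. Multiplication adds the numbers of letters, an element without
    letters is 1, and the elements with a bounded number of letters span. In a
    tensor product the letters of both factors are counted, so that the weight of
    a ⊗ b does not change when a ⊗ 1 and 1 ⊗ b are separated by a shuffle. *)
Record weighting (k : comPzRingType) (A : unitalAlgType k) := Weighting {
  wt :> nat -> A -> Prop;
  wt_bound : nat;
  wt_one : wt 0 𝟙;
  wt_mul : forall i j a b, wt i a -> wt j b -> wt (i + j) (a ∙ b);
  wt_eq1 : forall a, wt 0 a -> a = 𝟙;
  wt_leq : forall i j a, (i <= j)%N -> wt i a -> wt j a;
  wt_span : forall a, lspan (wt wt_bound) a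
}.

Section Weightings.
Variable k : comPzRingType.
Implicit Types A B C : unitalAlgType k.

Definition base_weight A : weighting A.
Proof.
pose w n (a : A) := a = 𝟙 \/ (0 < n)%N.
apply: (@Weighting k A w 1).
- by left.
- move=> i j a b [->|i0] [->|j0]; first by left; rewrite algmul1x.
  + by right; rewrite addn_gt0 j0 orbT.
  + by right; rewrite addn_gt0 i0.
  by right; rewrite addn_gt0 i0.
- by move=> a [].
- by move=> i j a ij [->|i0]; [left|right; apply: leq_trans ij].
by move=> a; apply: lspan_gen; right.
Defined.

Definition tensor_weight A B (wA : weighting A) (wB : weighting B) :
  weighting (A ⊗ B).
Proof.
pose w n (t : A ⊗ B) := exists i j a b,
  [/\ (i + j)%N = n, wA i a, wB j b & t = a ⊗ₜ b].
apply: (@Weighting k _ w (wt_bound wA + wt_bound wB)).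
- by exists 0%N, 0%N, 𝟙, 𝟙; split=> //; apply: wt_one.
- move=> _ _ _ _ [i [j [a [b [<- ia jb ->]]]]] [i' [j' [a' [b' [<- ia' jb' ->]]]]].
  exists (i + i')%N, (j + j')%N, (a ∙ a'), (b ∙ b'); rewrite addnACA mul_tens.
  by split=> //; apply: wt_mul.
- move=> _ [i [j [a [b [/eqP ij ia jb ->]]]]]; move: ij ia jb.
  by rewrite addn_eq0 => /andP[/eqP -> /eqP ->] /wt_eq1 -> /wt_eq1 ->.
- move=> n m _ nm [i [j [a [b [ij ia jb ->]]]]].
  exists i, (j + (m - n))%N, a, b; split=> //; first by rewrite addnA ij subnKC.
  by apply: wt_leq jb; rewrite leq_addr.
apply: tensor_ind => [a b|c x y Sx Sy|]; [|exact: lspan_comb|exact: Lspan0].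
have := wt_span wA a; apply: lspan_map (lin_tl b (fun _ _ _ => erefl)) _ _ => a' wa.
have := wt_span wB b; apply: lspan_map (tens_linearr a') _ _ => b' wb.
by apply: lspan_gen; exists (wt_bound wA), (wt_bound wB), a', b'.
Defined.

Section Words.
Variables (A : unitalAlgType k) (W : weighting A).
Implicit Types (s t : seq A).

Fixpoint word_weight N s : Prop :=
  if s is a :: s' then exists i j, [/\ (i + j)%N = N, W i a & word_weight j s']
  else True.

Lemma word_weight_leq M N s : (M <= N)%N -> word_weight M s -> word_weight N s.
Proof.
case: s => //= a s MN [i [j [ij wa ws]]].
exists (i + (N - M))%N, j; split=> //; first by rewrite addnAC ij subnKC.
by apply: wt_leq wa; rewrite leq_addr.
Qed.

Lemma word_weight_cat I J s t :
  word_weight I s -> word_weight J t -> word_weight (I + J) (s ++ t).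
Proof.
elim: s I => [|a s IH] I /=; first by move=> _; apply: word_weight_leq; rewrite leq_addl.
case=> i [j [<- wa ws]] wt; exists i, (j + J)%N; split=> //; first by rewrite addnA.
exact: IH.
Qed.

Lemma word_weight_catE N s t : word_weight N (s ++ t) ->
  exists I J, [/\ (I + J)%N = N, word_weight I s & word_weight J t].
Proof.
elim: s N => [|a s IH] N /=; first by exists 0%N, N.
case=> i [j [<- wa /IH [I [J [<- ws wt]]]]].
by exists (i + I)%N, J; split=> //; [rewrite addnA | exists i, I].
Qed.

Lemma word_weight_prod N s : word_weight N s -> W N (algprod s).
Proof.
elim: s N => [|a s IH] N /=; first by move=> _; apply: wt_leq (wt_one W).
by case=> i [j [<- wa /IH ws]]; apply: wt_mul.
Qed.

(** A word longer than its number of letters has an entry without letters. *)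
Lemma word_weight_one N s : word_weight N s -> (N < size s)%N -> 𝟙 \in s.
Proof.
elim: s N => [//|a s IH] N /= [[|i] [j [<- wa ws]]].
  by rewrite (wt_eq1 wa) in_cons eqxx.
rewrite addSn ltnS in_cons => h; apply/orP; right; apply: (IH j) => //.
by apply: leq_trans h; rewrite ltnS leq_addl.
Qed.

Definition form_weight n N (x : Omega A) : Prop :=
  exists a w, [/\ size w = n, word_weight N (a :: w) & x = dform a w].

Lemma form_weight0 n N x : form_weight n N x -> (N < n)%N -> x = 0.
Proof.
case=> a [w [<- [i [j [<- _ ww]]] ->]] h.
have : 𝟙 \in w by apply: (word_weight_one ww); apply: leq_ltn_trans h; rewrite leq_addl.
by case/splitPr=> u v; have [_ _ ->] := form_compat A.
Qed.

Lemma form_weight_span a w :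
  lspan (form_weight (size w) (wt_bound W * (size w).+1)) (dform a w).
Proof.
have [F0 FS _] := form_compat A.
pose Z n := (wt_bound W * n)%N.
suff h u v b : W (Z 1%N) b -> word_weight (Z (size u)) u ->
    lspan (form_weight (size (u ++ v)) (Z (size (u ++ v)).+1)) (dform b (u ++ v)).
  have := wt_span W a; apply: lspan_map (F0 w) _ _ => b wb.
  by apply: (h [::] w); rewrite /Z ?muln1.
elim: v u => [|c v IH] u wb wu.
  rewrite cats0; apply: lspan_gen; exists b, u; split=> //.
  by exists (Z 1%N), (Z (size u)); rewrite /Z -mulnDr add1n.
have := wt_span W c; apply: lspan_map (FS b u v) _ _ => d wd.
have -> : size (u ++ c :: v) = size (rcons u d ++ v) by rewrite cat_rcons !size_cat.
rewrite -cat_rcons.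
apply: IH => //; rewrite size_rcons -cats1 /Z -addn1 mulnDr.
apply: word_weight_cat => //=; exists (wt_bound W * 1)%N, 0%N.
by rewrite addn0 muln1.
Qed.
End Words.

Definition tensor_gen (M N : lmodType k) (P : nat -> nat -> M -> Prop)
    (Q : nat -> nat -> N -> Prop) n m (x : M ⊗ N) : Prop :=
  exists i j I J y z,
    [/\ (i + j)%N = n, (I + J)%N = m, P i I y, Q j J z & x = y ⊗ₜ z].

(** The coextensions have components of degrees 0, 2, 4 and so on. It is enough to
   know that they preserve the number of letters w and that their values lie in
   degrees n, n + 2, ... *)
Definition even_span (M : lmodType k) (P : nat -> nat -> M -> Prop) n N (x : M) : Prop :=
  lspan (fun y => exists m, P (n + m.*2)%N N y) x.

Definition shifts (M N : lmodType k) (P : nat -> nat -> M -> Prop)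
    (Q : nat -> nat -> N -> Prop) d (f : M -> N) : Prop :=
  linear f /\ forall n m x, P n m x -> even_span Q (n + d) m (f x).
End Weightings.

(** * Operators that preserve the number of letters *)
Section Shifts.
Variable k : comPzRingType.
Implicit Types M N L : lmodType k.
Local Notation family M := (nat -> nat -> M -> Prop).

Lemma even_span_gen M (P : family M) n w x : P n w x -> even_span P n w x.
Proof. by move=> Px; apply: lspan_gen; exists 0%N; rewrite addn0. Qed.

Lemma even_span_up M (P : family M) n m w x :
  even_span P (n + m.*2) w x -> even_span P n w x.
Proof.
apply: lspan_sub => y [i Py]; apply: lspan_gen; exists (m + i)%N.
by rewrite doubleD addnA.
Qed.

Lemma shifts_even M N (P : family M) (Q : family N) d f n m x :
  shifts P Q d f -> even_span P n m x -> even_span Q (n + d) m (f x).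
Proof.
case=> fl h; apply: lspan_map => // y [i /h]; rewrite addnAC.
exact: even_span_up.
Qed.

Lemma shifts_comp M N L (P : family M) (Q : family N) (R : family L) d e f g :
  shifts P Q d f -> shifts Q R e g -> shifts P R (d + e) (fun x => g (f x)).
Proof.
move=> hf hg; split; first by apply: lin_comp; [case: hg | case: hf].
by move=> n m x Px; rewrite addnA; apply: (shifts_even hg); case: hf => _; apply.
Qed.

Lemma shifts_ext M N (P : family M) (Q : family N) d f g :
  f =1 g -> shifts P Q d f -> shifts P Q d g.
Proof.
move=> e [fl h]; split; first by apply: (lin_eq _ fl) => x; rewrite e.
by move=> n m x /h; rewrite e.
Qed.

Lemma shifts_add M N (P : family M) (Q : family N) d f g :
  shifts P Q d f -> shifts P Q d g -> shifts P Q d (fun x => f x + g x).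
Proof.
move=> [fl hf] [gl hg]; split; first exact: lin_add.
by move=> n m x Px; apply: lspanD; [apply: hf | apply: hg].
Qed.

Lemma shifts_down M N (P : family M) (Q : family N) d e f :
  shifts P Q (d + e.*2) f -> shifts P Q d f.
Proof.
case=> fl h; split=> // n m x /h; rewrite addnA; exact: even_span_up.
Qed.

Lemma shifts_tmapl M M' N (P : family M) (P' : family M') (Q : family N) d f :
  shifts P P' d f -> shifts (tensor_gen P Q) (tensor_gen P' Q) d (tmap f id).
Proof.
case=> fl h; have il : linear (fun x : N => x) by [].
split; first exact: tmap_linear.
move=> _ _ _ [i [j [I [J [y [z [<- <- /h Py Qz ->]]]]]]]; rewrite tmap_tens //.
apply: (lspan_map (tens_linearl z) _ Py) => y' [m Py'].
apply: lspan_gen; exists m, (i + d + m.*2)%N, j, I, J, y', z; split=> //.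
by rewrite [LHS]addnAC [(i + d + j)%N]addnAC.
Qed.

Lemma shifts_tmapr M N N' (P : family M) (Q : family N) (Q' : family N') d f :
  shifts Q Q' d f -> shifts (tensor_gen P Q) (tensor_gen P Q') d (tmap id f).
Proof.
case=> fl h; have il : linear (fun x : M => x) by [].
split; first exact: tmap_linear.
move=> _ _ _ [i [j [I [J [y [z [<- <- Py /h Qz ->]]]]]]]; rewrite tmap_tens //.
apply: (lspan_map (tens_linearr y) _ Qz) => z' [m Qz'].
apply: lspan_gen; exists m, i, (j + d + m.*2)%N, I, J, y, z'; split=> //.
by rewrite !addnA.
Qed.

Definition vanishing M (P : family M) :=
  forall n w x, P n w x -> (w < n)%N -> x = 0.

Lemma even_span0 M (P : family M) n w x :
  vanishing P -> even_span P n w x -> (w < n)%N -> x = 0.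
Proof.
move=> P0 Px Nn; apply: lspan_eq0 Px => y [m Py]; apply: P0 Py _.
exact: leq_trans (leq_addr _ _).
Qed.

Lemma tensor_vanishing M N (P : family M) (Q : family N) :
  vanishing P -> vanishing Q -> vanishing (tensor_gen P Q).
Proof.
move=> P0 Q0 _ _ _ [i [j [I [J [y [z [<- <- Py Qz ->]]]]]]] h.
case: (ltnP I i) => [/(P0 _ _ _ Py) ->|iI].
  exact: linear0f (tens_linearl z).
case: (ltnP J j) => [/(Q0 _ _ _ Qz) ->|jJ].
  exact: linear0f (tens_linearr y).
by have := leq_add iI jJ; rewrite leqNgt h.
Qed.

(** The signs of the Koszul rule are those of an involution, the grading. *)
Definition involution_of M (P : family M) (e : M -> M) :=
  linear e /\ forall n w x, P n w x -> e x = (-1) ^+ n *: x.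

Definition generates M (P : family M) :=
  forall x, lspan (fun y => exists n w, P n w y) x.

Lemma even_span_involution M (P : family M) e n w x :
  involution_of P e -> even_span P n w x -> e x = (-1) ^+ n *: x.
Proof.
case=> el h; elim=> [|c y z [m /h Py] _ IH]; first by rewrite (linear0f el) scaler0.
rewrite el Py IH scalerDr !scalerA mulrC; congr (_ *: _ + _).
by rewrite -signr_odd oddD odd_double addbF signr_odd.
Qed.

(** An operator with components of degrees d, d + 2, ... has the parity of d. *)
Lemma shifts_involution M N (P : family M) (Q : family N) d f e e' x :
  generates P -> involution_of P e -> involution_of Q e' -> shifts P Q d f ->
  e' (f x) = (-1) ^+ d *: f (e x).
Proof.
move=> gP [el he] he' [fl hf]; elim: {x}(gP x) => [|c y z [n [m Py]] _ IH].
  by rewrite (linear0f el) !(linear0f fl) (linear0f he'.1) scaler0.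
rewrite fl he'.1 IH el fl scalerDr; congr (_ + _).
rewrite (even_span_involution he' (hf _ _ _ Py)) (he _ _ _ Py).
have -> : f ((-1) ^+ n *: y) = (-1) ^+ n *: f y.
  by have := fl ((-1) ^+ n) y 0; rewrite (linear0f fl) !addr0.
by rewrite !scalerA exprD [c * _]mulrA [c * _ * _]mulrC !mulrA.
Qed.

End Shifts.

Section FormShifts.
Variables (k : comPzRingType) (A : unitalAlgType k) (W : weighting A).
Local Notation FW := (form_weight W).

Lemma form_vanishing : vanishing FW.
Proof. by move=> n w x; apply: form_weight0. Qed.

Lemma form_generates : generates FW.
Proof.
apply: Omega_ind => [a w|c x y|]; [|exact: lspan_comb|exact: Lspan0].
by apply: lspan_sub (form_weight_span W a w) => x Fx; apply: lspan_gen; do 2!eexists; exact: Fx.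
Qed.

Lemma form_involution : involution_of FW (@grading k A).
Proof.
split; first exact: grading_linear.
by move=> n _ _ [a [w [<- _ ->]]]; rewrite grading_form.
Qed.

Lemma connes_shifts : shifts FW FW 1 (@connes k A).
Proof.
split; first exact: connes_linear.
move=> n w _ [x [s [<- [i [j [<- wx ws]]] ->]]].
rewrite connes_split; apply: lspan_splitsum => u v uv; apply: lspanZ; apply: even_span_gen.
move: ws; rewrite -uv => /word_weight_catE [I [J [<- wu wv]]].
exists 𝟙, (v ++ x :: u); split=> //.
  by rewrite !size_cat /= addn1 addnS addnC.
exists 0%N, (i + (I + J))%N; split=> //; first exact: wt_one.
rewrite addnA addnC; apply: word_weight_cat => //=; by exists i, I.
Qed.
End FormShifts.

Lemma Omega_map_shifts (k : comPzRingType) (A A' : unitalAlgType k)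
    (W : weighting A) (W' : weighting A') (f : A -> A') :
  algebra_morphism f -> (forall n a, W n a -> W' n (f a)) ->
  shifts (form_weight W) (form_weight W') 0 (Omega_map f).
Proof.
move=> fm h; split; first exact: Omega_map_linear.
move=> n w _ [x [s [<- wx ->]]]; rewrite addn0 Omega_map_form //.
apply: even_span_gen; exists (f x), (map f s); split; [by rewrite size_map| |by []].
rewrite -map_cons; elim: (x :: s) w wx => //= {x s} x s IH w [i [j [<- wx ws]]].
by exists i, j; split=> //; [apply: h | apply: IH].
Qed.

Section PairShifts.
Variables (k : comPzRingType) (A B : unitalAlgType k).
Variables (wA : weighting A) (wB : weighting B).
Local Notation FA := (form_weight wA).
Local Notation FB := (form_weight wB).
Local Notation FAB := (form_weight (tensor_weight wA wB)).
Implicit Types (X : A * B) (w : seq (A * B)).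

Definition pair_weight I J w :=
  word_weight wA I (unzip1 w) /\ word_weight wB J (unzip2 w).

Lemma pair_weight_word I J w : pair_weight I J w ->
  word_weight (tensor_weight wA wB) (I + J) (map (@tens_pair k A B) w).
Proof.
elim: w I J => [//|[a b] w IH] _ _ [[i [I [<- wa wI]]] [j [J [<- wb wJ]]]] /=.
exists (i + j)%N, (I + J)%N; split; [by rewrite addnACA| |exact: IH].
by exists i, j, a, b.
Qed.

Lemma word_pair_weight N s : word_weight (tensor_weight wA wB) N s ->
  exists I J w, [/\ (I + J)%N = N, pair_weight I J w & s = map (@tens_pair k A B) w].
Proof.
elim: s N => [|t s IH] N; first by exists 0%N, N, [::].
case=> _ [_ [<- [i [j [a [b [<- wa wb ->]]]]] /IH [I [J [w [<- [wI wJ] ->]]]]]].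
exists (i + I)%N, (j + J)%N, ((a, b) :: w); split=> //; first by rewrite addnACA.
by split; [exists i, I | exists j, J].
Qed.

Lemma pair_form_weight I J X w : pair_weight I J (X :: w) ->
  FAB (size w) (I + J) (pair_form X w).
Proof.
move=> h; exists (tens_pair X), (map (@tens_pair k A B) w).
by split; [rewrite size_map | apply: pair_weight_word h | ].
Qed.

Lemma pair_weight_cat I J I' J' u v :
  pair_weight I J u -> pair_weight I' J' v ->
  pair_weight (I + I') (J + J') (u ++ v).
Proof.
by case=> u1 u2 [v1 v2]; split; rewrite /unzip1 /unzip2 map_cat; apply: word_weight_cat.
Qed.

Lemma pair_weight_catE I J u v : pair_weight I J (u ++ v) ->
  exists I1 I2 J1 J2, [/\ (I1 + I2)%N = I, (J1 + J2)%N = J,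
    pair_weight I1 J1 u & pair_weight I2 J2 v].
Proof.
case; rewrite /unzip1 /unzip2 !map_cat => /word_weight_catE [I1 [I2 [eI u1 v1]]].
case/word_weight_catE => [J1 [J2 [eJ u2 v2]]].
by exists I1, I2, J1, J2.
Qed.

Lemma pair_weight_cons i j I J X w :
  wA i X.1 -> wB j X.2 -> pair_weight I J w -> pair_weight (i + I) (j + J) (X :: w).
Proof. by move=> wa wb [w1 w2]; split; [exists i, I | exists j, J]. Qed.

(** A shuffle of words of A and B has the letters of both, whatever the order of
    the entries. *)
Lemma lspan_shuffles (M : lmodType k) (S : M -> Prop) (H : seq (A * B) -> M) I J s t :
  (forall w, size w = (size s + size t)%N -> pair_weight I J w -> lspan S (H w)) ->
  word_weight wA I s -> word_weight wB J t ->
  lspan S (shufflesum H (map (@pairA k A B) s) (map (@pairB k A B) t)).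
Proof.
have wA1 := wt_one wA; have wB1 := wt_one wB.
have hB J' t' : word_weight wB J' t' -> pair_weight 0 J' (map (@pairB k A B) t').
  elim: t' J' => [|b t' IH] J' //= [j [J1 [<- wb /IH wt]]].
  exact: (@pair_weight_cons 0 j 0 J1 (pairB A b)).
have hA I' s' : word_weight wA I' s' -> pair_weight I' 0 (map (@pairA k A B) s').
  elim: s' I' => [|a s' IH] I' //= [i [I1 [<- wa /IH ws]]].
  exact: (@pair_weight_cons i 0 I1 0 (pairA B a)).
have up I' J' w : pair_weight 0 J' w -> pair_weight I' J' w.
  by case=> w1 w2; split=> //; apply: word_weight_leq w1.
have up' I' J' w : pair_weight I' 0 w -> pair_weight I' J' w.
  by case=> w1 w2; split=> //; apply: word_weight_leq w2.
move: s t H I J; apply: shuffle_ind => [t|s|a s b t IH1 IH2] H I J h ws wt.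
- by rewrite shufflesum_nil; apply: h; [rewrite size_map | apply/up/hB].
- by rewrite shufflesum_nilr; apply: h; [rewrite size_map addn0 | apply/up'/hA].
rewrite /= shufflesum_cons.
case: ws => [i [I1 [eI wa ws]]]; case: (wt) => [j [J1 [eJ wb wt1]]].
apply: lspanD; last apply: lspanZ.
  apply: (IH1 (fun w => H (pairA B a :: w)) I1 J) => // w sw pw.
  apply: h; first by rewrite /= sw.
  by rewrite -eI; apply: (@pair_weight_cons i 0 I1 J (pairA B a)).
apply: (IH2 (fun w => H (pairB A b :: w)) I J1) => //; last by exists i, I1.
move=> w sw pw; apply: h; first by rewrite /= sw /= addnS.
by rewrite -eJ; apply: (@pair_weight_cons 0 j I J1 (pairB A b)).
Qed.

Lemma sh_shifts : shifts (tensor_gen FA FB) FAB 0 (@sh k A B).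
Proof.
split; first exact: sh_linear.
move=> ? ? ? [n [m [I [J [x [y [<- <- Px Py ->]]]]]]].
case: Px => a [s [<- [i [I' [<- wa ws]]] ->]].
case: Py => b [t [<- [j [J' [<- wb wt]]] ->]].
rewrite sh_pair addn0; apply: lspan_shuffles ws wt => w sw pw.
apply: even_span_gen; rewrite -sw /= pmul1x.
by apply: pair_form_weight; apply: (@pair_weight_cons i j I' J' (a, b)).
Qed.

Lemma AW_shifts : shifts FAB (tensor_gen FA FB) 0 (@AW k A B).
Proof.
split; first exact: AW_linear.
move=> n N _ [t [s [<- /word_pair_weight [I [J [[|X w] [<- h [//]]]]] -> -> ->]]].
rewrite -/(pair_form X w) AW_split size_map addn0.
case: h => [[i [I' [<- wa ws]]] [j [J' [<- wb wt]]]].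
apply: lspan_splitsum => u v uv; apply: even_span_gen.
have : pair_weight I' J' (u ++ v) by rewrite uv.
case/pair_weight_catE => I1 [I2 [J1 [J2 [<- <- [u1 u2] [v1 v2]]]]].
exists (size u), (size v), (i + (I1 + I2))%N, (j + (J1 + J2))%N.
exists (dform (algprod (unzip1 v) ∙ X.1) (unzip1 u)).
exists (dform (X.2 ∙ algprod (unzip2 u)) (unzip2 v)).
split; [by rewrite -uv size_cat | by [] | | | by []].
  exists (algprod (unzip1 v) ∙ X.1), (unzip1 u); split; [by rewrite size_map | | by []].
  exists (I2 + i)%N, I1; split=> //; first by rewrite [(I2 + i)%N]addnC addnAC addnA.
  by apply: wt_mul => //; apply: word_weight_prod.
exists (X.2 ∙ algprod (unzip2 u)), (unzip2 v); split; [by rewrite size_map | | by []].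
exists (j + J1)%N, J2; split=> //; first by rewrite addnA.
by apply: wt_mul => //; apply: word_weight_prod.
Qed.

Lemma phi_shifts : shifts FAB FAB 1 (@phi k A B).
Proof.
split; first exact: phi_linear.
move=> n N _ [t [s [<- /word_pair_weight [I [J [[|X w] [<- h [//]]]]] -> -> ->]]].
rewrite -/(pair_form X w) phi_pair (phi_word_split _ _ _ (@pair_form_normalized k A B)).
rewrite size_map; case: h => [[i [I' [<- wa ws]]] [j [J' [<- wb wt]]]].
apply: lspan_splitsum => u v uv; apply: lspanZ.
have : pair_weight I' J' (u ++ v) by rewrite uv.
case/pair_weight_catE => I1 [I2 [J1 [J2 [<- <- wu wv]]]].
apply: lspan_splitsum => v1 v2 vv.
have : pair_weight I2 J2 (v1 ++ v2) by rewrite vv.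
case/pair_weight_catE => I3 [I4 [J3 [J4 [<- <- [v11 v12] [v21 v22]]]]].
apply: lspan_shuffles v11 v22 => z sz pz; apply: even_span_gen.
rewrite /= algmul1x algmulx1.
set Y := pmul _ X; set c := algprod _.
have -> : (i + (I1 + (I3 + I4)) + (j + (J1 + (J3 + J4))))%N =
    ((I4 + i) + (I1 + (0 + I3)) + ((0 + j) + (J1 + (J3 + J4))))%N.
  by rewrite !add0n [(I4 + i)%N]addnC -![(i + _ + _)%N]addnA [(I4 + (I1 + I3))%N]addnC -!addnA.
have -> : (size w + 1)%N = size (u ++ (𝟙, c) :: z).
  by rewrite -uv -vv !size_cat /= sz !size_map addn1 !addnS.
apply: pair_form_weight; apply: pair_weight_cons.
- by apply: wt_mul => //; apply: word_weight_prod.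
- by apply: wt_mul => //; apply: wt_one.
apply: pair_weight_cat => //; apply: pair_weight_cons => //; first exact: wt_one.
exact: word_weight_prod.
Qed.
End PairShifts.

(** * The perturbed homotopy and the coextensions *)
Section PhiInf.
Variables (k : comPzRingType) (A B : unitalAlgType k).
Local Notation phi := (@phi k A B).
Local Notation connes := (@connes k (A ⊗ B)).
Implicit Types (x y : Omega (A ⊗ B)).

Definition phi_iter m x := iter m (fun y => phi (connes y)) (phi x).

Lemma phi_iter_linear m : linear (phi_iter m).
Proof.
elim: m => [|m IH]; first exact: phi_linear.
exact: (lin_comp (@phi_linear k A B) (lin_comp (@connes_linear k _) IH)).
Qed.

Lemma phi_iter_shifts (wA : weighting A) (wB : weighting B) m :
  shifts (form_weight (tensor_weight wA wB)) (form_weight (tensor_weight wA wB))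
    m.*2.+1 (phi_iter m).
Proof.
elim: m => [|m IH]; first exact: phi_shifts.
have := shifts_comp IH (shifts_comp (@connes_shifts _ _ _) (@phi_shifts _ _ _ _ _)).
by rewrite addn2 doubleS.
Qed.

(** Each application of phi B raises the degree by 2 and keeps the number of
    letters, which bounds the degree of a nonzero form. *)
Lemma phi_iter_eventually0 x :
  exists M, forall m, (M <= m)%N -> phi_iter m x = 0.
Proof.
pose W := tensor_weight (base_weight A) (base_weight B).
elim: (form_generates W x) => [|c y z [n [w Fy]] _ [M IH]].
  by exists 0%N => m _; rewrite (linear0f (phi_iter_linear m)).
exists (maxn w M) => m; rewrite geq_max => /andP[wm Mm].
rewrite phi_iter_linear IH // addr0.
have [_ h] := phi_iter_shifts (base_weight A) (base_weight B) m.
rewrite (even_span0 (@form_vanishing _ _ W) (h _ _ _ Fy)) ?scaler0 //.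
by rewrite addnS ltnS (leq_trans wm) // (leq_trans _ (leq_addl _ _)) // -addnn leq_addr.
Qed.

(** The series phi_inf is a sum over a support, to be computed over any bound of
    this support; [phi_inf_bound] provides one for several elements at once. *)
Lemma phi_inf_sum x M : (forall m, (M <= m)%N -> phi_iter m x = 0) ->
  phi_inf x = \sum_(m < M) phi_iter m x.
Proof.
move=> h; rewrite /phi_inf -[LHS]/(\sum_(m \in [set: nat]) phi_iter m x).
rewrite (@fsbigE _ _ _ _ _ (iota 0 M)) ?iota_uniq //; last first.
  by move=> i _; rewrite mem_iota add0n -leqNgt => /h.
rewrite -(big_mkord xpredT (fun m => phi_iter m x)) /index_iota subn0.
by apply: eq_bigl => i; rewrite in_setT.
Qed.

Lemma phi_inf_bound (s : seq (Omega (A ⊗ B))) : exists M, forall x, x \in s ->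
  (forall m, (M <= m)%N -> phi_iter m x = 0).
Proof.
elim: s => [|y s [M IH]]; first by exists 0%N.
have [M' h] := phi_iter_eventually0 y; exists (maxn M M') => x.
rewrite in_cons => /orP[/eqP ->|xs] m; rewrite geq_max => /andP[m1 m2]; first exact: h.
exact: IH.
Qed.

Lemma phi_inf_linear : linear (@phi_inf k A B).
Proof.
move=> c x y; have [M h] := phi_inf_bound [:: x; y].
have hx := h x (mem_head _ _); have hy := h y (mem_last x [:: y]).
rewrite (phi_inf_sum hx) (phi_inf_sum hy) (@phi_inf_sum _ M) => [|m Mm].
  rewrite scaler_sumr -big_split; apply: eq_bigr => m _; exact: phi_iter_linear.
by rewrite phi_iter_linear hx // hy // scaler0 add0r.
Qed.
HB.instance Definition _ := GRing.isLinear.Build k (Omega (A ⊗ B))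
  (Omega (A ⊗ B)) *:%R (@phi_inf k A B) phi_inf_linear.

Lemma phi_inf_fixl x : phi_inf x = phi x + phi (connes (phi_inf x)).
Proof.
have [M h] := phi_iter_eventually0 x.
rewrite [LHS](@phi_inf_sum x M.+1) => [|m /ltnW]; last exact: h.
rewrite big_ord_recl (phi_inf_sum h); congr (_ + _).
rewrite [connes _]linear_sum [phi _]linear_sum; exact: eq_bigr.
Qed.

Lemma phi_inf_fixr x : phi_inf x = phi x + phi_inf (connes (phi x)).
Proof.
have [M h] := phi_iter_eventually0 x.
rewrite [LHS](@phi_inf_sum x M.+1) => [|m /ltnW]; last exact: h.
rewrite big_ord_recl (@phi_inf_sum _ M) => [|m Mm].
  by congr (_ + _); apply: eq_bigr => m _; exact: (iterSr m (fun y => phi (connes y))).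
rewrite -(h m.+1 (leqW Mm)); exact: esym (iterSr m (fun y => phi (connes y)) _).
Qed.

Variables (wA : weighting A) (wB : weighting B).
Local Notation FAB := (form_weight (tensor_weight wA wB)).
Local Notation F2 := (tensor_gen (form_weight wA) (form_weight wB)).

Lemma phi_inf_shifts : shifts FAB FAB 1 (@phi_inf k A B).
Proof.
split; first exact: phi_inf_linear.
move=> n w x Fx; have [M h] := phi_iter_eventually0 x; rewrite (phi_inf_sum h).
apply: lspan_sum => m _; have [_ hm] := phi_iter_shifts wA wB m.
by have := hm _ _ _ Fx; rewrite -add1n addnA; apply: even_span_up.
Qed.

Lemma sh_inf_linear : linear (@sh_inf k A B).
Proof.
apply: lin_add; first exact: linearP.
by apply: (lin_comp phi_inf_linear (lin_comp (@connes_linear k _) (@sh_linear k A B))).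
Qed.
HB.instance Definition _ := GRing.isLinear.Build k (Omega A ⊗ Omega B)
  (Omega (A ⊗ B)) *:%R (@sh_inf k A B) sh_inf_linear.

Lemma AW_inf_linear : linear (@AW_inf k A B).
Proof.
apply: (lin_comp (@AW_linear k A B)); apply: lin_add => //.
exact: (lin_comp (@connes_linear k _) phi_inf_linear).
Qed.
HB.instance Definition _ := GRing.isLinear.Build k (Omega (A ⊗ B))
  (Omega A ⊗ Omega B) *:%R (@AW_inf k A B) AW_inf_linear.

Lemma AW_infE x : AW_inf x = AW x + AW (connes (phi_inf x)).
Proof. exact: linearD. Qed.

Lemma sh_inf_shifts : shifts F2 FAB 0 (@sh_inf k A B).
Proof.
apply: shifts_add; first exact: sh_shifts.
apply: (@shifts_down _ _ _ _ _ 0 1).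
exact: shifts_comp (shifts_comp (@sh_shifts _ _ _ wA wB) (@connes_shifts _ _ _)) phi_inf_shifts.
Qed.

Lemma AW_inf_shifts : shifts FAB F2 0 (@AW_inf k A B).
Proof.
apply: (shifts_ext (fun x => esym (AW_infE x))).
apply: shifts_add; first exact: AW_shifts.
apply: (@shifts_down _ _ _ _ _ 0 1).
exact: shifts_comp (shifts_comp phi_inf_shifts (@connes_shifts _ _ _)) (@AW_shifts _ _ _ _ _).
Qed.

Lemma sh_inf_tail :
  shifts F2 FAB 4 (fun z => sh_inf z - (sh z + phi (connes (sh z)))).
Proof.
apply: (@shifts_ext _ _ _ _ _ _ (fun z =>
  phi (connes (phi_inf (connes (sh z)))))).
  by move=> z; rewrite /sh_inf [in RHS]phi_inf_fixl; zmod.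
exact: shifts_comp (shifts_comp (shifts_comp (shifts_comp
  (@sh_shifts _ _ _ wA wB) (@connes_shifts _ _ _)) phi_inf_shifts)
  (@connes_shifts _ _ _)) (@phi_shifts _ _ _ wA wB).
Qed.

Lemma AW_inf_tail :
  shifts FAB F2 4 (fun x => AW_inf x - (AW x + AW (connes (phi x)))).
Proof.
apply: (@shifts_ext _ _ _ _ _ _ (fun x =>
  AW (connes (phi_inf (connes (phi x)))))).
  move=> x; rewrite AW_infE [in RHS]phi_inf_fixr.
  by rewrite [connes (_ + _)]linearD [AW (_ + _)]linearD /=; zmod.
exact: shifts_comp (shifts_comp (shifts_comp (shifts_comp
  (@phi_shifts _ _ _ wA wB) (@connes_shifts _ _ _)) phi_inf_shifts)
  (@connes_shifts _ _ _)) (@AW_shifts _ _ _ wA wB).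
Qed.
End PhiInf.

(** * The perturbation lemma *)
Section Perturbation.
Variables (k : comPzRingType) (A B : unitalAlgType k).
Local Notation b := (@hochschild k _).
Local Notation B_ := (@connes k _).
Local Notation psi := (@phi_inf k A B).
Local Notation d2 := (tder (@bB k A) (@grading k A) (@bB k B)).
Local Notation b2 := (tder (@hochschild k A) (@grading k A) (@hochschild k B)).
Local Notation B2 := (tder (@connes k A) (@grading k A) (@connes k B)).

Lemma tder_bB z : d2 z = b2 z + B2 z.
Proof.
move: z; apply: Omega2_eq.
- exact: (tder_linear (@bB_linear k A) (@grading_linear k A) (@bB_linear k B)).
- by apply: lin_add; apply: tder_linear; exact: linearP.
move=> a s c t; rewrite !tder_tens; try exact: linearP.
rewrite /bB [_ ⊗ₜ (_ + _)]linearD /=.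
by rewrite -![(_ + _) ⊗ₜ _]/(tensl _ (_ + _)) linearD /tensl /=; zmod.
Qed.

Lemma base_word_weight (C : unitalAlgType k) (s : seq C) :
  word_weight (base_weight C) (size s) s.
Proof. by elim: s => //= a s IH; exists 1%N, (size s); split=> //; right. Qed.

Lemma base_form_weight (C : unitalAlgType k) (a : C) s :
  form_weight (base_weight C) (size s) (size s).+1 (dform a s).
Proof. exists a, s; split=> //; exact: (base_word_weight (a :: s)). Qed.

Lemma base_form2_weight (a : A) s (c : B) t :
  tensor_gen (form_weight (base_weight A)) (form_weight (base_weight B))
    (size s + size t) (size s + size t).+2 (dform a s ⊗ₜ dform c t).
Proof.
exists (size s), (size t), (size s).+1, (size t).+1, (dform a s), (dform c t).
by split=> //; [rewrite addSn addnS | exact: base_form_weight..].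
Qed.

(** This operator raises the degree by at least 3, while an element of degree n on
    two factors has at most n + 2 letters. *)
Lemma AW_connes_tail z : AW (B_ (psi (B_ (sh z)))) = 0.
Proof.
pose wA := base_weight A; pose wB := base_weight B.
have [hl h] := shifts_comp (shifts_comp (shifts_comp (shifts_comp
  (@sh_shifts _ _ _ wA wB) (@connes_shifts _ _ _)) (@phi_inf_shifts _ _ _ wA wB))
  (@connes_shifts _ _ _)) (@AW_shifts _ _ _ wA wB).
move: z; apply: Omega2_eq => //; first by move=> c x y; rewrite scaler0 addr0.
move=> a s c t; have /h e := base_form2_weight a s c t.
apply: (even_span0 _ e); last by rewrite (_ : (0 + 1 + 1 + 1 + 0)%N = 3) // addn3.
exact: (tensor_vanishing (@form_vanishing _ _ _) (@form_vanishing _ _ _)).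
Qed.

Lemma connes_hochschild (x : Omega (A ⊗ B)) : B_ (b x) = - b (B_ x).
Proof. by apply/eqP; rewrite -addr_eq0 addrC hochschild_connes. Qed.

(** The perturbation lemma. Put f = x + B phi_inf x, so that phi f = phi_inf x and
    B f = B x, and apply phi_inf = phi + phi_inf B phi to b f, where phi b f is
    known from the unperturbed identity for f. *)
Lemma phi_inf_homotopy x : bB (psi x) + psi (bB x) = sh_inf (AW_inf x) - x.
Proof.
have psiD y z : psi (y + z) = psi y + psi z by exact: linearD.
have psiN y : psi (- y) = - psi y by exact: linearN.
have BD y z : B_ (y + z) = B_ y + B_ z :> Omega (A ⊗ B) by exact: linearD.
have BN y : B_ (- y) = - B_ y :> Omega (A ⊗ B) by exact: linearN.
have bD y z : b (y + z) = b y + b z :> Omega (A ⊗ B) by exact: linearD.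
have [f fE] : exists f, f = x + B_ (psi x) by eexists.
have ef : phi f = psi x by rewrite [RHS]phi_inf_fixl fE; exact: linearD.
have Bf : B_ f = B_ x by rewrite fE BD connesK addr0.
have := phi_homotopy f; rewrite ef => e.
have e' : phi (b f) = sh (AW f) - f - b (psi x) by rewrite -e addrC addKr.
have : psi (b f) = phi (b f) + psi (B_ (phi (b f))) by exact: phi_inf_fixr.
rewrite {}e' !(BD, BN, psiD, psiN) Bf connes_hochschild psiN => e2.
have : psi (b f) = psi (b x) + psi (b (B_ (psi x))) by rewrite fE bD psiD.
rewrite {}e2 => e3.
have -> : sh_inf (AW_inf x) = sh (AW f) + psi (B_ (sh (AW f))) by rewrite fE.
rewrite /bB ?psiD.
have -> : psi (b x) = psi (b x) + psi (b (B_ (psi x))) - psi (b (B_ (psi x))).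
  by rewrite addrK.
by rewrite -e3 fE; zmod.
Qed.

(** Apply [phi_inf_homotopy] to y = B sh z. By [AW_connes_tail] the term A y is
    AW B sh z, which is Connes' operator applied to z. *)
Lemma bB_sh_inf z : bB (sh_inf z) = sh_inf (d2 z).
Proof.
have sD y y' : sh_inf (y + y') = sh_inf y + sh_inf y' :> Omega (A ⊗ B) by exact: linearD.
have psiN y : psi (- y) = - psi y by exact: linearN.
set y := B_ (sh z).
have eA : AW_inf y = B2 z.
  by rewrite AW_infE /y AW_connes_tail addr0 AW_connes_sh.
have := phi_inf_homotopy y; rewrite eA.
have -> : bB y = - B_ (sh (b2 z)).
  by rewrite /bB /y connesK addr0 -hochschild_sh connes_hochschild opprK.
rewrite psiN => e; rewrite tder_bB sD.
have -> : sh_inf (b2 z) = b (sh z) + psi (B_ (sh (b2 z))).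
  by rewrite /sh_inf hochschild_sh.
rewrite -[sh_inf (B2 z)](subrK y) -e {1}/sh_inf -/y.
rewrite [LHS](linearD (@bB k (A ⊗ B))) /= {1}/bB -/y; zmod.
Qed.

(** By [AW_connes_sh] and [AW_connes_tail], Connes' operator takes A x to
    AW B (S A x); replace S A by 1 + [b + B, phi_inf]. *)
Lemma AW_inf_bB x : d2 (AW_inf x) = AW_inf (bB x).
Proof.
have AD y y' : AW (y + y') = AW y + AW y' :> Omega A ⊗ Omega B by exact: linearD.
have AN y : AW (- y) = - AW y :> Omega A ⊗ Omega B by exact: linearN.
have BD y z : B_ (y + z) = B_ y + B_ z :> Omega (A ⊗ B) by exact: linearD.
have bD y z : b (y + z) = b y + b z :> Omega (A ⊗ B) by exact: linearD.
have eB : B2 (AW_inf x) = AW (B_ (sh_inf (AW_inf x))).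
  by rewrite [sh_inf _]/(_ + _) BD AD AW_connes_tail addr0 AW_connes_sh.
rewrite tder_bB eB -[sh_inf _](subrK x) -phi_inf_homotopy /AW_inf.
rewrite -AW_hochschild bD !BD connesK addr0 connes_hochschild !AD AN.
rewrite /bB ?AD.
zmod.
Qed.
End Perturbation.

(** * Operators on one factor of a tensor product *)
Section TensorMaps2.
Variable k : comPzRingType.
Implicit Types M N L : lmodType k.

Lemma tmap_comp M M' M'' N N' N'' (f : M' -> M'') (g : N' -> N'')
    (f' : M -> M') (g' : N -> N') z :
  linear f -> linear g -> linear f' -> linear g' ->
  tmap f g (tmap f' g' z) = tmap (fun x => f (f' x)) (fun y => g (g' y)) z.
Proof.
move=> fl gl fl' gl'; have l1 := tmap_linear fl gl; have l2 := tmap_linear fl' gl'.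
have fl2 := lin_comp fl fl'; have gl2 := lin_comp gl gl'.
move: z; apply: tensor_eq => [||x y]; last by rewrite !tmap_tens.
- by move=> c x y; rewrite l2 l1.
exact: tmap_linear.
Qed.

Lemma tmap_ext M M' N N' (f f' : M -> M') (g g' : N -> N') :
  f =1 f' -> g =1 g' -> tmap f g =1 tmap f' g'.
Proof. by move=> e e' z; apply: tlift_ext => x y; rewrite e e'. Qed.

Lemma tmap_id M N (z : M ⊗ N) : tmap (fun x => x) (fun y => y) z = z.
Proof.
have l : linear (tmap (fun x : M => x) (fun y : N => y)) by exact: tmap_linear.
by move: z; apply: tensor_eq => // x y; rewrite tmap_tens.
Qed.

Lemma tmap_0l M M' N N' (f : M -> M') (g : N -> N') z :
  (forall x, f x = 0) -> tmap f g z = 0.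
Proof.
by move=> f0; apply: tlift_zero => x y; rewrite f0; apply: linear0f (tens_linearl _).
Qed.

Lemma tmap_0r M M' N N' (f : M -> M') (g : N -> N') z :
  (forall y, g y = 0) -> tmap f g z = 0.
Proof.
by move=> g0; apply: tlift_zero => x y; rewrite g0; apply: linear0f (tens_linearr _).
Qed.

Lemma tassoc_natural M M' N N' L L' (f : M -> M') (g : N -> N') (h : L -> L') z :
  linear f -> linear g -> linear h ->
  tassoc (tmap (tmap f g) h z) = tmap f (tmap g h) (tassoc z).
Proof.
move=> fl gl hl; have l1 := tmap_linear fl gl; have l2 := tmap_linear gl hl.
have l3 := tmap_linear l1 hl; have l4 := tmap_linear fl l2.
have tl := @tassoc_linear k.
move: z; apply: tensor3_eq => [||x y z].
- by move=> c x y; rewrite l3; apply: tl.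
- by move=> c x y; rewrite (tl _ _ _ c x y); apply: l4.
by rewrite tassoc_tens !tmap_tens // tassoc_tens.
Qed.

Lemma tder_tmapr M N N' (D e : M -> M) (E : N -> N) (E' : N' -> N') (g : N -> N') z :
  linear D -> linear e -> linear E -> linear E' -> linear g ->
  (forall y, E' (g y) = g (E y)) ->
  tder D e E' (tmap id g z) = tmap id g (tder D e E z).
Proof.
move=> Dl el El El' gl gE; have idl : linear (fun x : M => x) by [].
have l1 := tder_linear Dl el El; have l2 := tder_linear Dl el El'.
have l3 := tmap_linear idl gl.
move: z; apply: tensor_eq => [c x y|c x y|x y]; first by rewrite l3 l2.
  by rewrite l1 l3.
rewrite tmap_tens // !tder_tens // gE.
by rewrite -[D x ⊗ₜ y]scale1r l3 scale1r !tmap_tens.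
Qed.

(** The mixed terms of a homotopy on the left factor and the differential of the
    right factor cancel because the homotopy is odd. *)
Lemma tder_homotopyl M N (D e : M -> M) (E : N -> N) (h p : M -> M) z :
  linear D -> linear e -> linear E -> linear h -> linear p ->
  (forall x, D (h x) + h (D x) = p x - x) -> (forall x, e (h x) = - h (e x)) ->
  tder D e E (tmap h id z) + tmap h id (tder D e E z) = tmap p id z - z.
Proof.
move=> Dl el El hl pl hD he; have idl : linear (fun x : N => x) by [].
have l1 := tder_linear Dl el El; have l2 := tmap_linear hl idl.
have l3 := tmap_linear pl idl.
move: z; apply: tensor_eq.
- by apply: lin_add; [exact: (lin_comp l1 l2) | exact: (lin_comp l2 l1)].
- exact: lin_sub.
move=> x y; rewrite !tmap_tens // !tder_tens //.
rewrite -[D x ⊗ₜ y]scale1r l2 scale1r !tmap_tens // he.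
have tN (a : M) (c : N) : (- a) ⊗ₜ c = - (a ⊗ₜ c).
  by rewrite -scaleN1r tensZl scaleN1r.
have tD (a a' : M) (c : N) : (a + a') ⊗ₜ c = a ⊗ₜ c + a' ⊗ₜ c.
  by have := tens_linearl c 1 a a'; rewrite !scale1r.
have -> : D (h x) = p x - x - h (D x) by rewrite -hD addrK.
by rewrite !tD !tN; zmod.
Qed.
End TensorMaps2.

Section NaturalityInf.
Variables (k : comPzRingType) (A A' B B' : unitalAlgType k).
Variables (f : A -> A') (g : B -> B').
Hypotheses (fm : algebra_morphism f) (gm : algebra_morphism g).
Local Notation fg := (tmap f g).
Let fgm : algebra_morphism fg := tmap_morphism fm gm.
Let ml := Omega_map_linear fgm.
Let mD x y : Omega_map fg (x + y) = Omega_map fg x + Omega_map fg y.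
Proof. by have := ml 1 x y; rewrite !scale1r. Qed.

Lemma phi_inf_natural x : Omega_map fg (phi_inf x) = phi_inf (Omega_map fg x).
Proof.
have e m : Omega_map fg (phi_iter m x) = phi_iter m (Omega_map fg x).
  rewrite /phi_iter; elim: m => [|m IH] /=; first exact: phi_natural.
  by rewrite phi_natural // Omega_map_connes // IH.
have [M h] := phi_iter_eventually0 x.
rewrite (phi_inf_sum h) (@phi_inf_sum _ _ _ (Omega_map fg x) M).
  rewrite -[LHS]/(lin_pack ml _) linear_sum; apply: eq_bigr => m _; exact: e.
by move=> m Mm; rewrite -e h // (linear0f ml).
Qed.

Lemma sh_inf_natural z :
  Omega_map fg (sh_inf z) = sh_inf (tmap (Omega_map f) (Omega_map g) z).
Proof.
by rewrite /sh_inf mD phi_inf_natural (Omega_map_connes fgm) (sh_natural fm gm).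
Qed.

Lemma AW_inf_natural x :
  tmap (Omega_map f) (Omega_map g) (AW_inf x) = AW_inf (Omega_map fg x).
Proof.
by rewrite /AW_inf (AW_natural fm gm) mD (Omega_map_connes fgm) phi_inf_natural.
Qed.
End NaturalityInf.

(** * Components of degrees 0 and 2 *)
Section Truncation.
Variable k : comPzRingType.
Local Notation family M := (nat -> nat -> M -> Prop).

(** f0 and f1 are the components of degrees 0 and 2 of f, whose other components
    have degree at least 4. *)
Record truncation (M N : lmodType k) (P : family M) (Q : family N)
    (f f0 f1 : M -> N) : Prop := Truncation {
  trunc0 : shifts P Q 0 f0;
  trunc1 : shifts P Q 2 f1;
  trunc_tail : shifts P Q 4 (fun x => f x - (f0 x + f1 x))
}.

Lemma truncation_shifts (M N : lmodType k) (P : family M) (Q : family N) f f0 f1 :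
  truncation P Q f f0 f1 -> shifts P Q 0 f.
Proof.
case=> t0 t1 t2.
apply: (@shifts_ext _ _ _ _ _ _ (fun x => (f x - (f0 x + f1 x)) + (f0 x + f1 x))).
  by move=> x; rewrite subrK.
apply: shifts_add; first exact: (@shifts_down _ _ _ _ _ 0 2).
by apply: shifts_add => //; apply: (@shifts_down _ _ _ _ _ 0 1).
Qed.

Lemma truncation_ext (M N : lmodType k) (P : family M) (Q : family N)
    f f0 f1 f' f0' f1' : f =1 f' -> f0 =1 f0' -> f1 =1 f1' ->
  truncation P Q f f0 f1 -> truncation P Q f' f0' f1'.
Proof.
move=> e e0 e1 [t0 t1 t2]; split; [exact: shifts_ext t0|exact: shifts_ext t1|].
by apply: shifts_ext t2 => x; rewrite e e0 e1.
Qed.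

Lemma truncation_even (M N : lmodType k) (P : family M) (Q : family N) f :
  shifts P Q 0 f -> truncation P Q f f (fun _ => 0).
Proof.
have z : linear (fun _ : M => 0 : N) by move=> c x y; rewrite scaler0 addr0.
move=> h; split=> //.
  by split=> // n m x _; apply: Lspan0.
apply: (@shifts_ext _ _ _ _ _ _ (fun _ => 0)).
  by move=> x; rewrite addr0 subrr.
by split=> // n m x _; apply: Lspan0.
Qed.

Lemma truncation_comp (M N L : lmodType k) (P : family M) (Q : family N)
    (R : family L) f f0 f1 g g0 g1 :
  truncation P Q f f0 f1 -> truncation Q R g g0 g1 ->
  truncation P R (fun x => g (f x)) (fun x => g0 (f0 x))
    (fun x => g1 (f0 x) + g0 (f1 x)).
Proof.
move=> tf tg; have [gl _] := truncation_shifts tg.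
case: (tf) (tg) => t0 t1 t2 [u0 u1 u2]; have [g0l _] := u0; have [g1l _] := u1.
split; first exact: shifts_comp t0 u0.
  apply: shifts_add; first exact: shifts_comp t0 u1.
  exact: shifts_comp t1 u0.
apply: (@shifts_ext _ _ _ _ _ _ (fun x =>
  g (f x - (f0 x + f1 x)) + (g (f0 x) - (g0 (f0 x) + g1 (f0 x))) +
  (g (f1 x) - (g0 (f1 x) + g1 (f1 x))) + g1 (f1 x))).
  have gB y z : g (y - z) = g y - g z by exact: (linearB (lin_pack gl)).
  have gD y z : g (y + z) = g y + g z by exact: (linearD (lin_pack gl)).
  by move=> x; rewrite gB gD; zmod.
apply: shifts_add; first apply: shifts_add; first apply: shifts_add.
- exact: shifts_comp t2 (truncation_shifts tg).
- exact: shifts_comp t0 u2.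
- apply: (@shifts_down _ _ _ _ _ 4 1); exact: shifts_comp t1 u2.
exact: shifts_comp t1 u1.
Qed.

Lemma truncation_tmapl (M M' N : lmodType k) (P : family M) (P' : family M')
    (Q : family N) f f0 f1 :
  truncation P P' f f0 f1 ->
  truncation (tensor_gen P Q) (tensor_gen P' Q) (tmap f id) (tmap f0 id) (tmap f1 id).
Proof.
move=> tf; have [fl _] := truncation_shifts tf; case: tf => t0 t1 t2.
split; [exact: shifts_tmapl | exact: shifts_tmapl | ].
apply: shifts_ext (shifts_tmapl Q t2).
have idl : linear (fun x : N => x) by [].
have [f0l _] := t0; have [f1l _] := t1; have [tl _] := t2.
have l1 := tmap_linear f0l idl; have l2 := tmap_linear f1l idl.
apply: tensor_eq; first exact: tmap_linear.
  by apply: lin_sub; [exact: tmap_linear | exact: lin_add].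
move=> x y; rewrite !tmap_tens // -![_ ⊗ₜ y]/(tensl y _) linearB.
by congr (_ - _); exact: linearD.
Qed.

Lemma truncation_tmapr (M N N' : lmodType k) (P : family M) (Q : family N)
    (Q' : family N') f f0 f1 :
  truncation Q Q' f f0 f1 ->
  truncation (tensor_gen P Q) (tensor_gen P Q') (tmap id f) (tmap id f0) (tmap id f1).
Proof.
move=> tf; have [fl _] := truncation_shifts tf; case: tf => t0 t1 t2.
split; [exact: shifts_tmapr | exact: shifts_tmapr | ].
apply: shifts_ext (shifts_tmapr P t2).
have idl : linear (fun x : M => x) by [].
have [f0l _] := t0; have [f1l _] := t1; have [tl _] := t2.
have l1 := tmap_linear idl f0l; have l2 := tmap_linear idl f1l.
apply: tensor_eq; first exact: tmap_linear.
  by apply: lin_sub; [exact: tmap_linear | exact: lin_add].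
move=> x y; rewrite !tmap_tens // linearB.
by congr (_ - _); exact: linearD.
Qed.
End Truncation.

Section InfTruncation.
Variables (k : comPzRingType) (A B : unitalAlgType k).
Variables (wA : weighting A) (wB : weighting B).
Local Notation FAB := (form_weight (tensor_weight wA wB)).
Local Notation F2 := (tensor_gen (form_weight wA) (form_weight wB)).

Definition sh1 (z : Omega A ⊗ Omega B) := phi (connes (sh z)).
Definition AW1 (x : Omega (A ⊗ B)) := AW (connes (phi x)).

Lemma sh_inf_truncation : truncation F2 FAB (@sh_inf k A B) (@sh k A B) sh1.
Proof.
split; [exact: sh_shifts | | exact: sh_inf_tail].
exact: shifts_comp (shifts_comp (@sh_shifts _ _ _ wA wB) (@connes_shifts _ _ _))
  (@phi_shifts _ _ _ wA wB).
Qed.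

Lemma AW_inf_truncation : truncation FAB F2 (@AW_inf k A B) (@AW k A B) AW1.
Proof.
split; [exact: AW_shifts | | exact: AW_inf_tail].
exact: shifts_comp (shifts_comp (@phi_shifts _ _ _ wA wB) (@connes_shifts _ _ _))
  (@AW_shifts _ _ _ wA wB).
Qed.
End InfTruncation.

(** * The composites on three factors *)
Section Triple.
Variables (k : comPzRingType) (A B C : unitalAlgType k).
Local Notation T := (A ⊗ B ⊗ C).
Local Notation Y3 := (Omega3 A B C).
Local Notation Sl := (@sh_inf_left k A B C).
Local Notation Sr := (@sh_inf_right k A B C).
Local Notation Al := (@AW_inf_left k A B C).
Local Notation Ar := (@AW_inf_right k A B C).
(** The homotopy of A ⊗ B and C plus the transport, along its S and A, of the one of
    A and B. *)
Definition H3 (x : Omega T) : Omega T :=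
  phi_inf x + sh_inf (tmap (@phi_inf k A B) id (AW_inf x)).

Let wA := base_weight A.
Let wB := base_weight B.
Let wC := base_weight C.
Local Notation FT := (form_weight (tensor_weight (tensor_weight wA wB) wC)).
Local Notation F3 := (tensor_gen (tensor_gen (form_weight wA) (form_weight wB)) (form_weight wC)).
Local Notation FT' := (form_weight (tensor_weight wA (tensor_weight wB wC))).
Local Notation F3' := (tensor_gen (form_weight wA) (tensor_gen (form_weight wB) (form_weight wC))).

Lemma tassoc_shifts : shifts F3 F3' 0 (@tassoc k (Omega A) (Omega B) (Omega C)).
Proof.
split; first exact: tassoc_linear.
move=> ? ? ? [_ [j [_ [J [_ [z [<- <- [i1 [i2 [I1 [I2 [x [y [<- <- Px Py ->]]]]]]] Pz ->]]]]]]].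
rewrite tassoc_tens addn0; apply: even_span_gen.
exists i1, (i2 + j)%N, I1, (I2 + J)%N, x, (y ⊗ₜ z); rewrite !addnA; split=> //.
by exists i2, j, I2, J, y, z.
Qed.

Lemma tassocV_shifts : shifts F3' F3 0 (@tassocV k (Omega A) (Omega B) (Omega C)).
Proof.
split; first exact: tassocV_linear.
move=> ? ? ? [i [_ [I [_ [x [_ [<- <- Px [i1 [i2 [I1 [I2 [y [z [<- <- Py Pz ->]]]]]]] ->]]]]]]].
rewrite tassocV_tens addn0; apply: even_span_gen.
exists (i + i1)%N, i2, (I + I1)%N, I2, (x ⊗ₜ y), z; rewrite !addnA; split=> //.
by exists i, i1, I, I1, x, y.
Qed.

Lemma Omega_tassoc_shifts : shifts FT FT' 0 (Omega_map (@tassoc k A B C)).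
Proof.
apply: Omega_map_shifts; first exact: tassoc_morphism.
move=> ? ? [_ [j [_ [c [<- [i1 [i2 [a [b [<- wa wb ->]]]]] wc ->]]]]].
exists i1, (i2 + j)%N, a, (b ⊗ₜ c); rewrite addnA tassoc_tens; split=> //.
by exists i2, j, b, c.
Qed.

Lemma Omega_tassocV_shifts : shifts FT' FT 0 (Omega_map (@tassocV k A B C)).
Proof.
apply: Omega_map_shifts; first exact: tassocV_morphism.
move=> ? ? [i [_ [a [_ [<- wa [i1 [i2 [b [c [<- wb wc ->]]]]] ->]]]]].
exists (i + i1)%N, i2, (a ⊗ₜ b), c; rewrite addnA tassocV_tens; split=> //.
by exists i, i1, a, b.
Qed.

Lemma Omega_tassocK : cancel (Omega_map (@tassocV k A B C)) (Omega_map (@tassoc k A B C)).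
Proof.
apply: Omega_mapK; [exact: tassocV_morphism | exact: tassoc_morphism | exact: tassocVK].
Qed.

(** The components of degree 2 of S_r, A_l, S_l and A_r. In degree 0 the two
   bracketings agree. *)
Definition Sr1 (z : Y3) : Omega T :=
  Omega_map (@tassocV k A B C) (sh1 (tmap id (@sh k B C) (tassoc z)) +
    sh (tmap id (@sh1 k B C) (tassoc z))).
Definition Al1 (x : Omega T) : Y3 :=
  tmap (@AW1 k A B) id (AW x) + tmap (@AW k A B) id (AW1 x).
Definition Sl1 (z : Y3) : Omega T :=
  sh1 (tmap (@sh k A B) id z) + sh (tmap (@sh1 k A B) id z).
Definition Ar1 (x : Omega T) : Y3 :=
  tassocV (tmap id (@AW1 k B C) (AW (Omega_map (@tassoc k A B C) x)) +
    tmap id (@AW k B C) (AW1 (Omega_map (@tassoc k A B C) x))).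
Definition S0 (z : Y3) : Omega T := sh (tmap (@sh k A B) id z).
Definition A0 (x : Omega T) : Y3 := tmap (@AW k A B) id (AW x).

Lemma Sr_truncation : truncation F3 FT Sr S0 Sr1.
Proof.
have t1 := truncation_even tassoc_shifts.
have t2 := truncation_tmapr (form_weight wA) (sh_inf_truncation wB wC).
have t3 := sh_inf_truncation wA (tensor_weight wB wC).
have t4 := truncation_even Omega_tassocV_shifts.
have := truncation_comp (truncation_comp (truncation_comp t1 t2) t3) t4.
apply: truncation_ext => z //; first exact: sh_assoc.
have l1 : linear (tmap id (@sh k B C) : Omega A ⊗ (Omega B ⊗ Omega C) -> _).
  by apply: tmap_linear => //; apply: sh_linear.
by rewrite (linear0f l1) addr0 add0r.
Qed.

Lemma Sl_truncation : truncation F3 FT Sl S0 Sl1.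
Proof.
exact: truncation_comp (truncation_tmapl (form_weight wC) (sh_inf_truncation wA wB))
  (sh_inf_truncation (tensor_weight wA wB) wC).
Qed.

Lemma Al_truncation : truncation FT F3 Al A0 Al1.
Proof.
exact: truncation_comp (AW_inf_truncation (tensor_weight wA wB) wC)
  (truncation_tmapl (form_weight wC) (AW_inf_truncation wA wB)).
Qed.

Lemma Ar_truncation : truncation FT F3 Ar A0 Ar1.
Proof.
have t1 := truncation_even Omega_tassoc_shifts.
have t2 := AW_inf_truncation wA (tensor_weight wB wC).
have t3 := truncation_tmapr (form_weight wA) (AW_inf_truncation wB wC).
have t4 := truncation_even tassocV_shifts.
have := truncation_comp (truncation_comp (truncation_comp t1 t2) t3) t4.
apply: truncation_ext => z //; first exact: AW_coassoc.
by rewrite (linear0f (@AW_linear k A (B ⊗ C))) addr0 add0r.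
Qed.
End Triple.

Section Triple2.
Variables (k : comPzRingType) (A B C : unitalAlgType k).
Local Notation T := (A ⊗ B ⊗ C).
Local Notation Y3 := (Omega3 A B C).
Local Notation Sl := (@sh_inf_left k A B C).
Local Notation Sr := (@sh_inf_right k A B C).
Local Notation Al := (@AW_inf_left k A B C).
Local Notation Ar := (@AW_inf_right k A B C).
Local Notation d3 := (@bB3 k A B C).
Local Notation dA_B_C := (tder (@bB k A) (@grading k A)
  (tder (@bB k B) (@grading k B) (@bB k C))).

Let wA := base_weight A.
Let wB := base_weight B.
Let wC := base_weight C.
Local Notation FT := (form_weight (tensor_weight (tensor_weight wA wB) wC)).
Local Notation F3 := (tensor_gen (tensor_gen (form_weight wA) (form_weight wB)) (form_weight wC)).

Local Notation H3 := (@H3 k A B C).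
Local Notation S0 := (@S0 k A B C).
Local Notation A0 := (@A0 k A B C).

Let idl (M : lmodType k) : linear (fun x : M => x).
Proof. by []. Qed.

Lemma sh1_linear (D E : unitalAlgType k) : linear (@sh1 k D E).
Proof.
exact: (lin_comp (@phi_linear k D E) (lin_comp (@connes_linear k _) (@sh_linear k D E))).
Qed.
Lemma AW1_linear (D E : unitalAlgType k) : linear (@AW1 k D E).
Proof.
exact: (lin_comp (@AW_linear k D E) (lin_comp (@connes_linear k _) (@phi_linear k D E))).
Qed.

Lemma AW_sh1 (D E : unitalAlgType k) z : AW (@sh1 k D E z) = 0.
Proof. exact: AW_phi. Qed.
Lemma AW1_sh (D E : unitalAlgType k) z : AW1 (@sh k D E z) = 0.
Proof.
by rewrite /AW1 phi_sh (linear0f (@connes_linear k _)) (linear0f (@AW_linear k D E)).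
Qed.

Lemma S0_right z : S0 z =
  Omega_map (@tassocV k A B C) (sh (tmap id (@sh k B C) (tassoc z))).
Proof. by rewrite sh_assoc. Qed.
Lemma A0_right x : A0 x =
  tassocV (tmap id (@AW k B C) (AW (Omega_map (@tassoc k A B C) x))).
Proof. by rewrite AW_coassoc. Qed.

Lemma A0_S0 z : A0 (S0 z) = z.
Proof.
rewrite /A0 AW_sh (tmap_comp _ (@AW_linear k A B) (idl (M := _)) (@sh_linear k A B) (idl (M := _))).
by rewrite (tmap_ext (@AW_sh k A B) (fun y => erefl y)) tmap_id.
Qed.

Lemma Al1_S0 z : Al1 (S0 z) = 0.
Proof.
rewrite /Al1 AW1_sh AW_sh.
rewrite (tmap_comp _ (@AW1_linear A B) (idl (M := _)) (@sh_linear k A B) (idl (M := _))).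
rewrite tmap_0l => [|y]; last exact: AW1_sh.
by rewrite add0r (linear0f (tmap_linear (@AW_linear k A B) (idl (M := _)))).
Qed.

Lemma A0_Sr1 z : A0 (Sr1 z) = 0.
Proof.
rewrite A0_right.
rewrite /Sr1.
rewrite (Omega_tassocK (_ + _)).
have -> : AW (sh1 (tmap id (@sh k B C) (tassoc z)) +
    sh (tmap id (@sh1 k B C) (tassoc z))) = tmap id (@sh1 k B C) (tassoc z).
  have := @AW_linear k A (B ⊗ C) 1 (sh1 (tmap id (@sh k B C) (tassoc z)))
    (sh (tmap id (@sh1 k B C) (tassoc z))).
  by rewrite AW_sh AW_sh1 scaler0 add0r scale1r.
rewrite (tmap_comp _ (idl (M := _)) (@AW_linear k B C) (idl (M := _)) (@sh1_linear B C)).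
rewrite tmap_0r => [|y]; last exact: AW_sh1.
exact: linear0f (@tassocV_linear k _ _ _).
Qed.

Lemma Ar1_S0 z : Ar1 (S0 z) = 0.
Proof.
rewrite S0_right /Ar1 !(Omega_tassocK (sh _)) AW1_sh AW_sh.
rewrite (tmap_comp _ (idl (M := _)) (@AW1_linear B C) (idl (M := _)) (@sh_linear k B C)).
rewrite tmap_0r => [|y]; last exact: AW1_sh.
rewrite add0r (linear0f (tmap_linear (idl (M := _)) (@AW_linear k B C))).
exact: linear0f (@tassocV_linear k _ _ _).
Qed.

Lemma A0_Sl1 z : A0 (Sl1 z) = 0.
Proof.
rewrite /A0 /Sl1.
have -> : AW (sh1 (tmap (@sh k A B) id z) + sh (tmap (@sh1 k A B) id z)) =
    tmap (@sh1 k A B) id z.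
  have := @AW_linear k (A ⊗ B) C 1 (sh1 (tmap (@sh k A B) id z)) (sh (tmap (@sh1 k A B) id z)).
  by rewrite AW_sh AW_sh1 scaler0 add0r scale1r.
rewrite (tmap_comp _ (@AW_linear k A B) (idl (M := _)) (@sh1_linear A B) (idl (M := _))).
by rewrite tmap_0l => [//|y]; exact: AW_sh1.
Qed.

Lemma base_form3_weight (a : A) s (b : B) t (c : C) u :
  F3 (size s + size t + size u) (size s + size t + size u).+3
    (dform a s ⊗ₜ dform b t ⊗ₜ dform c u).
Proof.
exists (size s + size t)%N, (size u), (size s + size t).+2, (size u).+1.
exists (dform a s ⊗ₜ dform b t), (dform c u); split=> //.
- by rewrite addnS !addSn.
- exact: base_form2_weight.
exact: base_form_weight.
Qed.

(** The composite has the component 1 in degree 0 and 0 in degree 2. The remaining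
    ones have degree at least 4 and vanish, as an element of degree n on three
    factors has at most n + 3 letters. *)
Lemma truncation_cancel S A' S1 A1 :
  truncation F3 FT S S0 S1 -> truncation FT F3 A' A0 A1 ->
  (forall z, A1 (S0 z) = 0) -> (forall z, A0 (S1 z) = 0) -> cancel S A'.
Proof.
move=> tS tA A1S A0S; have [_ _ [tl t]] := truncation_comp tS tA.
have z0 : linear (fun x : Y3 => 0 : Y3) by move=> c x y; rewrite scaler0 addr0.
have e : (fun z => A' (S z) - (A0 (S0 z) + (A1 (S0 z) + A0 (S1 z)))) =1 (fun _ => 0).
  apply: Omega3_eq => // a s b t' c u.
  have /t := base_form3_weight a s b t' c u; move/even_span0; apply; last first.
    by rewrite addn4.
  do 2?apply: tensor_vanishing; exact: form_vanishing.
move=> z; have := e z; rewrite A0_S0 A1S A0S !addr0 => /eqP.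
by rewrite subr_eq0 => /eqP.
Qed.

Lemma Al_Sr : cancel Sr Al.
Proof.
exact: truncation_cancel (@Sr_truncation k A B C) (@Al_truncation k A B C) Al1_S0 A0_Sr1.
Qed.
Lemma Ar_Sl : cancel Sl Ar.
Proof.
exact: truncation_cancel (@Sl_truncation k A B C) (@Ar_truncation k A B C) Ar1_S0 A0_Sl1.
Qed.

Section Parity.
Variables D E : unitalAlgType k.
Let wD := base_weight D.
Let wE := base_weight E.
Let g1 := @form_generates k _ (tensor_weight wD wE).
Let i1 := @form_involution k _ (tensor_weight wD wE).

Lemma grading_phi_inf x :
  grading (@phi_inf k D E x) = - phi_inf (grading x).
Proof.
by rewrite (shifts_involution x g1 i1 i1 (@phi_inf_shifts k D E wD wE)) scaleN1r.
Qed.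
End Parity.

Lemma tassoc_d3 z : tassoc (d3 z) = dA_B_C (tassoc z).
Proof.
have l1 : linear d3 by rewrite /bB3; lin.
have l2 : linear dA_B_C by lin.
have tl := @tassoc_linear k.
move: z; apply: tensor3_eq => [c x y|c x y|x y z]; first by rewrite l1; apply: tl.
  by rewrite (tl _ _ _ c x y); apply: l2.
rewrite tassoc_tens /bB3 !tder_tens ?tmap_tens; try lin.
have tD (M N : lmodType k) (a a' : M) (c : N) : (a + a') ⊗ₜ c = a ⊗ₜ c + a' ⊗ₜ c.
  by have := tens_linearl c 1 a a'; rewrite !scale1r.
have tD' (M N : lmodType k) (a : M) (c c' : N) : a ⊗ₜ (c + c') = a ⊗ₜ c + a ⊗ₜ c'.
  by have := tens_linearr a 1 c c'; rewrite !scale1r.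
have taD u v : tassoc (u + v) = tassoc u + tassoc v :> Omega A ⊗ (Omega B ⊗ Omega C).
  by have := tl _ _ _ 1 u v; rewrite !scale1r.
by rewrite tD taD taD !tassoc_tens (tD' _ _ (grading x) (bB y ⊗ₜ z)) addrA.
Qed.

Lemma bB_Sr z : bB (Sr z) = Sr (d3 z).
Proof.
rewrite /sh_inf_right -(Omega_map_bB (@tassocV_morphism k A B C)) bB_sh_inf tassoc_d3.
congr (Omega_map _ (sh_inf _)); apply: tder_tmapr; try lin.
exact: bB_sh_inf.
Qed.

Lemma d3_Ar x : d3 (Ar x) = Ar (bB x).
Proof.
have e w : d3 (tassocV w) = tassocV (dA_B_C w).
  have e1 := tassoc_d3 (tassocV w); have e2 := tassocK (d3 (tassocV w)).
  have e3 := @tassocVK k (Omega A) (Omega B) (Omega C) w.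
  exact: etrans (esym e2) (congr1 _ (etrans e1 (congr1 dA_B_C e3))).
rewrite /AW_inf_right e (Omega_map_bB (@tassoc_morphism k A B C)) -AW_inf_bB.
congr tassocV; apply: tder_tmapr; try lin.
exact: AW_inf_bB.
Qed.

(** The maps S and A of A ⊗ B and C commute with b + B, so that the commutator with
    the second term of H is S ([b + B, phi_inf] ⊗ 1) A = S_l A_l - S A. The first
    term contributes S A - 1. *)
Lemma H3_homotopy x : bB (H3 x) + H3 (bB x) = Sl (Al x) - x.
Proof.
pose y := AW_inf x.
pose t := tmap (@phi_inf k A B) id : _ -> Omega (A ⊗ B) ⊗ Omega C.
have sD u v : sh_inf (u + v) = sh_inf u + sh_inf v :> Omega T.
  by have := @sh_inf_linear k (A ⊗ B) C 1 u v; rewrite !scale1r.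
have bD u v : bB (u + v) = bB u + bB v :> Omega T.
  by have := @bB_linear k T 1 u v; rewrite !scale1r.
have e1 := phi_inf_homotopy x.
have e2 : bB (sh_inf (t y)) + sh_inf (t (AW_inf (bB x))) =
    sh_inf (tmap (fun x => sh_inf (AW_inf x)) id y) - sh_inf y.
  rewrite bB_sh_inf -AW_inf_bB -sD (tder_homotopyl (p := fun x => sh_inf (AW_inf x))); try lin.
  - by rewrite -[LHS](addrK (sh_inf y)) -sD subrK.
  - exact: phi_inf_homotopy.
  exact: grading_phi_inf.
rewrite /H3 -/y -!/(t _) bD.
have -> : Sl (Al x) = sh_inf (tmap (fun x => sh_inf (AW_inf x)) id y).
  rewrite /sh_inf_left /AW_inf_left tmap_comp //.
    exact: sh_inf_linear.
  exact: AW_inf_linear.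
have -> : sh_inf (tmap (fun x => sh_inf (AW_inf x)) id y) =
    bB (sh_inf (t y)) + sh_inf (t (AW_inf (bB x))) + sh_inf y by rewrite e2 subrK.
by rewrite -[sh_inf y](subrK x) -e1; zmod.
Qed.
End Triple2.

(** * Degrees of the homotopies *)
Section Degrees.
Variable k : comPzRingType.
Local Notation family M := (nat -> nat -> M -> Prop).

Definition degree_span (M : lmodType k) (P : family M) n (x : M) : Prop :=
  lspan (fun y => exists w, P n w y) x.

Definition graded_submodule (M : lmodType k) (D : nat -> M -> Prop) :=
  forall n, D n 0 /\ forall c x y, D n x -> D n y -> D n (c *: x + y).

(** An odd operator maps degree n to a sum of terms of degrees n + 1, n + 3, ...,
    and the terms of equal degree are collected. *)
Lemma shifts_degree (M N : lmodType k) (P : family M) (Q : family N)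
    (degM : nat -> M -> Prop) (degN : nat -> N -> Prop) f :
  shifts P Q 1 f -> (forall n x, degM n x -> degree_span P n x) ->
  graded_submodule degN -> (forall n w y, Q n w y -> degN n y) ->
  forall n x, degM n x -> exists m (y : nat -> N),
    (forall i, degN (n + i.*2.+1)%N (y i)) /\ f x = \sum_(i < m) y i.
Proof.
move=> [fl hf] hP hN hQ n x /hP Px.
suff: lspan (fun y => exists i, degN (n + i.*2.+1)%N y) (f x).
  elim=> [|c y z [j dy] _ [m [u [du ->]]]].
    exists 0%N, (fun _ => 0); split=> [i|]; first by case: (hN (n + i.*2.+1)%N).
    by rewrite big_ord0.
  pose u' i := (if i == j then c *: y else 0) + (if (i < m)%N then u i else 0).
  have d0 i : degN (n + i.*2.+1)%N 0 by case: (hN (n + i.*2.+1)%N).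
  have dP i c' v v' : degN (n + i.*2.+1)%N v -> degN (n + i.*2.+1)%N v' ->
      degN (n + i.*2.+1)%N (c' *: v + v').
    by case: (hN (n + i.*2.+1)%N) => _; apply.
  exists (maxn j.+1 m), u'; split=> [i|].
    have -> : u' i = c *: (if i == j then y else 0) + (if (i < m)%N then u i else 0).
      by rewrite /u'; case: eqP => // _; rewrite scaler0.
    by apply: dP; [case: eqP => [->|_] | case: ifP].
  rewrite big_split; congr (_ + _).
    rewrite -big_mkcond /= (big_pred1 (Ordinal (leq_maxl j.+1 m))) // => i.
  rewrite -big_mkcond /=.
  by rewrite (big_ord_widen _ u (leq_maxr j.+1 m)).
apply: (lspan_map fl _ Px) => y [w /hf]; apply: lspan_sub => z [i Qz].
by apply: lspan_gen; exists i; rewrite -add1n addnA; apply: hQ Qz.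
Qed.

Lemma Omega_deg_submodule (A : unitalAlgType k) : graded_submodule (@Omega_deg k A).
Proof.
have [F0 _ _] := form_compat A.
move=> n; split; first by exists [::]; rewrite ?big_nil.
move=> c _ _ [s hs ->] [t ht ->]; exists ([seq (c *: p.1, p.2) | p <- s] ++ t).
  by rewrite all_cat all_map ht andbT.
rewrite big_cat big_map scaler_sumr /=; congr (_ + _); apply: eq_bigr => p _.
by have := F0 p.2 c p.1 0; rewrite (linear0f (F0 p.2)) !addr0.
Qed.

Lemma tdeg_submodule (M N : lmodType k) (degM : nat -> M -> Prop) (degN : nat -> N -> Prop) :
  graded_submodule degM -> graded_submodule (tdeg degM degN).
Proof.
move=> hM n; split; first by exists [::]; rewrite ?big_nil.
move=> c _ _ [s hs ->] [t ht ->]; exists ([seq (c *: p.1, p.2) | p <- s] ++ t).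
  move=> p; rewrite mem_cat => /orP[/mapP[q /hs [i [j [ij di dj]]] ->]|/ht //].
  exists i, j; split=> //=; case: (hM i) => d0 dP.
  by rewrite -[_ *: _]addr0; apply: dP.
rewrite big_cat big_map scaler_sumr /=; congr (_ + _); apply: eq_bigr => p _.
by rewrite tensZl.
Qed.

Lemma form_weight_deg (A : unitalAlgType k) (W : weighting A) n w x :
  form_weight W n w x -> Omega_deg n x.
Proof.
case=> a [s [<- _ ->]]; exists [:: (a, s)]; first by rewrite /= eqxx.
by rewrite big_seq1.
Qed.

Lemma tensor_gen_deg (M N : lmodType k) (P : family M) (Q : family N)
    (degM : nat -> M -> Prop) (degN : nat -> N -> Prop) n w x :
  (forall n w y, P n w y -> degM n y) -> (forall n w y, Q n w y -> degN n y) ->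
  tensor_gen P Q n w x -> tdeg degM degN n x.
Proof.
move=> hP hQ [i [j [I [J [y [z [<- _ /hP dy /hQ dz ->]]]]]]].
exists [:: (y, z)]; last by rewrite big_seq1.
by move=> p; rewrite inE => /eqP ->; exists i, j.
Qed.

Lemma Omega_deg_span (A : unitalAlgType k) (W : weighting A) n x :
  Omega_deg n x -> degree_span (form_weight W) n x.
Proof.
case=> s /allP hs ->; rewrite big_seq; apply: lspan_sum => p /hs /eqP <-.
by apply: lspan_sub (form_weight_span W p.1 p.2) => y Fy; apply: lspan_gen; eexists; exact: Fy.
Qed.

Lemma tdeg_span (M N : lmodType k) (P : family M) (Q : family N)
    (degM : nat -> M -> Prop) (degN : nat -> N -> Prop) n x :
  (forall n y, degM n y -> degree_span P n y) ->
  (forall n y, degN n y -> degree_span Q n y) ->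
  tdeg degM degN n x -> degree_span (tensor_gen P Q) n x.
Proof.
move=> hP hQ [s hs ->]; rewrite big_seq; apply: lspan_sum => p /hs.
case=> i [j [<- /hP Pp /hQ Qp]].
apply: (lspan_map (tens_linearl p.2) _ Pp) => y [w Py].
apply: (lspan_map (tens_linearr y) _ Qp) => z [w' Qz].
by apply: lspan_gen; exists (w + w')%N, i, j, w, w', y, z.
Qed.
End Degrees.

(** * Naturality on three factors *)
Section TripleNaturality.
Variables (k : comPzRingType) (A B C A' B' C' : unitalAlgType k).
Variables (f : A -> A') (g : B -> B') (l : C -> C').
Hypotheses (fm : algebra_morphism f) (gm : algebra_morphism g) (lm : algebra_morphism l).
Local Notation fgl := (tmap (tmap f g) l).
Let fgm := tmap_morphism fm gm.
Let glm := tmap_morphism gm lm.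
Let fglm := tmap_morphism fgm lm.
Let fglm' := tmap_morphism fm glm.
Let fl := Omega_map_linear fm.
Let gl := Omega_map_linear gm.
Let ll := Omega_map_linear lm.
Let fgl_ := Omega_map_linear fgm.
Let gll := Omega_map_linear glm.

Lemma Omega_map_square (D D1 D2 E : unitalAlgType k) (u1 : D -> D1) (v1 : D1 -> E)
    (u2 : D -> D2) (v2 : D2 -> E) x :
  algebra_morphism u1 -> algebra_morphism v1 ->
  algebra_morphism u2 -> algebra_morphism v2 ->
  (forall a, v1 (u1 a) = v2 (u2 a)) ->
  Omega_map v1 (Omega_map u1 x) = Omega_map v2 (Omega_map u2 x).
Proof.
move=> mu1 mv1 mu2 mv2 e; move: x; apply: Omega_eq.
- exact: (lin_comp (Omega_map_linear mv1) (Omega_map_linear mu1)).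
- exact: (lin_comp (Omega_map_linear mv2) (Omega_map_linear mu2)).
move=> a w; rewrite !Omega_map_form // e -!map_comp.
by congr dform; apply: eq_map => b; exact: e.
Qed.

Let tassoc_fgl t : tassoc (fgl t) = tmap f (tmap g l) (tassoc t).
Proof. by case: fm gm lm => ? _ _ [? _ _] [? _ _]; exact: tassoc_natural. Qed.

Let tassocV_fgl t : tassocV (tmap f (tmap g l) t) = fgl (tassocV t).
Proof.
have e1 := tassoc_fgl (tassocV t); have e2 := tassocVK t.
exact: etrans (congr1 _ (esym (etrans e1 (congr1 _ e2)))) (tassocK _).
Qed.

Lemma H3_natural x : Omega_map fgl (H3 x) = H3 (Omega_map fgl x).
Proof.
rewrite /H3.
have -> : Omega_map fgl (phi_inf x + sh_inf (tmap (@phi_inf k A B) id (AW_inf x))) =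
    Omega_map fgl (phi_inf x) +
    Omega_map fgl (sh_inf (tmap (@phi_inf k A B) id (AW_inf x))).
  by have := Omega_map_linear fglm 1 (phi_inf x)
    (sh_inf (tmap (@phi_inf k A B) id (AW_inf x))); rewrite !scale1r.
rewrite phi_inf_natural // sh_inf_natural // -AW_inf_natural //.
congr (_ + sh_inf _).
have idl (M : lmodType k) : linear (fun x : M => x) by [].
rewrite (tmap_comp _ fgl_ ll (@phi_inf_linear k A B) (idl _)).
rewrite (tmap_comp _ (@phi_inf_linear k A' B') (idl _) fgl_ ll).
by apply: tmap_ext => // y; exact: phi_inf_natural.
Qed.

Lemma sh_inf_right_natural z :
  Omega_map fgl (sh_inf_right z) = sh_inf_right (Omega3_map f g l z).
Proof.
have idl (M : lmodType k) : linear (fun x : M => x) by [].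
rewrite /sh_inf_right /Omega3_map (tassoc_natural z fl gl ll).
have sq y : Omega_map fgl (Omega_map (@tassocV k A B C) y) =
    Omega_map (@tassocV k A' B' C') (Omega_map (tmap f (tmap g l)) y).
  by apply: Omega_map_square => //; exact: tassocV_morphism.
rewrite {}sq sh_inf_natural //; congr (Omega_map _ (sh_inf _)).
rewrite (tmap_comp _ fl gll (idl _) (@sh_inf_linear k B C)).
rewrite (tmap_comp _ (idl _) (@sh_inf_linear k B' C') fl (tmap_linear gl ll)).
by apply: tmap_ext => // y; exact: sh_inf_natural.
Qed.

Lemma AW_inf_right_natural x :
  Omega3_map f g l (AW_inf_right x) = AW_inf_right (Omega_map fgl x).
Proof.
have idl (M : lmodType k) : linear (fun x : M => x) by [].
rewrite /AW_inf_right.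
have sq y : Omega_map (@tassoc k A' B' C') (Omega_map fgl y) =
    Omega_map (tmap f (tmap g l)) (Omega_map (@tassoc k A B C) y).
  by apply: Omega_map_square => //; exact: tassoc_morphism.
rewrite {}sq -AW_inf_natural //.
set y := AW_inf _.
have e : tmap id (@AW_inf k B' C') (tmap (Omega_map f) (Omega_map (tmap g l)) y) =
    tmap (Omega_map f) (tmap (Omega_map g) (Omega_map l)) (tmap id (@AW_inf k B C) y).
  rewrite (tmap_comp _ (idl _) (@AW_inf_linear k B' C') fl gll).
  rewrite (tmap_comp _ fl (tmap_linear gl ll) (idl _) (@AW_inf_linear k B C)).
  by apply: tmap_ext => // u; rewrite -AW_inf_natural.
rewrite {}e; set w := tmap id _ y.
have e1 := tassoc_natural (tassocV w) fl gl ll.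
have e2 := tassocVK w.
rewrite /Omega3_map.
exact: etrans (esym (tassocK _)) (congr1 _ (etrans e1 (congr1 _ e2))).
Qed.
End TripleNaturality.

(** * The two homotopies *)
Section Homotopies.
Variables (k : comPzRingType) (A B C : unitalAlgType k).
Let wA := base_weight A.
Let wB := base_weight B.
Let wC := base_weight C.
Local Notation FT := (form_weight (tensor_weight (tensor_weight wA wB) wC)).
Local Notation F3 := (tensor_gen (tensor_gen (form_weight wA) (form_weight wB)) (form_weight wC)).

Lemma H3_shifts : shifts FT FT 1 (@H3 k A B C).
Proof.
apply: shifts_add; first exact: phi_inf_shifts.
exact: shifts_comp (shifts_comp (@AW_inf_shifts _ _ _ _ _)
  (shifts_tmapl (form_weight wC) (@phi_inf_shifts _ _ _ wA wB))) (@sh_inf_shifts _ _ _ _ _).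
Qed.

Definition sh_homotopy (z : Omega3 A B C) : Omega (A ⊗ B ⊗ C) := H3 (sh_inf_right z).
Definition AW_homotopy (x : Omega (A ⊗ B ⊗ C)) : Omega3 A B C := AW_inf_right (H3 x).

Lemma sh_homotopy_shifts : shifts F3 FT 1 sh_homotopy.
Proof. exact: shifts_comp (truncation_shifts (@Sr_truncation k A B C)) H3_shifts. Qed.
Lemma AW_homotopy_shifts : shifts FT F3 1 AW_homotopy.
Proof. exact: shifts_comp H3_shifts (truncation_shifts (@Ar_truncation k A B C)). Qed.

HB.instance Definition _ := GRing.isLinear.Build k (Omega3 A B C)
  (Omega (A ⊗ B ⊗ C)) *:%R sh_homotopy sh_homotopy_shifts.1.
HB.instance Definition _ := GRing.isLinear.Build k (Omega (A ⊗ B ⊗ C))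
  (Omega3 A B C) *:%R AW_homotopy AW_homotopy_shifts.1.

Lemma sh_homotopyP : homotopy (@Omega3_deg k A B C) (@Omega_deg k (A ⊗ B ⊗ C))
  (@bB3 k A B C) (@bB k (A ⊗ B ⊗ C))
  (@sh_inf_left k A B C) (@sh_inf_right k A B C) sh_homotopy.
Proof.
split.
  apply: (shifts_degree sh_homotopy_shifts).
  - move=> n x; apply: tdeg_span => {n x} n x; last exact: Omega_deg_span.
    by apply: tdeg_span => {n x} n x; exact: Omega_deg_span.
  - exact: Omega_deg_submodule.
  exact: form_weight_deg.
move=> z; have e1 := bB_Sr z; have e2 := H3_homotopy (sh_inf_right z); have e3 := Al_Sr z.
symmetry; rewrite /sh_homotopy.
exact: etrans (congr1 (fun y => bB (H3 (sh_inf_right z)) + H3 y) (esym e1))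
  (etrans e2 (congr1 (fun y => sh_inf_left y - sh_inf_right z) e3)).
Qed.

Lemma AW_homotopyP : homotopy (@Omega_deg k (A ⊗ B ⊗ C)) (@Omega3_deg k A B C)
  (@bB k (A ⊗ B ⊗ C)) (@bB3 k A B C)
  (@AW_inf_left k A B C) (@AW_inf_right k A B C) AW_homotopy.
Proof.
split.
  apply: (shifts_degree AW_homotopy_shifts).
  - exact: Omega_deg_span.
  - by do 2!apply: tdeg_submodule; exact: Omega_deg_submodule.
  move=> n w y; apply: tensor_gen_deg => {n w y} n w y; last exact: form_weight_deg.
  by apply: tensor_gen_deg => {n w y} n w y; exact: form_weight_deg.
have [rl _] := truncation_shifts (@Ar_truncation k A B C).
have rD y y' : AW_inf_right (y + y') = AW_inf_right y + AW_inf_right y' :> Omega3 A B C.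
  by have := rl 1 y y'; rewrite !scale1r.
have rB y y' : AW_inf_right (y - y') = AW_inf_right y - AW_inf_right y' :> Omega3 A B C.
  by rewrite addrC -scaleN1r rl scaleN1r addrC.
move=> x; have e1 := d3_Ar (H3 x); have e2 := H3_homotopy x.
have e3 := Ar_Sl (AW_inf_left x).
symmetry; rewrite /AW_homotopy.
exact: etrans (congr1 (fun y => y + AW_inf_right (H3 (bB x))) e1)
  (etrans (esym (rD _ _)) (etrans (congr1 _ e2) (etrans (rB _ _)
    (congr1 (fun y => y - AW_inf_right x) e3)))).
Qed.
End Homotopies.

Theorem proposition4p7 (k : comPzRingType) :
  (exists h : forall A B C : unitalAlgType k,
       {linear Omega3 A B C -> Omega (A ⊗ B ⊗ C)},
     (forall A B C : unitalAlgType k,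
        homotopy (@Omega3_deg k A B C) (@Omega_deg k (A ⊗ B ⊗ C))
          (@bB3 k A B C) (@bB k (A ⊗ B ⊗ C))
          (@sh_inf_left k A B C) (@sh_inf_right k A B C) (h A B C)) /\
     (forall (A B C A' B' C' : unitalAlgType k)
        (f : A -> A') (g : B -> B') (l : C -> C'),
        algebra_morphism f -> algebra_morphism g -> algebra_morphism l ->
        forall z : Omega3 A B C,
          h A' B' C' (Omega3_map f g l z) =
          Omega_map (tmap (tmap f g) l) (h A B C z))) /\
  (exists h : forall A B C : unitalAlgType k,
       {linear Omega (A ⊗ B ⊗ C) -> Omega3 A B C},
     (forall A B C : unitalAlgType k,
        homotopy (@Omega_deg k (A ⊗ B ⊗ C)) (@Omega3_deg k A B C)
          (@bB k (A ⊗ B ⊗ C)) (@bB3 k A B C)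
          (@AW_inf_left k A B C) (@AW_inf_right k A B C) (h A B C)) /\
     (forall (A B C A' B' C' : unitalAlgType k)
        (f : A -> A') (g : B -> B') (l : C -> C'),
        algebra_morphism f -> algebra_morphism g -> algebra_morphism l ->
        forall x : Omega (A ⊗ B ⊗ C),
          h A' B' C' (Omega_map (tmap (tmap f g) l) x) =
          Omega3_map f g l (h A B C x))).
Proof.
split.
  exists (fun A B C => @sh_homotopy k A B C); split=> [A B C|]; first exact: sh_homotopyP.
  move=> A B C A' B' C' f g l fm gm lm z /=.
  by rewrite /sh_homotopy H3_natural // sh_inf_right_natural.
exists (fun A B C => @AW_homotopy k A B C); split=> [A B C|]; first exact: AW_homotopyP.
move=> A B C A' B' C' f g l fm gm lm x /=.
by rewrite /AW_homotopy -H3_natural // AW_inf_right_natural.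
Qed.
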